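(* (Weighted $L^2$-$L^2$ estimate.) Let $0<\mu<2$, let $\phi(u,\bar u)$ solve $$\begin{cases}\phi_{u\bar u}+\dfrac{\mu(2-\mu)\,\phi}{4(u+\bar u)^2}=G(u,\bar u),\\[4pt] t=0:\ \phi=\varepsilon r\psi_0,\quad \phi_t=\varepsilon r\psi_1,\end{cases}$$ and let $\bar U\ge\frac12$ be a constant. Then for $0\le s\le1$ there holds $$\sup_{\frac12\le\bar u\le\bar U}\left(\int_{\max(\bar u,2-\bar u)}^{+\infty}u^{3s}(u-\bar u)^s\phi_u^2\,du\right)^{\frac12}\lesssim \varepsilon\left(\|\psi_0\|_{H^1(\mathbb{R}^3)}^2+\|\psi_1\|_{L^2(\mathbb{R}^3)}^2\right)^{\frac12}+\int_{\frac12}^{\bar U}\left(\int_{\max(\bar u,2-\bar u)}^{+\infty}u^{3s}(u-\bar u)^sG^2\,du\right)^{\frac12}d\bar u .$$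
   Context: Coordinates: for $t\ge0$, $r\ge0$ set $u=\frac{t+2+r}{2}$, $\bar u=\frac{t+2-r}{2}$, so that $t=u+\bar u-2$, $r=u-\bar u$, $\partial_u=\partial_t+\partial_r$, $\partial_{\bar u}=\partial_t-\partial_r$; the region $t\ge0$, $r\ge0$ corresponds to $u\ge\max(\bar u,2-\bar u)$. The function $\phi$ is of the form $\phi(u,\bar u)=(u-\bar u)\,\psi(u+\bar u-2,u-\bar u)$, i.e. $\phi=r\psi$ with $\psi(t,r)$ a radial function on $\mathbb{R}^3$ for each $t\ge 0$ (so $\phi=0$ at $r=0$). The functions $\psi_0\in H^1(\mathbb{R}^3)$, $\psi_1\in L^2(\mathbb{R}^3)$ are radial and supported in $\{r\le1\}$, $\varepsilon>0$, and the solution vanishes for $\bar u\le\frac12$. The notation $A\lesssim B$ means $A\le CB$ with a constant $C>0$ independent of $\phi,G,\psi_0,\psi_1,\varepsilon,\bar U$.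
   Formalization: For 3/4 ≤ s ≤ 1 it is assumed that the integrals on the left are finite for 1/2 ≤ ū ≤ Ū; otherwise the estimate fails, e.g. for G=0, ψ0=0 and ψ1≥0 a bump near r=0.85, where φ_u ~ -K u^{-2} makes the left side infinite and the right side finite. *)

(* Defs.v *)
From HB Require Import structures.
From mathcomp Require Export all_boot all_order all_algebra.
From mathcomp Require Export all_classical all_reals all_analysis.

Set Implicit Arguments.
Unset Strict Implicit.
Unset Printing Implicit Defensive.

Import Order.TTheory GRing.Theory Num.Theory.
Import numFieldNormedType.Exports.

Local Open Scope classical_set_scope.
Local Open Scope ring_scope.

Section Euclidean3.
Context (R : realType).

Definition leb1 := @lebesgue_measure R.
Definition leb2 := (leb1 \x leb1)%E.
Definition leb3 := (leb2 \x leb1)%E.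

Definition enorm3 (x : R * R * R) : R :=
  Num.sqrt (x.1.1 ^+ 2 + x.1.2 ^+ 2 + x.2 ^+ 2).

Definition basis3 (i : 'I_3) : R * R * R :=
  (((i == 0 :> nat)%:R, (i == 1 :> nat)%:R), (i == 2 :> nat)%:R).

(* The radial function on R^3 with profile f : [0, +oo) -> R; the values of
   the profile at negative arguments play no role. *)
Definition radial (f : R -> R) : R * R * R -> R := fun x => f (enorm3 x).

Definition sqL2 (f : R * R * R -> R) : \bar R :=
  (\int[leb3]_x (f x ^+ 2)%:E)%E.

Definition in_L2 (f : R * R * R -> R) : Prop :=
  measurable_fun setT f /\ (sqL2 f < +oo)%E.

Definition test_function (chi : R * R * R -> R) : Prop :=
  [/\ forall i x, derivable chi x (basis3 i),
      forall i, continuous (fun x => 'D_(basis3 i) chi x) &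
      exists M : R, forall x, M < enorm3 x -> chi x = 0].

Definition weak_gradient (f : R * R * R -> R) (g : 'I_3 -> R * R * R -> R) :=
  forall i chi, test_function chi ->
    (\int[leb3]_x (f x * 'D_(basis3 i) chi x) =
     - \int[leb3]_x (g i x * chi x))%R.

(* f belongs to H^1(R^3), with gradient g. *)
Definition in_H1 (f : R * R * R -> R) (g : 'I_3 -> R * R * R -> R) : Prop :=
  [/\ in_L2 f, forall i, in_L2 (g i) & weak_gradient f g].

Definition sqH1 (f : R * R * R -> R) (g : 'I_3 -> R * R * R -> R) : \bar R :=
  (sqL2 f + \sum_(i < 3) sqL2 (g i))%E.

End Euclidean3.

Section Problem.
Context (R : realType).
Implicit Types (phi phiu phiub G : R -> R -> R).

Local Notation leb := (@leb1 R).

(* Below ub stands for \bar u. *)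
Definition ucoord (t r : R) : R := (t + 2 + r) / 2.
Definition ubcoord (t r : R) : R := (t + 2 - r) / 2.

Definition lowu (ub : R) : R := Num.max ub (2 - ub).

(* Image of the quarter plane t >= 0, r >= 0. *)
Definition region : set (R * R) := [set p | lowu p.2 <= p.1].

(* F is absolutely continuous on [a, b], with a.e. derivative f. *)
Definition primitive_on (a b : R) (F f : R -> R) : Prop :=
  leb.-integrable `[a, b] (EFin \o f) /\
  forall x y, a <= x -> x <= y -> y <= b ->
    F y - F x = \int[leb]_(z in `[x, y]) f z.

Definition phi_uub_rhs (mu : R) phi G (u ub : R) : R :=
  G u ub - mu * (2 - mu) * phi u ub / (4 * (u + ub) ^+ 2).

(* phi solves the initial value problem, phiu and phiub being its derivatives
   in u and in ub.  As the data are only in H^1 x L^2, phi need not be twice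
   differentiable: derivatives are those of functions absolutely continuous
   along characteristics, and the equation means that phiu is absolutely
   continuous in ub for almost every u, with derivative phi_uub_rhs (and
   likewise for phiub).  This gives phiu and phiub traces at t = 0 for almost
   every r, hence a meaning to phi_t = (phiu + phiub) / 2 there.
   On u <= B, lowu ub <= u amounts to 2 - u <= ub <= u. *)
Record solution (mu : R) phi phiu phiub G (eps : R)
    (psi0 psi1 : R -> R) : Prop := {
  sol_radial : exists psi : R -> R -> R, forall u ub, lowu ub <= u ->
    phi u ub = (u - ub) * psi (u + ub - 2) (u - ub);
  sol_cont : {within region, continuous (fun p : R * R => phi p.1 p.2)};
  sol_source : forall B : R,
    (@leb2 R).-integrable (region `&` [set p | p.1 <= B])
      (fun p => (G p.1 p.2)%:E);
  sol_u : forall ub B, lowu ub <= B ->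
    primitive_on (lowu ub) B (phi ^~ ub) (phiu ^~ ub);
  sol_ub : forall u, 1 <= u -> primitive_on (2 - u) u (phi u) (phiub u);
  sol_eq_u : {ae leb, forall u : R, 1 <= u ->
    primitive_on (2 - u) u (phiu u) (phi_uub_rhs mu phi G u)};
  sol_eq_ub : {ae leb, forall ub : R, forall B, lowu ub <= B ->
    primitive_on (lowu ub) B (phiub ^~ ub) ((phi_uub_rhs mu phi G) ^~ ub)};
  sol_init : {ae leb, forall r : R, 0 <= r ->
    phi (ucoord 0 r) (ubcoord 0 r) = eps * r * psi0 r};
  sol_init_t : {ae leb, forall r : R, 0 <= r ->
    (phiu (ucoord 0 r) (ubcoord 0 r) + phiub (ucoord 0 r) (ubcoord 0 r)) / 2
    = eps * r * psi1 r}
}.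

Definition weighted_sq (s : R) (f : R -> R -> R) (ub : R) : \bar R :=
  (\int[leb]_(u in `[lowu ub, +oo[)
     (u `^ (3 * s) * (u - ub) `^ s * f u ub ^+ 2)%:E)%E.

(* When 3/4 <= s, the integral of the weighted square of phi_u can diverge
   although the data and G are finite: for G = 0 one has
   phi_u ~ - mu (2 - mu) / 4 * u^-2 * \int_(1/2)^ub phi(+oo, x) dx
   as u -> +oo, while the weight grows like u^(4 s).  For those s the estimate
   concerns solutions for which its left-hand side is meaningful. *)
Definition admissible (s : R) phiu (Ub : R) : Prop :=
  3 / 4 <= s -> forall ub, 1 / 2 <= ub -> ub <= Ub ->
    (weighted_sq s phiu ub < +oo)%E.

End Problem.

(* Main.v *)
From HB Require Import structures.
Require Import Defs.
From mathcomp Require Import all_boot all_order all_algebra.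
From mathcomp Require Import all_classical all_reals all_analysis.
From mathcomp Require Import ring lra measurable_realfun.

Set Implicit Arguments.
Unset Strict Implicit.
Unset Printing Implicit Defensive.

Import Order.TTheory GRing.Theory Num.Theory.
Import numFieldNormedType.Exports.

Local Open Scope classical_set_scope.
Local Open Scope ring_scope.

(** Along a line ub = cst the equation is an ordinary differential equation in u
for phi, with [phiu] as its derivative; along a ray u = cst it gives [phiu]
itself.  Integrating the equation in ub from the initial line, or from ub = 1/2
where phi vanishes, one finds

  phiu + potential_term a phi = trace on the initial line + integral of G

with a = mu (2 - mu) / 4 in (0, 1/4].  The right-hand side is controlled in the
weighted norm by M = C (eps |data| + I), where I is the source norm of the
theorem: the trace by the data, since the weight is bounded on the bounded part
of the initial line that carries the data, and the integral of G by Minkowski's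
inequality ([minkowski_integral], [source_norm]), since the weight decreases in
ub.  The potential term has to be absorbed, and this is a nonlocal but linear
problem for phi alone: the Cauchy-Schwarz inequality in u turns a bound on the
sum into a bound on the increments of phi up to the potential, and a pointwise
bound on phi improves the potential by a factor less than 1 because a <= 1/4 and
because of the decay of (u + x)^-2.  The record [flux_control] contains what
this argument uses.

Three regimes occur.  For s <= 1/2 one bootstraps the rate
|phi| <= c M u^(1 - 2 s) ub^(-1/2), starting from the axis or the initial line
([low_regime]).  For 1/2 <= s < 3/4 the function phi has a limit in u, and this
profile must be estimated before the rate of convergence; the leading part of the
potential is then a times the primitive of the profile over u^2, its sign is
favourable, and it enters through a scalar linear equation ([mid_regime], with
[linear_ode_bound]).  For s >= 3/4 that leading part is not in the weighted
space, so that finiteness of the norm of [phiu] forces the profile to vanish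
([high_decay]); then one can integrate from infinity instead, and the supremum of
the norms satisfies Y <= 2 M^2 + Y / 8 ([high_regime]).

For the trace, write w = r psi0 for the profile of the first datum.  On t = 0 the
trace of phiu is eps (r psi1 + w') almost everywhere ([ae_trace_u]); this rests on
Green's formula in a characteristic triangle ([initial_increment]), which shows
that w is absolutely continuous.  The square integrability of w' is the one point
where psi0 in H^1 is used ([radial_derivative_L2]): in polar coordinates the
gradient of psi0 is psi0', and the integral of (r psi0')^2 dominates that of w'^2
by Hardy's identity for w^2 / r.  As the gradient is weak, the argument is carried
out for difference quotients of w, tested by duality against radial fields
([radial_gradient_test]), and Fatou's lemma removes the regularization. *)

(** * Real powers and elementary integrals *)

(** The cost of [lra] grows with the nonlinear atoms among the hypotheses that it
reads.  Below, [slra] first tries with the facts that are affine in obvious atoms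
and falls back on all order facts. *)
Ltac keep_order_facts :=
  repeat match goal with
  | H : ?T |- _ =>
    lazymatch type of T with Prop =>
      lazymatch T with
      | is_true (@Order.le ring_display _ _ _) => fail
      | is_true (@Order.lt ring_display _ _ _) => fail
      | @eq _ _ _ => fail
      | _ => clear H
      end
    end
  | x := _ |- _ => clearbody x
  end.

Ltac keep_affine_facts :=
  repeat match goal with
  | H : context [@powR _ _ _] |- _ => clear H
  | H : context [@Num.norm _ _ _] |- _ => clear H
  | H : context [@GRing.exp _ _ _] |- _ => clear H
  | H : context [@GRing.mul _ ?x ?y] |- _ => is_var x; is_var y; clear H
  | H : context [@Rintegral _ _ _ _ _ _] |- _ => clear H
  end.

Ltac slra := keep_order_facts; first [solve [keep_affine_facts; lra] | lra].

Section toolkit.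
Context (R : realType).
Local Notation leb := (@lebesgue_measure R).
Implicit Types (a b u x : R).

Lemma powR_add (x r t : R) : 0 < x -> x `^ (r + t) = x `^ r * x `^ t.
Proof. by move=> x0; rewrite powRD// (gt_eqF x0) implybT. Qed.

Lemma powR_sq (x r : R) : (x `^ r) ^+ 2 = x `^ (2 * r).
Proof. by rewrite mulrC powRrM -powR_mulrn ?powR_ge0. Qed.

Lemma powR_half_sq (x : R) : 0 <= x -> (x `^ (1 / 2)) ^+ 2 = x.
Proof. by move=> x0; rewrite powR_sq mulrCA mulfV// mulr1 powRr1. Qed.

Lemma le_powR_neg (x y r : R) : 0 < x -> x <= y -> r <= 0 -> y `^ r <= x `^ r.
Proof.
move=> x0 xy; rewrite -oppr_ge0 -[in X in _ -> X](opprK r) => r0.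
rewrite (powRN x) (powRN y).
have y0 : 0 < y := lt_le_trans x0 xy.
rewrite lef_pV2 ?posrE ?powR_gt0//; apply: ge0_ler_powR => //.
- by rewrite nnegrE ltW.
- by rewrite nnegrE ltW.
Qed.

Lemma le_powR_pos (x y r : R) : 0 <= x -> x <= y -> 0 <= r -> x `^ r <= y `^ r.
Proof.
move=> x0 xy r0; apply: ge0_ler_powR => //; rewrite nnegrE//.
exact: le_trans xy.
Qed.

Lemma powR_le1 (x r : R) : 0 <= x -> x <= 1 -> 0 <= r -> x `^ r <= 1.
Proof. by move=> x0 x1 r0; have := le_powR_pos x0 x1 r0; rewrite powR1. Qed.

Lemma powR_invl (x r : R) : 0 < x -> x^-1 `^ r = (x `^ r)^-1.
Proof. by move=> x0; rewrite -(powR_inv1 (ltW x0)) -powRrM mulN1r powRN. Qed.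

Lemma powRN2 (x : R) : 0 <= x -> x `^ (-2) = x ^- 2.
Proof. by exact: powR_invn. Qed.

(** Bootstrap: an a priori finite quantity that improves every bound P to c + q P
is at most the fixed point c / (1 - q). *)
Lemma contraction_bound (T : Type) (D : set T) (X : T -> R) (c q : R) :
  q < 1 -> (exists K : R, forall t, D t -> X t <= K) ->
  (forall P : R, 0 <= P -> (forall t, D t -> X t <= P) ->
     forall t, D t -> X t <= c + q * P) ->
  (forall t, D t -> 0 <= X t) ->
  forall t, D t -> X t <= c / (1 - q).
Proof.
move=> q1 [K XK] step X0 t0 Dt0.
pose S := [set X t | t in D].
have hS : has_sup S.
  split; first by exists (X t0), t0.
  by exists K => _ [t Dt <-]; exact: XK.
have ubS t : D t -> X t <= sup S.
  by move=> Dt; apply: sup_upper_bound => //; exists t.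
have S0 : 0 <= sup S by apply: le_trans (ubS _ Dt0); exact: X0.
have le : sup S <= c + q * sup S.
  apply: ge_sup; first by exists (X t0), t0.
  by move=> _ [t Dt <-]; exact: step.
apply: (le_trans (ubS _ Dt0)); rewrite ler_pdivlMr ?subr_gt0//.
by rewrite mulrBr mulr1 lerBlDr (mulrC _ q).
Qed.

Local Open Scope ereal_scope.

(** The primitive need not extend continuously to the end points, which is
what allows integrable singularities there. *)
Lemma integral_le_primitive (f F : R -> R) a b (l h : R) : (a <= b)%R ->
  (l <= h)%R ->
  (forall x, (a < x < b)%R -> is_derive x 1%R F (f x)) ->
  (forall x, (a < x < b)%R -> {for x, continuous f}) ->
  (forall x, (a < x < b)%R -> 0 <= f x)%R ->
  (forall x, (a < x < b)%R -> l <= F x <= h)%R ->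
  \int[leb]_(x in `[a, b]) (f x)%:E <= (h - l)%:E.
Proof.
rewrite le_eqVlt => /predU1P[-> lh _ _ _ _|ab lh dF cf f0 Flh].
  by rewrite set_itv1 integral_set1 lee_fin subr_ge0.
have mf : measurable_fun `]a, b[ (fun x => (f x)%:E).
  apply/measurable_EFinP; apply: open_continuous_measurable_fun => //.
  by move=> x; rewrite inE/= in_itv/= => /cf.
rewrite (integral_itv_bndoo _ _ mf).
have := @ge0_nondecreasing_set_cvg_integral _ (measurableTypeR R) R
  (fun n => `[(a + (b - a) / n.+3%:R)%R, (b - (b - a) / n.+3%:R)%R]%classic)
  (fun x => (f x)%:E) leb.
pose e n : R := ((b - a) / n.+3%:R)%R.
have e0 n : (0 < e n)%R by rewrite divr_gt0// subr_gt0.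
have e2 n : (e n < (b - a) / 2)%R.
  by rewrite ltr_pM2l ?subr_gt0// ltf_pV2 ?posrE// ltr_nat.
have sub n x : (a + e n <= x <= b - e n)%R -> (a < x < b)%R.
  by have := e0 n; move=> ? /andP[? ?]; apply/andP; split; lra.
have enm n m : (n <= m)%N -> (e m <= e n)%R.
  by move=> nm; rewrite ler_pM2l ?subr_gt0// lef_pV2 ?posrE// ler_nat !ltnS.
have -> : \bigcup_n `[(a + e n)%R, (b - e n)%R]%classic = `]a, b[%classic.
  apply/seteqP; split => [x [n _]/=|x/=]; rewrite !in_itv/=; first exact: sub.
  move=> /andP[ax xb].
  have [n hn] : exists n, (e n < Num.min (x - a) (b - x))%R.
    have m0 : (0 < Num.min (x - a) (b - x))%R by rewrite lt_min !subr_gt0 ax.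
    have := ltr_add_invr; move=> /(_ R 0%R (Num.min (x - a) (b - x) / (b - a))%R).
    rewrite divr_gt0 ?subr_gt0// => /(_ isT) [k hk].
    exists k; rewrite /e mulrC -ltr_pdivlMr ?subr_gt0//.
    apply: le_lt_trans hk; rewrite add0r lef_pV2 ?posrE// ler_nat.
    by rewrite !ltnS ltnW.
  exists n => //=; rewrite in_itv/=; move: hn; rewrite lt_min => /andP[h1 h2].
  by apply/andP; split; lra.
move=> cv.
apply: (cvge_le _ (cv _ _ _ _)) => //; last first.
- by move=> n x /=; rewrite in_itv/= lee_fin => /sub/f0.
- move=> n; apply: measurable_funS mf => // x/=; rewrite !in_itv/=; exact: sub.
- move=> n m nm; rewrite subsetEset => x /=; rewrite !in_itv/=.
  rewrite -/(e n) -/(e m).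
  by have := enm _ _ nm => ? /andP[? ?]; apply/andP; split; lra.
apply: nearW => n; rewrite -/(e n).
have en := e2 n.
have anb : (a + e n < b - e n)%R by lra.
have sub' x : x \in `[(a + e n)%R, (b - e n)%R] -> (a < x < b)%R.
  by rewrite in_itv/=; exact: sub.
rewrite (@continuous_FTC2 _ f F _ _ anb).
- have /Flh /andP[? ?] : (a < a + e n < b)%R by have := e0 n => ?; apply/andP; split; lra.
  have /Flh /andP[? ?] : (a < b - e n < b)%R by have := e0 n => ?; apply/andP; split; lra.
  by rewrite -EFinB lee_fin lerB.
- apply: continuous_in_subspaceT => x; rewrite inE => /sub' xab; exact: cf.
- have cF x : (a < x < b)%R -> {for x, continuous F}.
    move=> /dF [dFx _]; apply: differentiable_continuous.
    exact/derivable1_diffP.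
  split.
  + move=> x xi; suff /dF[] : (a < x < b)%R by [].
    by apply: sub'; exact: subset_itv_oo_cc xi.
  + apply: cvg_at_right_filter; apply: cF; apply: sub'.
    by rewrite in_itv/= lexx ltW.
  + apply: cvg_at_left_filter; apply: cF; apply: sub'.
    by rewrite in_itv/= lexx ltW.
- move=> x xi; have /dF dFx : (a < x < b)%R.
    by apply: sub'; exact: subset_itv_oo_cc xi.
  by rewrite derive1E; apply: derive_val.
Qed.

Lemma integral_itvcy_le (f : R -> R) a (K : \bar R) :
  measurable_fun `[a, +oo[ f ->
  (forall x, (a <= x)%R -> 0 <= f x)%R ->
  (forall b, (a <= b)%R -> \int[leb]_(x in `[a, b]) (f x)%:E <= K) ->
  \int[leb]_(x in `[a, +oo[) (f x)%:E <= K.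
Proof.
move=> mf f0 fK.
have := @ge0_nondecreasing_set_cvg_integral _ (measurableTypeR R) R
  (fun n => `[a, (a + n%:R)%R]%classic) (fun x => (f x)%:E) leb.
have -> : \bigcup_n `[a, (a + n%:R)%R]%classic = `[a, +oo[%classic.
  apply/seteqP; split => [x [n _]/=|x/=]; rewrite !in_itv/=.
    by move=> /andP[->].
  rewrite andbT => ax; exists (Num.truncn (x - a)).+1 => //=.
  rewrite in_itv/= ax/= -lerBlDl; apply: ltW; apply: truncnS_gt.
move=> cv.
apply: (cvge_le _ (cv _ _ _ _)) => //; last first.
- by move=> n x /=; rewrite in_itv/= lee_fin => /andP[/f0].
- move=> n; apply/measurable_EFinP; apply: measurable_funS mf => // x/=.
  by rewrite !in_itv/= => /andP[->].
- move=> n m nm; rewrite subsetEset => x /=; rewrite !in_itv/=.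
  by move=> /andP[-> h]/=; apply: le_trans h _; rewrite lerD2l ler_nat.
by apply: nearW => n; apply: fK; rewrite lerDl.
Qed.

Lemma is_derive_invr (x : R) : x != 0%R ->
  is_derive x 1%R (fun y : R => y^-1)%R (- x ^- 2)%R.
Proof.
move=> x0; have h : is_derive x 1%R (fun y : R => y) 1%R by exact: is_derive_id.
have := @is_deriveV _ (fun y : R => y) x 1%R 1%R x0 h.
by rewrite /GRing.scale/= mulr1.
Qed.

Lemma continuous_invr (x : R) : x != 0%R -> {for x, continuous (fun y : R => y^-1)%R}.
Proof. by move=> x0; exact: cvgV. Qed.

Lemma integral_inv23 (c2 c3 u1 u2 : R) : (0 < u1)%R -> (u1 <= u2)%R ->
  leb.-integrable `[u1, u2] (fun u => (c2 / u ^+ 2 + 2 * c3 / u ^+ 3)%:E) /\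
  (\int[leb]_(u in `[u1, u2]) (c2 / u ^+ 2 + 2 * c3 / u ^+ 3) =
   c2 * (u1^-1 - u2^-1) + c3 * (u1 ^- 2 - u2 ^- 2))%R.
Proof.
move=> u10; rewrite le_eqVlt => /predU1P[<-|u12].
  rewrite set_itv1 Rintegral_set1 !subrr !mulr0 addr0; split => //.
  apply: null_set_integrable => //; last exact: lebesgue_measure_set1.
  exact: measurable_fun_set1.
pose f u := (c2 / u ^+ 2 + 2 * c3 / u ^+ 3)%R : R.
pose F u := (- c2 * u^-1 - c3 * (u^-1) ^+ 2)%R : R.
have dF u : (0 < u)%R -> is_derive u 1%R F (f u).
  move=> u0; have u0' : u != 0%R by rewrite gt_eqF.
  have iV := is_derive_invr u0'; rewrite /F; apply: is_derive_eq.
  rewrite /f /GRing.scale/=; field.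
  exact: u0'.
have cf : {within `[u1, u2], continuous f}.
  apply: continuous_in_subspaceT => x; rewrite inE/= in_itv/= => /andP[ux _].
  have x0 : x != 0%R by rewrite gt_eqF// (lt_le_trans u10).
  rewrite /f; apply: cvgD; apply: cvgM; try exact: cvg_cst.
    apply: cvgV; first by rewrite expf_neq0.
    exact: exprn_continuous.
  apply: cvgV; first by rewrite expf_neq0.
  exact: exprn_continuous.
split; first exact: continuous_compact_integrable (@segment_compact _ u1 u2) cf.
have cF x : (0 < x)%R -> {for x, continuous F}.
  move=> /dF [dFx _]; apply: differentiable_continuous.
  exact/derivable1_diffP.
rewrite /Rintegral (@continuous_FTC2 _ f F _ _ u12) //=.
- by rewrite /F; rewrite !exprVn; ring.
- split.
  + move=> x; rewrite in_itv/= => /andP[ux _].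
    by have [] := dF _ (lt_trans u10 ux).
  + by apply: cvg_at_right_filter; exact: cF.
  + by apply: cvg_at_left_filter; apply: cF; exact: lt_trans u12.
- move=> x; rewrite in_itv/= => /andP[ux _].
  by have h := dF _ (lt_trans u10 ux); rewrite derive1E; apply: derive_val.
Qed.

Lemma integral_inv2_le (u1 u2 : R) : (0 < u1)%R -> (u1 <= u2)%R ->
  \int[leb]_(u in `[u1, u2]) (u ^- 2)%:E <= (u1^-1 - u2^-1)%:E.
Proof.
move=> u10 u12.
have u20 := lt_le_trans u10 u12.
have := @integral_le_primitive (fun u => u ^- 2)%R (fun u => - u^-1)%R u1 u2
  (- u1^-1)%R (- u2^-1)%R u12.
rewrite opprK (addrC (- _)%R); apply.
- by rewrite lerN2 lef_pV2.
- move=> x /andP[ux _]; have x0 : x != 0%R by rewrite gt_eqF// (lt_trans u10).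
  by have iV := is_derive_invr x0; apply: is_derive_eq; rewrite opprK.
- move=> x /andP[ux _]; have x0 : x != 0%R by rewrite gt_eqF// (lt_trans u10).
  apply: cvgV; first by rewrite expf_neq0.
  exact: exprn_continuous.
- by move=> x /andP[ux _]; rewrite invr_ge0 exprn_ge0// ltW// (lt_trans u10).
- move=> x /andP[ux xu]; have x0 := lt_trans u10 ux.
  by rewrite !lerN2 !lef_pV2 ?posrE// !ltW.
Qed.

Lemma continuous_powR_pos (r x : R) : (0 < x)%R -> {for x, continuous (fun y => y `^ r)%R}.
Proof.
move=> x0; apply: differentiable_continuous; apply/derivable1_diffP.
by have [] := is_derive1_powR r x0.
Qed.

Lemma integral_powR_le (r a b : R) : (-1 < r)%R -> (0 <= a)%R -> (a <= b)%R ->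
  \int[leb]_(x in `[a, b]) (x `^ r)%:E <= ((b `^ (r + 1) - a `^ (r + 1)) / (r + 1))%:E.
Proof.
move=> r1 a0 ab; rewrite mulrBl.
have r10 : (0 < r + 1)%R by lra.
apply: (integral_le_primitive (F := fun x => x `^ (r + 1) / (r + 1))%R) => //.
- by rewrite ler_pM2r ?invr_gt0//; apply: le_powR_pos => //; exact: ltW.
- move=> x /andP[ax _]; have x0 : (0 < x)%R by apply: le_lt_trans ax.
  have h := is_derive1_powR (r + 1) x0.
  rewrite (_ : (fun x => _) = (r + 1)^-1 *: (fun x : R => x `^ (r + 1)))%R; last first.
    by apply/funext => y; rewrite /GRing.scale/= mulrC.
  apply: is_derive_eq; rewrite /GRing.scale/= addrK mulrA mulVf ?mul1r//.
  by rewrite gt_eqF.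
- by move=> x /andP[ax _]; apply: continuous_powR_pos; apply: le_lt_trans ax.
- by move=> x _; exact: powR_ge0.
- move=> x /andP[ax xb]; rewrite !ler_pM2r ?invr_gt0//; apply/andP; split.
    by apply: le_powR_pos => //; apply: ltW.
  by apply: le_powR_pos => //; apply: ltW => //; apply: le_lt_trans ax.
Qed.

Lemma integral_powR_tail_le (r a b : R) : (r < -1)%R -> (0 < a)%R -> (a <= b)%R ->
  \int[leb]_(x in `[a, b]) (x `^ r)%:E <= (a `^ (r + 1) / - (r + 1))%:E.
Proof.
move=> r1 a0 ab.
have r10 : (0 < - (r + 1))%R by lra.
have b0 := lt_le_trans a0 ab.
rewrite -[X in X%:E](subKr 0%R) !sub0r.
rewrite -[X in X%:E](subrK 0%R) subr0 addr0 -sub0r.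
apply: (integral_le_primitive (F := fun x => x `^ (r + 1) / (r + 1))%R) => //.
- by rewrite oppr_le0 divr_ge0 ?powR_ge0// ltW.
- move=> x /andP[ax _]; have x0 : (0 < x)%R by apply: lt_trans ax.
  have h := is_derive1_powR (r + 1) x0.
  rewrite (_ : (fun x => _) = (r + 1)^-1 *: (fun x : R => x `^ (r + 1)))%R; last first.
    by apply/funext => y; rewrite /GRing.scale/= mulrC.
  apply: is_derive_eq; rewrite /GRing.scale/= addrK mulrA mulVf ?mul1r//.
  by rewrite lt_eqF//; lra.
- by move=> x /andP[ax _]; apply: continuous_powR_pos; apply: lt_trans ax.
- by move=> x _; exact: powR_ge0.
- move=> x /andP[ax xb]; rewrite invrN mulrN opprK -oppr_ge0 -mulrN -invrN.
  rewrite divr_ge0 ?powR_ge0 ?(ltW r10)// andbT -lerN2 -!mulrN -!invrN ler_pM2r ?invr_gt0//.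
  by apply: le_powR_neg; rewrite ?ltW//; lra.
Qed.

(** The substitution t = 1 - c / u turns the integrand into t^-s / c. *)
Lemma integral_axis_weight_le (s c u1 u2 : R) : (s < 1)%R -> (0 < c)%R ->
  (c <= u1)%R -> (u1 <= u2)%R ->
  \int[leb]_(u in `[u1, u2]) (u ^- 2 * (1 - c / u) `^ (- s))%:E <=
  ((((1 - c / u2) `^ (1 - s)) - ((1 - c / u1) `^ (1 - s))) / (c * (1 - s)))%:E.
Proof.
move=> s1 c0 cu1 u12.
have u10 := lt_le_trans c0 cu1; have u20 := lt_le_trans u10 u12.
have s10 : (0 < 1 - s)%R by rewrite subr_gt0.
have cs0 : (0 < c * (1 - s))%R by rewrite mulr_gt0.
have mono x y : (u1 <= x)%R -> (x <= y)%R ->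
    ((1 - c / x) `^ (1 - s) / (c * (1 - s)) <= (1 - c / y) `^ (1 - s) / (c * (1 - s)))%R.
  move=> ux xy; have x0 := lt_le_trans u10 ux; have y0 := lt_le_trans x0 xy.
  rewrite ler_pM2r ?invr_gt0//; apply: le_powR_pos; last exact: ltW.
    by rewrite subr_ge0 ler_pdivrMr// mul1r (le_trans cu1).
  by rewrite lerD2l lerN2 ler_pM2l// lef_pV2.
rewrite mulrBl.
apply: (integral_le_primitive
  (F := fun u => (1 - c / u) `^ (1 - s) / (c * (1 - s)))%R) => //.
- exact: mono.
- move=> x /andP[ax _]; have x0 : (0 < x)%R by apply: lt_trans ax.
  have t0 : (0 < 1 - c / x)%R by rewrite subr_gt0 ltr_pdivrMr// mul1r (le_lt_trans cu1).
  have xn0 : x != 0%R by rewrite gt_eqF.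
  have h := is_derive1_powR (1 - s) t0.
  have h2 : is_derive x 1%R (fun y => 1 - c / y)%R (c * x ^- 2)%R.
    by have iV := is_derive_invr xn0; apply: is_derive_eq; rewrite /GRing.scale/=; ring.
  have h3 := @is_derive1_comp _ (fun y => y `^ (1 - s))%R (fun y => 1 - c / y)%R x _ _ h h2.
  rewrite (_ : (fun u => _) = (c * (1 - s))^-1 *:
     ((fun y : R => y `^ (1 - s)) \o (fun y : R => 1 - c / y)))%R; last first.
    by apply/funext => y; rewrite /GRing.scale/= mulrC.
  apply: is_derive_eq; rewrite /GRing.scale/= [(1 - s - 1)%R](_ : _ = - s)%R; last by ring.
  field; rewrite xn0 !gt_eqF//.
- move=> x /andP[ax _]; have x0 : (0 < x)%R by apply: lt_trans ax.
  have t0 : (0 < 1 - c / x)%R by rewrite subr_gt0 ltr_pdivrMr// mul1r (le_lt_trans cu1).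
  have xn0 : x != 0%R by rewrite gt_eqF.
  have c1 : {for x, continuous (fun y : R => 1 - c / y)%R}.
    apply: cvgB; first exact: cvg_cst.
    apply: cvgM; first exact: cvg_cst.
    exact: cvgV.
  have c2 := continuous_comp c1 (continuous_powR_pos (r := (- s)%R) t0).
  apply: cvgM; last exact: c2.
  by apply: cvgV; [rewrite expf_neq0|exact: exprn_continuous].
- move=> x /andP[ax _]; rewrite mulr_ge0 ?powR_ge0// invr_ge0 exprn_ge0//.
  by rewrite ltW// (lt_trans u10).
- by move=> x /andP[ax xb]; rewrite !mono// ltW.
Qed.

End toolkit.

(** * The reciprocal weight *)

Section weights.
Context (R : realType).
Local Notation leb := (@lebesgue_measure R).
Implicit Types (a s u x ub : R).

(** The reciprocal of the weight, which the Cauchy-Schwarz inequality pairs with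
[weighted_sq]. *)
Definition inv_weight s u ub : R := u `^ (- (3 * s)) * (u - ub) `^ (- s).

(** In the variable t = 1 - ub / u the reciprocal weight is u^(2 - 4 s) times an
exact differential, which makes its integrals explicit. *)
Lemma inv_weightE s u ub : 0 < u -> ub <= u ->
  inv_weight s u ub = u `^ (2 - 4 * s) * (u ^- 2 * (1 - ub / u) `^ (- s)).
Proof.
move=> u0 uu; rewrite /inv_weight.
have un0 : u != 0 by rewrite gt_eqF.
have -> : u - ub = u * (1 - ub / u) by rewrite mulrBr mulr1 mulrCA mulfV// mulr1.
have t0 : 0 <= 1 - ub / u by rewrite subr_ge0 ler_pdivrMr// mul1r.
rewrite powRM ?(ltW u0)// mulrA mulrA; congr (_ * _).
rewrite -powR_add// -powRN2 ?(ltW u0)// -powR_add//; congr (_ `^ _); ring.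
Qed.

Lemma measurable_weight (D : set R) (p q c : R) :
  measurable_fun D (fun u : R => u `^ p * (u - c) `^ q).
Proof.
apply: measurable_funM; first exact: measurable_funTS.
apply: (@measurableT_comp _ _ _ _ _ _ (fun x : R => x `^ q)).
  exact: measurable_powR.
exact: measurable_funB.
Qed.

Lemma measurable_axis_weight (D : set R) (s c : R) : D `<=` [set u | 0 < u] ->
  measurable D ->
  measurable_fun D (fun u : R => u ^- 2 * (1 - c / u) `^ (- s)).
Proof.
move=> D0 mD.
have mV : measurable_fun D (fun u : R => u^-1).
  apply: (@eq_measurable_fun _ _ _ _ _ (fun u : R => u `^ (-1))).
    by move=> x; rewrite inE => /D0 /ltW x0; rewrite powR_inv1.
  exact: measurable_funTS.
apply: measurable_funM.
  under eq_fun do rewrite -exprVn.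
  by apply: measurable_funX.
apply: (@measurableT_comp _ _ _ _ _ _ (fun x : R => x `^ (- s))).
  exact: measurable_powR.
by apply: measurable_funB => //; apply: measurable_funM.
Qed.

Local Open Scope ereal_scope.

Lemma integral_inv_weight_le s ub u1 u2 (c K : R) : (0 < ub)%R -> (ub <= u1)%R ->
  (0 <= c)%R ->
  (forall u, (u1 <= u <= u2)%R -> (u `^ (2 - 4 * s) <= c)%R) ->
  \int[leb]_(u in `[u1, u2]) (u ^- 2 * (1 - ub / u) `^ (- s))%:E <= K%:E ->
  \int[leb]_(u in `[u1, u2]) (inv_weight s u ub)%:E <= (c * K)%:E.
Proof.
move=> ub0 uu c0 uc intK.
have mw : measurable_fun `[u1, u2] (fun u : R => u ^- 2 * (1 - ub / u) `^ (- s))%R.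
  apply: measurable_axis_weight => // u/=; rewrite in_itv/= => /andP[h _].
  by rewrite (lt_le_trans ub0)// (le_trans uu).
apply: (@le_trans _ _ (\int[leb]_(u in `[u1, u2]) (c%:E * (u ^- 2 * (1 - ub / u) `^ (- s))%:E))).
  apply: ge0_le_integral => //.
  - by move=> u _; rewrite lee_fin mulr_ge0 ?powR_ge0.
  - by apply/measurable_EFinP; exact: measurable_weight.
  - by apply: measurable_funeM; apply/measurable_EFinP.
  - move=> u /=; rewrite in_itv/= => ui; have /andP[u1u _] := ui.
    have u0 : (0 < u)%R by rewrite (lt_le_trans ub0)// (le_trans uu).
    rewrite inv_weightE ?(le_trans uu)// -EFinM lee_fin ler_wpM2r ?uc//.
    by rewrite mulr_ge0 ?powR_ge0// invr_ge0 exprn_ge0// ltW.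
rewrite ge0_integralZl//.
- by rewrite EFinM; apply: lee_wpmul2l => //; rewrite lee_fin.
- exact/measurable_EFinP.
- move=> u /=; rewrite in_itv/= => /andP[u1u _].
  rewrite lee_fin mulr_ge0 ?powR_ge0// invr_ge0 exprn_ge0// ltW//.
  by rewrite (lt_le_trans ub0)// (le_trans uu).
Qed.

Lemma integral_inv_weight_low s ub u1 u2 : (0 <= s)%R -> (s <= 1 / 2)%R -> (0 < ub)%R ->
  (ub <= u1)%R -> (u1 <= u2)%R ->
  \int[leb]_(u in `[u1, u2]) (inv_weight s u ub)%:E <=
  (u2 `^ (2 - 4 * s) * (ub * (1 - s))^-1)%:E.
Proof.
move=> s0 s12 ub0 uu1 u12.
have u10 := lt_le_trans ub0 uu1; have u20 := lt_le_trans u10 u12.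
apply: integral_inv_weight_le => //; first exact: powR_ge0.
  move=> u /andP[h1 h2]; apply: le_powR_pos => //; last lra.
  by rewrite ltW// (lt_le_trans u10).
have s1 : (s < 1)%R by lra.
apply: (le_trans (integral_axis_weight_le s1 ub0 uu1 u12)).
have cs0 : (0 < ub * (1 - s))%R by rewrite mulr_gt0// subr_gt0.
rewrite lee_fin -[leRHS]mul1r ler_pM2r ?invr_gt0//.
apply: (@le_trans _ _ ((1 - ub / u2) `^ (1 - s)))%R.
  by rewrite gerBl powR_ge0.
apply: powR_le1.
- by rewrite subr_ge0 ler_pdivrMr// mul1r (le_trans uu1).
- by rewrite gerBl divr_ge0// ltW.
- by lra.
Qed.

Lemma integral_inv_weight_tail s ub u1 u2 : (1 / 2 <= s)%R -> (s < 1)%R -> (0 < ub)%R ->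
  (ub <= u1)%R -> (u1 <= u2)%R ->
  \int[leb]_(u in `[u1, u2]) (inv_weight s u ub)%:E <= (u1 `^ (1 - 4 * s) / (1 - s))%:E.
Proof.
move=> s12 s1 ub0 uu1 u12.
have u10 := lt_le_trans ub0 uu1; have u20 := lt_le_trans u10 u12.
have -> : (u1 `^ (1 - 4 * s) / (1 - s) = u1 `^ (2 - 4 * s) * (u1 * (1 - s))^-1)%R.
  have -> : (2 - 4 * s = (1 - 4 * s) + 1)%R by ring.
  rewrite (powR_add (1 - 4 * s)%R 1%R u10) powRr1 ?(ltW u10)//; field.
  by rewrite !gt_eqF//= subr_gt0.
apply: integral_inv_weight_le => //; first exact: powR_ge0.
  by move=> u /andP[h1 h2]; apply: le_powR_neg => //; lra.
apply: (le_trans (integral_axis_weight_le s1 ub0 uu1 u12)).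
have s10 : (0 < 1 - s)%R by rewrite subr_gt0.
rewrite lee_fin !invfM !mulrA ler_pM2r ?invr_gt0//.
rewrite ler_pdivrMr// [leRHS]mulrC.
pose t := (ub / u1)%R.
have t01 : (0 <= t <= 1)%R.
  by apply/andP; split; [rewrite divr_ge0// ltW|rewrite ler_pdivrMr// mul1r].
have h2 : ((1 - ub / u2) `^ (1 - s) <= 1)%R.
  apply: powR_le1.
  - by rewrite subr_ge0 ler_pdivrMr// mul1r (le_trans uu1).
  - by rewrite gerBl divr_ge0// ltW.
  - by lra.
have h1 : (1 - t <= (1 - t) `^ (1 - s))%R.
  have [->|t1] := eqVneq t 1%R; first by rewrite subrr powR_ge0.
  have /andP[t0 tl1] := t01.
  apply: ger1_powR; last by lra.
  by rewrite subr_gt0 lt_neqAle t1 tl1/= gerBl.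
by move: h1 h2; rewrite -/t; lra.
Qed.

(** Away from the axis the factor in t is decreasing, and the power of u alone
makes the integral converge, even for s = 1 where the axis is singular. *)
Lemma integral_inv_weight_far s ub u1 u2 : (1 / 2 <= s)%R -> (0 < ub)%R ->
  (ub < u1)%R -> (u1 <= u2)%R ->
  \int[leb]_(u in `[u1, u2]) (inv_weight s u ub)%:E <=
  (u1 `^ (1 - 4 * s) * (1 - ub / u1) `^ (- s))%:E.
Proof.
move=> s12 ub0 uu1 u12.
have u10 := lt_trans ub0 uu1; have u20 := lt_le_trans u10 u12.
have -> : (u1 `^ (1 - 4 * s) * (1 - ub / u1) `^ (- s) =
    u1 `^ (2 - 4 * s) * (u1^-1 * (1 - ub / u1) `^ (- s)))%R.
  have -> : (2 - 4 * s = (1 - 4 * s) + 1)%R by ring.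
  rewrite (powR_add (1 - 4 * s)%R 1%R u10) powRr1 ?(ltW u10)//; field.
  by rewrite !gt_eqF.
apply: integral_inv_weight_le => //; [exact: ltW|exact: powR_ge0| |].
  by move=> u /andP[h1 h2]; apply: le_powR_neg => //; lra.
have mw : measurable_fun `[u1, u2] (fun u : R => u ^- 2)%R.
  apply: subspace_continuous_measurable_fun => //.
  apply: continuous_in_subspaceT => x; rewrite inE/= in_itv/= => /andP[ux _].
  apply: cvgV; first by rewrite expf_neq0// gt_eqF// (lt_le_trans u10).
  exact: exprn_continuous.
apply: (@le_trans _ _ (\int[leb]_(u in `[u1, u2]) (((1 - ub / u1) `^ (- s))%:E * (u ^- 2)%:E))).
  apply: ge0_le_integral => //.
  - by move=> u _; rewrite lee_fin mulr_ge0 ?powR_ge0// invr_ge0 sqr_ge0.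
  - apply/measurable_EFinP; apply: measurable_axis_weight => // u/=; rewrite in_itv/= => /andP[h _].
    by rewrite (lt_le_trans u10).
  - by apply: measurable_funeM; apply/measurable_EFinP.
  - move=> u /=; rewrite in_itv/= => /andP[u1u _].
    rewrite -EFinM lee_fin mulrC ler_wpM2r// ?invr_ge0 ?sqr_ge0//.
    have u0 := lt_le_trans u10 u1u.
    apply: le_powR_neg; last lra.
      by rewrite subr_gt0 ltr_pdivrMr// mul1r.
    by rewrite lerD2l lerN2 ler_pM2l// lef_pV2.
rewrite ge0_integralZl//; first last.
- by rewrite lee_fin powR_ge0.
- by move=> u _; rewrite lee_fin invr_ge0 sqr_ge0.
- exact/measurable_EFinP.
rewrite [in leRHS]mulrC EFinM; apply: lee_wpmul2l; first by rewrite lee_fin powR_ge0.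
apply: (le_trans (integral_inv2_le u10 u12)).
by rewrite lee_fin gerBl invr_ge0 ltW.
Qed.

End weights.

(** * Flux control, and the regime s <= 1/2 *)

Section flux.
Context (R : realType).
Local Notation leb := (@lebesgue_measure R).
Implicit Types (a s M Ub u x ub : R) (phi phiu : R -> R -> R).

(** Integral in ub of the zeroth-order term of the equation along the ray of
abscissa u, which meets the region from max (1 / 2, 2 - u) on. *)
Definition potential_term a phi u ub : R :=
  a * \int[leb]_(x in `[Num.max (1 / 2) (2 - u), ub]) (phi u x / (u + x) ^+ 2).

Definition weight s u ub : R := u `^ (3 * s) * (u - ub) `^ s.

(** What the weighted estimate uses of a solution.  The sum phiu + potential_term
collects the data and the source, and its weighted square norm is at most M;
[fc_step], [fc_norm] and [fc_diverge] express this without naming the sum, which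
is never seen except through the Cauchy-Schwarz inequality, the triangle
inequality, and the divergence of the integral of c / u.  In [fc_step] the
potential is only compared with c1 / u ^+ 2, since in the middle regime its main
part has to be kept with its sign. *)
Record flux_control a s M Ub phi phiu : Prop := FluxControl {
  fc_cont : continuous (fun p : R * R => phi p.1 p.2);
  fc_step : forall ub u1 u2 J c1 c2 c3, 1 / 2 <= ub -> ub <= Ub ->
    lowu ub <= u1 -> u1 <= u2 -> 0 <= J ->
    (\int[leb]_(u in `[u1, u2]) (inv_weight s u ub)%:E <= (J ^+ 2)%:E)%E ->
    (forall u, u1 <= u -> u <= u2 ->
      `|potential_term a phi u ub - c1 / u ^+ 2| <= c2 / u ^+ 2 + 2 * c3 / u ^+ 3) ->
    `|phi u2 ub - phi u1 ub + c1 * (u1^-1 - u2^-1)| <=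
      M * J + (c2 * (u1^-1 - u2^-1) + c3 * (u1 ^- 2 - u2 ^- 2));
  fc_norm : forall ub k r, 1 / 2 <= ub -> ub <= Ub -> 0 <= k -> r < -1 ->
    (forall u, lowu ub <= u ->
      weight s u ub * potential_term a phi u ub ^+ 2 <= k * u `^ r) ->
    (weighted_sq s phiu ub <=
     (2 * M ^+ 2 + 2 * (k * (lowu ub `^ (r + 1) / - (r + 1))))%:E)%E;
  fc_diverge : forall ub c U, 1 / 2 <= ub -> ub <= Ub ->
    (weighted_sq s phiu ub < +oo)%E -> 0 < c -> lowu ub <= U ->
    ~ (forall u, U <= u -> c / u <= weight s u ub * potential_term a phi u ub ^+ 2);
  fc_cs : forall ub u1 u2 N J, 1 / 2 <= ub -> ub <= Ub -> lowu ub <= u1 ->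
    u1 <= u2 -> 0 <= N -> 0 <= J ->
    (weighted_sq s phiu ub <= (N ^+ 2)%:E)%E ->
    (\int[leb]_(u in `[u1, u2]) (inv_weight s u ub)%:E <= (J ^+ 2)%:E)%E ->
    `|phi u2 ub - phi u1 ub| <= N * J;
  fc_init : forall ub, 1 / 2 <= ub -> ub <= 1 -> `|phi (lowu ub) ub| <= M;
  fc_axis : forall ub, 1 <= ub -> ub <= Ub -> phi ub ub = 0
}.

Lemma lowuP (ub : R) : [/\ 1 <= lowu ub, ub <= lowu ub & 2 - ub <= lowu ub].
Proof.
rewrite /lowu; split; rewrite le_max ?lexx ?orbT//.
by have [h|h] := leP 1 ub => //=; slra.
Qed.

Lemma lowu_id (ub : R) : 1 <= ub -> lowu ub = ub.
Proof. by move=> ub1; apply/max_idPl; slra. Qed.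

Lemma lowu_le (ub u : R) : (lowu ub <= u) = (ub <= u) && (2 - ub <= u).
Proof. by rewrite /lowu ge_max. Qed.

Lemma three_halves_le2 : 3 / 2 <= 2 :> R.
Proof. slra. Qed.

Lemma lowu_half : lowu (1 / 2) = 3 / 2 :> R.
Proof. by rewrite /lowu (max_idPr _); slra. Qed.

Lemma weight_ge0 s u ub : 0 <= weight s u ub.
Proof. by rewrite mulr_ge0 ?powR_ge0. Qed.

Lemma weight_le s u ub : 0 <= s -> 0 <= ub -> ub <= u -> 0 < u ->
  weight s u ub <= u `^ (4 * s).
Proof.
move=> s0 ub0 uu u0.
have -> : 4 * s = 3 * s + s by ring.
rewrite powR_add// ler_wpM2l ?powR_ge0//; apply: le_powR_pos => //; slra.
Qed.

Lemma bounded_on_strip (f : R -> R -> R) (Ub B : R) :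
  continuous (fun p : R * R => f p.1 p.2) ->
  exists K : R, forall u x, 0 <= x -> x <= Ub -> 0 <= u -> u <= B -> `|f u x| <= K.
Proof.
move=> cf.
have cK : compact (`[0, B] `*` `[0, Ub] : set (R * R)).
  by apply: compact_setX; exact: segment_compact.
have : compact ((fun p : R * R => f p.1 p.2) @` (`[0, B] `*` `[0, Ub])).
  by apply: continuous_compact => //; exact: continuous_subspaceT.
move=> /compact_bounded[N [Nr hN]]; exists (N + 1) => u x x0 xU u0 uB.
apply: (hN (N + 1)); first by rewrite ltrDl.
by exists (u, x) => //; split => /=; rewrite in_itv/= ?u0 ?x0.
Qed.

Lemma Rintegral_bound (g P : R -> R) (b c K : R) :
  {within `[b, c], continuous g} ->
  (forall x, b <= x -> x <= c -> `|g x| <= P x) ->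
  measurable_fun `[b, c] P ->
  (\int[leb]_(x in `[b, c]) (P x)%:E <= K%:E)%E ->
  `|\int[leb]_(x in `[b, c]) g x| <= K.
Proof.
move=> cg gP mP PK.
have ig : leb.-integrable `[b, c] (EFin \o g).
  by apply: continuous_compact_integrable => //; exact: segment_compact.
have mg : measurable_fun `[b, c] g.
  by apply/measurable_EFinP; exact: measurable_int ig.
apply: (le_trans (le_normr_Rintegral _ ig)) => //.
rewrite -lee_fin /Rintegral fineK; last first.
  by apply: integrable_fin_num => //; exact: integrable_norm.
apply: le_trans PK; apply: ge0_le_integral => //.
- by apply/measurable_EFinP; apply: measurableT_comp.
- exact/measurable_EFinP.
- by move=> x /=; rewrite in_itv/= => /andP[bx xc]; rewrite lee_fin gP.
Qed.

Lemma continuous_slice (phi : R -> R -> R) (u : R) :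
  continuous (fun p : R * R => phi p.1 p.2) -> continuous (phi u).
Proof.
move=> cphi x; apply: (@continuous_comp _ _ _ (fun y : R => (u, y)) (fun p => phi p.1 p.2)).
  by apply: (@cvg_pair _ _ _ (nbhs x) (nbhs u) (nbhs x)); [exact: cvg_cst|exact: cvg_id].
exact: cphi.
Qed.

Lemma continuous_potential (phi : R -> R -> R) (u b c : R) :
  continuous (fun p : R * R => phi p.1 p.2) -> 0 < u -> 0 <= b ->
  {within `[b, c], continuous (fun x => phi u x / (u + x) ^+ 2)}.
Proof.
move=> cphi u0 b0; apply: continuous_in_subspaceT => x; rewrite inE/= in_itv/= => /andP[bx _].
apply: cvgM; first exact: continuous_slice.
apply: cvgV; first by rewrite expf_neq0// gt_eqF// ltr_wpDr// (le_trans b0).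
apply: (@continuous_comp _ _ _ (fun y : R => u + y) (fun y : R => y ^+ 2)).
  by apply: cvgD; [exact: cvg_cst|exact: cvg_id].
exact: exprn_continuous.
Qed.

Lemma potential_piece_le (phi : R -> R -> R) (u b c p r : R) :
  continuous (fun p : R * R => phi p.1 p.2) -> 0 < u -> 0 <= b -> b <= c ->
  -1 < r -> 0 <= p ->
  (forall x, b <= x -> x <= c -> `|phi u x| <= p * x `^ r) ->
  `|\int[leb]_(x in `[b, c]) (phi u x / (u + x) ^+ 2)| <=
    p * ((c `^ (r + 1) - b `^ (r + 1)) / (r + 1)) / u ^+ 2.
Proof.
move=> cphi u0 b0 bc r1 p0 phiP.
have mp : measurable_fun `[b, c] (fun x : R => x `^ r) by exact: measurable_funTS.
apply: (@Rintegral_bound _ (fun x => (p / u ^+ 2) * x `^ r)).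
- exact: continuous_potential.
- move=> x bx xc; have x0 := le_trans b0 bx.
  rewrite normrM normfV (ger0_norm (sqr_ge0 _)) mulrAC.
  apply: ler_pM => //; first by rewrite invr_ge0 sqr_ge0.
    exact: phiP.
  rewrite lef_pV2 ?posrE ?exprn_gt0// ?ltr_wpDr//.
  by rewrite lerXn2r ?nnegrE ?addr_ge0 ?lerDl// ltW.
- by apply: measurable_funM.
- under eq_integral do rewrite EFinM.
  rewrite ge0_integralZl//; first last.
  + by rewrite lee_fin divr_ge0// sqr_ge0.
  + by move=> x _; rewrite lee_fin powR_ge0.
  + exact/measurable_EFinP.
  rewrite [in leRHS]mulrAC [leRHS]EFinM; apply: lee_wpmul2l; first by rewrite lee_fin divr_ge0// sqr_ge0.
  exact: integral_powR_le.
Qed.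

Lemma potential_term_le a (phi : R -> R -> R) (u ub p r : R) : 0 <= a ->
  continuous (fun p : R * R => phi p.1 p.2) -> 1 / 2 <= ub -> lowu ub <= u ->
  -1 < r -> 0 <= p ->
  (forall x, 1 / 2 <= x -> x <= ub -> lowu x <= u -> `|phi u x| <= p * x `^ r) ->
  `|potential_term a phi u ub| <=
    a * (p * ((ub `^ (r + 1) - (1 / 2) `^ (r + 1)) / (r + 1)) / u ^+ 2).
Proof.
move=> a0 cphi ub12; rewrite lowu_le => /andP[ubu ubu2] r1 p0 phiP.
have h12 : (0 : R) <= 1 / 2 by slra.
have u0 : 0 < u by slra.
have m0 : 0 <= Num.max (1 / 2) (2 - u) by rewrite le_max h12.
rewrite normrM (ger0_norm a0) ler_wpM2l//.
apply: le_trans (potential_piece_le cphi u0 m0 _ r1 p0 _) _.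
- by rewrite ge_max ub12/=; slra.
- move=> x; rewrite ge_max => /andP[x12 xu] xub; apply: phiP => //.
  by rewrite lowu_le; apply/andP; split; slra.
rewrite ler_wpM2r// ?invr_ge0 ?sqr_ge0// ler_wpM2l// ler_pM2r ?invr_gt0; last slra.
rewrite lerD2l lerN2; apply: le_powR_pos => //; last slra.
by rewrite le_max lexx.
Qed.

End flux.

Section low_regime.
Context (R : realType) (a s M Ub : R) (phi phiu : R -> R -> R).

(** The reciprocal weight integrates to at most u^(2 - 4 s) / ub up to a constant,
which is where the rate comes from.  Inserting the rate in the potential returns
it with the factor 2 a <= 1/2, and the bootstrap closes on the bounded set of
abscissas at most u, where phi is bounded by continuity. *)
Lemma low_regime_pointwise u ub :
  0 <= a -> a <= 1 / 4 -> 0 <= s -> s <= 1 / 2 -> 0 <= M ->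
  flux_control a s M Ub phi phiu ->
  1 / 2 <= ub -> ub <= Ub -> lowu ub <= u ->
  `|phi u ub| <= 5 * M * u `^ (1 - 2 * s) * ub `^ (- (1 / 2)).
Proof.
move=> a0 a4 s0 s12 M0 fc ub12 ubU uu.
have p0 : 0 <= 1 - 2 * s by slra.
have [p pE] : exists p : R, p = 1 - 2 * s by exists (1 - 2 * s).
rewrite -pE in p0 *.
have cphi := fc_cont fc.
have [K hK] := bounded_on_strip Ub u cphi.
pose D := [set t : R * R | [/\ 1 / 2 <= t.2, t.2 <= Ub, lowu t.2 <= t.1 & t.1 <= u]].
pose X (t : R * R) : R := `|phi t.1 t.2| * (t.1 `^ p)^-1 * t.2 `^ (1 / 2).
have Xle : X (u, ub) <= (5 / 2 * M) / (1 - 1 / 2).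
  apply: (@contraction_bound _ _ D X) => //; first slra.
  - exists (K * Ub `^ (1 / 2)) => -[v x] [/= x12 xU vx vu].
    have [l1 l2 l3] := lowuP x; rewrite /X/=.
    apply: ler_pM; rewrite ?mulr_ge0 ?invr_ge0 ?powR_ge0//; last first.
      by apply: le_powR_pos => //; slra.
    apply: (@le_trans _ _ `|phi v x|); last by apply: hK; slra.
    rewrite -[leRHS]mulr1 ler_wpM2l// invf_le1 ?powR_gt0//; last slra.
    have <- := powRr0 v; apply: ler_powR => //; slra.
  - move=> P P0 XP [v x] [/= x12 xU vx vu].
    have [l1 l2 l3] := lowuP x.
    have x0 : 0 < x by slra.
    have v0 : 0 < v by slra.
    have vp1 : 1 <= v `^ p.
      by have <- := powRr0 v; apply: ler_powR => //; slra.
    have phiP w y : 1 / 2 <= y -> y <= x -> lowu y <= w -> w <= v ->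
        `|phi w y| <= (P * v `^ p) * y `^ (- (1 / 2)).
      move=> y12 yx yw wv.
      have [k1 k2 k3] := lowuP y.
      have y0 : 0 < y by slra.
      have w0 : 0 < w by slra.
      have /= := XP (w, y); rewrite /X/= => h.
      have {h} h : `|phi w y| / w `^ p * y `^ (1 / 2) <= P.
        by apply: h; split => //=; [exact: le_trans xU|exact: le_trans vu].
      rewrite powRN ler_pdivlMr ?powR_gt0//.
      move: h; rewrite mulrAC ler_pdivrMr ?powR_gt0// => /le_trans; apply.
      by rewrite ler_wpM2l//; apply: le_powR_pos => //; exact: ltW.
    set V := v `^ p in vp1 phiP *.
    have h0 : 0 < x `^ (1 / 2) by rewrite powR_gt0.
    have hh : x = x `^ (1 / 2) * x `^ (1 / 2).
      by rewrite -expr2 powR_half_sq// ltW.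
    set h := x `^ (1 / 2) in h0 hh *.
    have hint : (\int[@lebesgue_measure R]_(z in `[lowu x, v]) (inv_weight s z x)%:E <=
        ((3 / 2 * V / h) ^+ 2)%:E)%E.
      apply: (le_trans (integral_inv_weight_low s0 s12 x0 l2 vx)).
      have -> : v `^ (2 - 4 * s) = V ^+ 2.
        by rewrite powR_sq; congr (_ `^ _); rewrite pE; ring.
      have s10 : 0 < 1 - s by slra.
      rewrite lee_fin -subr_ge0.
      have -> : (3 / 2 * V / h) ^+ 2 - V ^+ 2 / (x * (1 - s)) =
         V ^+ 2 * (9 / 4 * (1 - s) - 1) / (h * h * (1 - s)).
        by rewrite [in X in _ - X]hh; field; rewrite !gt_eqF.
      by rewrite divr_ge0 ?mulr_ge0 ?sqr_ge0//; try slra; rewrite ltW.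
    have J0 : 0 <= 3 / 2 * V / h.
      by rewrite divr_ge0 ?mulr_ge0 ?(ltW h0)//; slra.
    have PV0 : 0 <= P * V by rewrite mulr_ge0//; slra.
    have hpot z : lowu x <= z -> z <= v -> `|potential_term a phi z x - 0 / z ^+ 2| <=
        a * (2 * P * V * h) / z ^+ 2 + 2 * 0 / z ^+ 3.
      move=> z1 z2; rewrite mul0r subr0 mulr0 mul0r addr0.
      have z0 : 0 < z by slra.
      have r1 : -1 < - (1 / 2) :> R by slra.
      apply: (le_trans (potential_term_le a0 cphi x12 z1 r1 PV0 _)).
        by move=> y y1 y2 y3; apply: phiP.
      rewrite mulrA ler_wpM2r ?invr_ge0 ?sqr_ge0// ler_wpM2l//.
      have -> : x `^ (- (1 / 2) + 1) = h by congr (_ `^ _); field.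
      have -> : - (1 / 2) + 1 = 1 / 2 :> R by field.
      have hb : (h - (1 / 2) `^ (1 / 2)) / (1 / 2) <= 2 * h.
        have : 0 <= (1 / 2) `^ (1 / 2) :> R by exact: powR_ge0.
        by rewrite ler_pdivrMr; slra.
      have -> : 2 * P * V * h = P * V * (2 * h) by ring.
      by rewrite ler_wpM2l.
    have := fc_step fc x12 xU (lexx _) vx J0 hint hpot.
    rewrite !mul0r !addr0 => hphi.
    have hlow : `|phi (lowu x) x| <= M / h.
      have [x1|x1] := leP x 1.
        apply: (le_trans (fc_init fc x12 x1)).
        rewrite ler_pdivlMr// -[leRHS]mulr1 ler_wpM2l//; apply: powR_le1 => //; slra.
      by rewrite lowu_id ?(ltW x1)// (fc_axis fc (ltW x1) xU) normr0 divr_ge0// (ltW h0).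
    have htri : `|phi v x| <= M / h + (M * (3 / 2 * V / h) + a * (2 * P * V * h) * ((lowu x)^-1 - v^-1)).
      rewrite -[phi v x](subrK (phi (lowu x) x)) (le_trans (ler_normD _ _))// addrC.
      exact: lerD.
    have hinv : ((lowu x)^-1 - v^-1) <= (h * h)^-1.
      rewrite -hh; apply: (@le_trans _ _ (lowu x)^-1); last by rewrite lef_pV2 ?posrE//; slra.
      by rewrite gerBl invr_ge0; slra.
    have hc : a * (2 * P * V * h) * ((lowu x)^-1 - v^-1) <= P * V / h / 2.
      apply: (@le_trans _ _ (a * (2 * P * V * h) * (h * h)^-1)).
        by rewrite ler_wpM2l// !mulr_ge0//; slra.
      have -> : a * (2 * P * V * h) * (h * h)^-1 = (2 * a) * (P * V / h).
        by field; rewrite gt_eqF.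
      have PVh : 0 <= P * V / h by rewrite divr_ge0 ?(ltW h0).
      have : a * (P * V / h) <= 1 / 4 * (P * V / h) by rewrite ler_wpM2r.
      by rewrite -mulrA; slra.
    rewrite /X/= -/V -/h mulrAC ler_pdivrMr; last slra.
    apply: (@le_trans _ _ ((M / h + (M * (3 / 2 * V / h) + P * V / h / 2)) * h)).
      by rewrite ler_wpM2r ?(ltW h0)// (le_trans htri)// lerD2l lerD2l.
    have -> : (M / h + (M * (3 / 2 * V / h) + P * V / h / 2)) * h =
       M + 3 / 2 * (M * V) + 1 / 2 * (P * V) by field; rewrite gt_eqF.
    have MV : M * 1 <= M * V by rewrite ler_wpM2l.
    by rewrite mulr1 in MV; rewrite mulrDl -!mulrA; slra.
  - by move=> [v x] _; rewrite /X !mulr_ge0 ?invr_ge0 ?powR_ge0.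
have [l1 l2 l3] := lowuP ub.
have ub0 : 0 < ub by slra.
have u0 : 0 < u by slra.
move: Xle; rewrite /X/= mulrAC ler_pdivrMr ?powR_gt0// => h.
rewrite powRN ler_pdivlMr ?powR_gt0//.
apply: (le_trans h); rewrite ler_wpM2r ?powR_ge0//.
rewrite (_ : 1 - 1 / 2 = 1 / 2 :> R); last slra.
by rewrite [leLHS](_ : _ = 5 * M)//; field.
Qed.

(** With the pointwise rate, the weight times the squared potential is
O (ub / u^2), whose integral from [lowu ub >= ub] on is bounded. *)
Lemma low_regime ub :
  0 <= a -> a <= 1 / 4 -> 0 <= s -> s <= 1 / 2 -> 0 <= M ->
  flux_control a s M Ub phi phiu -> 1 / 2 <= ub -> ub <= Ub ->
  (weighted_sq s phiu ub <= (15 * M ^+ 2)%:E)%E.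
Proof.
move=> a0 a4 s0 s12 M0 fc ub12 ubU.
have [l1 l2 l3] := lowuP ub.
have ub0 : 0 < ub by slra.
have k0 : 0 <= (5 / 2 * M) ^+ 2 * ub by rewrite mulr_ge0 ?sqr_ge0// ltW.
have r1 : -2 < -1 :> R by slra.
apply: (le_trans (fc_norm fc ub12 ubU k0 r1 _)).
  move=> u uu; have u0 : 0 < u by slra.
  have cphi := fc_cont fc.
  have r12 : -1 < - (1 / 2) :> R by slra.
  have P0 : 0 <= 5 * M * u `^ (1 - 2 * s) by rewrite !mulr_ge0 ?powR_ge0.
  have := potential_term_le a0 cphi ub12 uu r12 P0.
  move=> /(_ (fun x x1 x2 x3 => low_regime_pointwise a0 a4 s0 s12 M0 fc x1 (le_trans x2 ubU) x3)).
  have -> : - (1 / 2) + 1 = 1 / 2 :> R by field.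
  set V := u `^ (1 - 2 * s); set h := ub `^ (1 / 2) => hpot.
  have hh : h ^+ 2 = ub by apply: powR_half_sq; exact: ltW.
  have V0 : 0 <= V by exact: powR_ge0.
  have h0 : 0 <= h by exact: powR_ge0.
  have hpot2 : `|potential_term a phi u ub| <= 5 / 2 * M * V * h / u ^+ 2.
    apply: (le_trans hpot); rewrite mulrA ler_wpM2r ?invr_ge0 ?sqr_ge0//.
    have hb : (h - (1 / 2) `^ (1 / 2)) / (1 / 2) <= 2 * h.
      have : 0 <= (1 / 2) `^ (1 / 2) :> R by exact: powR_ge0.
      by rewrite ler_pdivrMr; slra.
    apply: (@le_trans _ _ (1 / 4 * (5 * M * V * (2 * h)))); last slra.
    have : 0 <= 5 * M * V by rewrite !mulr_ge0.
    move=> h5; apply: ler_pM => //; last by rewrite ler_wpM2l.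
    apply: mulr_ge0 => //; apply: divr_ge0; last slra.
    by rewrite subr_ge0; apply: le_powR_pos => //; slra.
  have -> : potential_term a phi u ub ^+ 2 = `|potential_term a phi u ub| ^+ 2.
    by rewrite real_normK// num_real.
  apply: (@le_trans _ _ (u `^ (4 * s) * (5 / 2 * M * V * h / u ^+ 2) ^+ 2)).
    apply: ler_pM; rewrite ?weight_ge0 ?sqr_ge0//.
      by apply: weight_le => //; slra.
    by rewrite lerXn2r ?nnegrE// divr_ge0 ?sqr_ge0// !mulr_ge0//; slra.
  have -> : u `^ (4 * s) * (5 / 2 * M * V * h / u ^+ 2) ^+ 2 =
     (5 / 2 * M) ^+ 2 * ub * (u `^ (4 * s) * V ^+ 2 / u ^+ 4).
    by rewrite -hh; field; rewrite gt_eqF.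
  rewrite ler_wpM2l// /V powR_sq -powR_add//.
  have -> : 4 * s + 2 * (1 - 2 * s) = 2%:R by ring.
  rewrite powR_mulrn ?(ltW u0)// powRN2 ?(ltW u0)//.
  by rewrite (_ : u ^+ 2 / u ^+ 4 = u ^- 2)//; field; rewrite gt_eqF.
have -> : -2 + 1 = -1 :> R by ring.
rewrite opprK divr1 powR_inv1; last slra.
rewrite lee_fin.
have : ub / lowu ub <= 1 by rewrite ler_pdivrMr ?mul1r//; slra.
have : 0 <= M ^+ 2 by exact: sqr_ge0.
rewrite -mulrA; nra.
Qed.

End low_regime.

(** * The regime 3/4 <= s *)

Section high_regime.
Context (R : realType).
Local Notation leb := (@lebesgue_measure R).
Implicit Types (a s M Ub u x ub : R) (phi phiu : R -> R -> R).

Lemma flux_step a s M Ub phi phiu ub u1 u2 J k :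
  flux_control a s M Ub phi phiu -> 1 / 2 <= ub -> ub <= Ub ->
  lowu ub <= u1 -> u1 <= u2 -> 0 <= J ->
  (\int[leb]_(u in `[u1, u2]) (inv_weight s u ub)%:E <= (J ^+ 2)%:E)%E ->
  (forall u, u1 <= u -> u <= u2 -> `|potential_term a phi u ub| <= k / u ^+ 2) ->
  `|phi u2 ub - phi u1 ub| <= M * J + k * (u1^-1 - u2^-1).
Proof.
move=> fc ub12 ubU uu1 u12 J0 hJ hk.
have := fc_step fc (c1 := 0) (c2 := k) (c3 := 0) ub12 ubU uu1 u12 J0 hJ.
rewrite !mul0r !addr0; apply => u h1 h2.
by rewrite mul0r subr0 mulr0 mul0r addr0; exact: hk.
Qed.

Lemma potential_term_le_cst a phi u ub p : 0 <= a ->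
  continuous (fun p : R * R => phi p.1 p.2) -> 1 / 2 <= ub -> lowu ub <= u ->
  0 <= p ->
  (forall x, 1 / 2 <= x -> x <= ub -> lowu x <= u -> `|phi u x| <= p) ->
  `|potential_term a phi u ub| <= a * p * (ub - 1 / 2) / u ^+ 2.
Proof.
move=> a0 cphi ub12 uu p0 hp.
have r1 : -1 < 0 :> R by slra.
have := potential_term_le (r := 0) a0 cphi ub12 uu r1 p0.
rewrite add0r divr1 !powRr1; [|slra|slra].
rewrite !mulrA; apply => x x1 x2 x3; rewrite powRr0 mulr1; exact: hp.
Qed.

(** For s >= 3/4 the exponent 4 s - 1 is at least 2, so that increments of phi
beyond abscissa u1 are O (1 / u1). *)
Lemma inv_weight_far_le s Ub x u1 u2 : 3 / 4 <= s -> s <= 1 -> 1 / 2 <= x ->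
  x <= Ub -> Ub + 2 <= u1 -> u1 <= u2 ->
  (\int[leb]_(u in `[u1, u2]) (inv_weight s u x)%:E <= (((Ub + 2) / u1) ^+ 2)%:E)%E.
Proof.
move=> s34 s1 x12 xU Uu1 u12.
have s12 : 1 / 2 <= s by slra.
have x0 : 0 < x by slra.
have xu1 : x < u1 by slra.
have u10 : 0 < u1 by slra.
have u11 : 1 <= u1 by slra.
apply: (le_trans (integral_inv_weight_far s12 x0 xu1 u12)); rewrite lee_fin.
rewrite expr_div_n mulrC; apply: ler_pM; rewrite ?powR_ge0//.
  have t2 : 2 / (Ub + 2) <= 1 - x / u1.
    rewrite ler_pdivrMr; last slra.
    rewrite mulrBl mul1r -[X in _ - X]mulrA.
    have : x * (u1^-1 * (Ub + 2)) <= x * 1.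
      by rewrite ler_wpM2l ?(ltW x0)// mulrC ler_pdivrMr// mul1r.
    slra.
  have t0 : 0 < 2 / (Ub + 2) by rewrite divr_gt0//; slra.
  apply: (@le_trans _ _ ((2 / (Ub + 2)) `^ (- s))).
    by apply: le_powR_neg => //; slra.
  have tE : 2 / (Ub + 2) = ((Ub + 2) / 2)^-1 by rewrite invf_div.
  rewrite powRN tE; set y := (Ub + 2) / 2.
  have y1 : 1 <= y by rewrite /y; slra.
  rewrite powR_invl ?invrK; last exact: lt_le_trans ltr01 y1.
  apply: (@le_trans _ _ y); last by rewrite /y; nra.
  by apply: ler1_powR.
rewrite -powRN2 ?(ltW u10)//; apply: ler_powR => //; slra.
Qed.

(** On a bounded range of abscissas phi is bounded by continuity; beyond it the
step estimate is a contraction, as the potential is O (1 / u^2). *)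
Lemma high_bounded a s M Ub phi phiu : 0 <= a -> a <= 1 / 4 -> 3 / 4 <= s ->
  s <= 1 -> 0 <= M -> flux_control a s M Ub phi phiu ->
  exists K : R, 0 <= K /\ forall u ub, 1 / 2 <= ub -> ub <= Ub -> lowu ub <= u ->
    `|phi u ub| <= K.
Proof.
move=> a0 a4 s34 s1 M0 fc.
have cphi := fc_cont fc.
have [K1' hK1'] := bounded_on_strip Ub (Ub + 2) cphi.
have [K1 [K10 hK1]] : exists K1 : R, 0 <= K1 /\
    forall u x, 0 <= x -> x <= Ub -> 0 <= u -> u <= Ub + 2 -> `|phi u x| <= K1.
  exists `|K1'|; split => // u x h1 h2 h3 h4.
  by apply: le_trans (ler_norm _); exact: hK1'.
exists ((K1 + M) / (1 - 1 / 4)); split.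
  by rewrite divr_ge0; slra.
move=> u ub ub12 ubU uu.
have [K hK] := bounded_on_strip Ub u cphi.
pose D := [set t : R * R | [/\ 1 / 2 <= t.2, t.2 <= Ub, lowu t.2 <= t.1 & t.1 <= u]].
pose X (t : R * R) : R := `|phi t.1 t.2|.
apply: (@contraction_bound _ _ D X _ _ _ _ _ _ (u, ub)) => //=; first slra.
- exists K => -[v x] [/= x12 xU vx vu]; rewrite /X/=.
  have [l1 l2 l3] := lowuP x; apply: hK; slra.
- move=> P P0 XP [v x] [/= x12 xU vx vu]; rewrite /X/=.
  have [l1 l2 l3] := lowuP x.
  have [vU|Uv] := leP v (Ub + 2).
    apply: (@le_trans _ _ K1); first by apply: hK1; slra.
    slra.
  have lU : lowu x <= Ub + 2 by rewrite lowu_le; apply/andP; split; slra.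
  have hJ := inv_weight_far_le s34 s1 x12 xU (lexx _) (ltW Uv).
  have U0 : 0 < Ub + 2 by slra.
  rewrite divff ?gt_eqF// in hJ.
  have hp z : Ub + 2 <= z -> z <= v ->
      `|potential_term a phi z x| <= a * P * (x - 1 / 2) / z ^+ 2.
    move=> z1 z2; apply: potential_term_le_cst => //; first exact: le_trans z1.
    move=> y y1 y2 y3; apply: (XP (z, y)); split => //=; slra.
  have := flux_step fc x12 xU lU (ltW Uv) ler01 hJ hp.
  have hphi1 : `|phi (Ub + 2) x| <= K1 by apply: hK1; slra.
  have hc : a * P * (x - 1 / 2) * ((Ub + 2)^-1 - v^-1) <= 1 / 4 * P.
    apply: (@le_trans _ _ (a * P * (x - 1 / 2) * (Ub + 2)^-1)).
      apply: ler_wpM2l; first by rewrite !mulr_ge0//; slra.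
      by rewrite gerBl invr_ge0; slra.
    rewrite ler_pdivrMr//.
    have : 0 <= a * P by rewrite mulr_ge0.
    have : a * P <= 1 / 4 * P by rewrite ler_wpM2r.
    nra.
  rewrite mulr1 => hd.
  rewrite -[phi v x](subrK (phi (Ub + 2) x)) (le_trans (ler_normD _ _))//.
  slra.
- by move=> t _; exact: normr_ge0.
Qed.

Lemma high_rate a s M Ub phi phiu : 0 <= a -> a <= 1 / 4 -> 3 / 4 <= s ->
  s <= 1 -> 0 <= M -> 1 / 2 <= Ub -> flux_control a s M Ub phi phiu ->
  exists C : R, 0 <= C /\ forall u1 u2 x, 1 / 2 <= x -> x <= Ub -> Ub + 2 <= u1 ->
    u1 <= u2 -> `|phi u2 x - phi u1 x| <= C / u1.
Proof.
move=> a0 a4 s34 s1 M0 Ub12 fc.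
have [K [K0 hK]] := high_bounded a0 a4 s34 s1 M0 fc.
have aK0 : 0 <= a * K by rewrite mulr_ge0.
exists (M * (Ub + 2) + a * K * Ub); split.
  by rewrite addr_ge0 ?mulr_ge0//; slra.
move=> u1 u2 x x12 xU Uu1 u12.
have [l1 l2 l3] := lowuP x.
have lU : lowu x <= u1 by rewrite lowu_le; apply/andP; split; slra.
have hJ := inv_weight_far_le s34 s1 x12 xU Uu1 u12.
have u10 : 0 < u1 by slra.
have J0 : 0 <= (Ub + 2) / u1 by rewrite divr_ge0//; slra.
have hp z : u1 <= z -> z <= u2 -> `|potential_term a phi z x| <= a * K * (x - 1 / 2) / z ^+ 2.
  move=> z1 z2; apply: potential_term_le_cst => //; first exact: (fc_cont fc).
    exact: le_trans z1.
  by move=> y y1 y2 y3; apply: hK => //; slra.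
apply: (le_trans (flux_step fc x12 xU lU u12 J0 hJ hp)).
rewrite [leRHS]mulrDl -(mulrA M) lerD2l.
apply: (@le_trans _ _ (a * K * Ub * (u1^-1 - u2^-1))).
  rewrite ler_wpM2r//; last by rewrite ler_wpM2l//; slra.
  by rewrite subr_ge0 lef_pV2// posrE; slra.
rewrite ler_wpM2l//; first by rewrite mulr_ge0//; slra.
by rewrite gerBl invr_ge0; slra.
Qed.

Lemma integral_cst_itv (b c K : R) : b <= c ->
  (\int[leb]_(x in `[b, c]) K%:E = (K * (c - b))%:E)%E.
Proof.
rewrite le_eqVlt => /predU1P[->|bc].
  by rewrite set_itv1 integral_set1 subrr mulr0.
by rewrite integral_cst//= lebesgue_measure_itv/= lte_fin bc -EFinB -EFinM.
Qed.

Lemma Rintegral_cst_bound (g : R -> R) (b c K : R) : b <= c -> continuous g ->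
  (forall x, b <= x -> x <= c -> `|g x| <= K) ->
  `|\int[leb]_(x in `[b, c]) g x| <= K * (c - b).
Proof.
move=> bc cg gK; apply: (@Rintegral_bound _ _ (fun=> K)) => //.
  exact: continuous_subspaceT.
by rewrite integral_cst_itv.
Qed.

Lemma continuous_integrable (g : R -> R) (b c : R) : continuous g ->
  leb.-integrable `[b, c] (EFin \o g).
Proof.
move=> cg; apply: continuous_compact_integrable; first exact: segment_compact.
exact: continuous_subspaceT.
Qed.

(** Otherwise the potential is of exact order u^-2 for large u, its weighted
square dominates c / u when s >= 3/4, and the norm of [phiu] diverges.  So the
limit of phi as u tends to infinity has zero mean over [1/2, ub]. *)
Lemma high_mean_small a s M Ub phi phiu (C : R) : 0 < a -> a <= 1 / 4 -> 3 / 4 <= s ->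
  s <= 1 -> 0 <= M -> 1 / 2 <= Ub -> flux_control a s M Ub phi phiu ->
  (forall ub, 1 / 2 <= ub -> ub <= Ub -> (weighted_sq s phiu ub < +oo)%E) ->
  0 <= C ->
  (forall u1 u2 x, 1 / 2 <= x -> x <= Ub -> Ub + 2 <= u1 ->
    u1 <= u2 -> `|phi u2 x - phi u1 x| <= C / u1) ->
  forall ub u1, 1 / 2 <= ub -> ub <= Ub -> Ub + 2 <= u1 ->
    `|\int[leb]_(x in `[1 / 2, ub]) phi u1 x| <= Ub * C / u1.
Proof.
move=> a0 a4 s34 s1 M0 Ub12 fc adm C0 hC ub u1 ub12 ubU Uu1.
have [K [K0 hK]] := high_bounded (ltW a0) a4 s34 s1 M0 fc.
have cphi := fc_cont fc.
rewrite leNgt; apply/negP => hlt.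
pose I u := \int[leb]_(x in `[1 / 2, ub]) phi u x.
pose d : R := `|I u1| - Ub * C / u1.
have d0 : 0 < d by rewrite subr_gt0.
have u10 : 0 < u1 by slra.
have Id u : u1 <= u -> d <= `|I u|.
  move=> uu.
  have : `|I u - I u1| <= C / u1 * (ub - 1 / 2).
    rewrite /I -RintegralB//; last 2 first.
    - exact/continuous_integrable/continuous_slice.
    - exact/continuous_integrable/continuous_slice.
    apply: Rintegral_cst_bound => //.
      by move=> x; apply: cvgB; apply: continuous_slice.
    by move=> x x1 x2; apply: hC => //; exact: le_trans ubU.
  have : C / u1 * (ub - 1 / 2) <= Ub * C / u1.
    rewrite -(mulrA Ub) [leLHS]mulrC; apply: ler_wpM2r; last by slra.
    by rewrite divr_ge0// ltW.
  have : `|I u1| <= `|I u| + `|I u - I u1|.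
    by rewrite -{1}[I u1](subKr (I u)) (le_trans (ler_normB _ _))// lerD2r.
  rewrite /d; slra.
pose E := K * 2 * Ub * Ub.
have E0 : 0 <= E by rewrite !mulr_ge0//; slra.
pose U := Num.max u1 (2 * E / d).
have potI u : u1 <= u -> `|u ^+ 2 * (potential_term a phi u ub / a) - I u| <= E / u.
  move=> uu; have u0 : 0 < u by slra.
  rewrite /potential_term (_ : Num.max (1 / 2) (2 - u) = 1 / 2); last first.
    by apply/max_idPl; slra.
  rewrite [a * _]mulrC mulfK ?gt_eqF// -RintegralZl//; last first.
    apply: continuous_compact_integrable; first exact: segment_compact.
    by apply: continuous_potential => //; slra.
  rewrite /I -RintegralB//; first last.
  - exact/continuous_integrable/continuous_slice.
  - apply: continuous_compact_integrable; first exact: segment_compact.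
    move=> x; apply: cvgM; first exact: cvg_cst.
    by apply: continuous_potential => //; slra.
  have -> : E / u = K * (2 * Ub / u) * Ub by rewrite /E; field; rewrite gt_eqF.
  apply: (@le_trans _ _ (K * (2 * Ub / u) * (ub - 1 / 2))); last first.
    rewrite ler_wpM2l//; last slra.
    by rewrite mulr_ge0// divr_ge0//; slra.
  apply: (@Rintegral_bound _ _ (fun=> K * (2 * Ub / u))) => //.
  - move=> x; apply: cvgB; last by apply: continuous_subspaceT; exact: continuous_slice.
    apply: cvgM; first exact: cvg_cst.
    by apply: continuous_potential => //; slra.
  - move=> x x1 x2.
    have ux0 : 0 < u + x by slra.
    have -> : u ^+ 2 * (phi u x / (u + x) ^+ 2) - phi u x =
        phi u x * - (x * (2 * u + x) / (u + x) ^+ 2).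
      by field; rewrite gt_eqF.
    rewrite normrM normrN; apply: ler_pM => //.
      by apply: hK => //; [slra|rewrite lowu_le; apply/andP; split; slra].
    have h0 : 0 <= x * (2 * u + x) by rewrite mulr_ge0//; slra.
    rewrite ger0_norm; last by rewrite divr_ge0// sqr_ge0.
    rewrite ler_pdivrMr ?exprn_gt0// mulrAC ler_pdivlMr//.
    nra.
  - by rewrite integral_cst_itv.
have u1U : u1 <= U by rewrite le_max lexx.
have lU : lowu ub <= U by rewrite lowu_le; apply/andP; split; slra.
have cpos : 0 < 2 / (Ub + 2) * (a * (d / 2)) ^+ 2.
  apply: mulr_gt0; first by apply: divr_gt0 => //; slra.
  by apply: exprn_gt0; apply: mulr_gt0 => //; slra.
apply: (fc_diverge fc ub12 ubU (adm _ ub12 ubU) cpos lU) => u Uu.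
have uu1 : u1 <= u by exact: le_trans Uu.
have u0 : 0 < u by slra.
have u1' : 1 <= u by slra.
have pl : a * (d / 2) / u ^+ 2 <= `|potential_term a phi u ub|.
  have hE : E / u <= d / 2.
    rewrite ler_pdivrMr//.
    have : 2 * E / d <= u by apply: le_trans Uu; rewrite le_max lexx orbT.
    by rewrite ler_pdivrMr//; slra.
  have hp := potI _ uu1; have hd := Id _ uu1.
  have : d / 2 <= `|u ^+ 2 * (potential_term a phi u ub / a)|.
    have := ler_normB (u ^+ 2 * (potential_term a phi u ub / a))
      (u ^+ 2 * (potential_term a phi u ub / a) - I u).
    rewrite subKr; slra.
  rewrite normrM (ger0_norm (sqr_ge0 u)) normrM normfV (gtr0_norm a0).
  rewrite mulrA ler_pdivlMr// => h.
  by rewrite ler_pdivrMr ?exprn_gt0// mulrC [leRHS]mulrC.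
have hw : 2 / (Ub + 2) * u ^+ 3 <= weight s u ub.
  rewrite /weight.
  have -> : u - ub = u * (1 - ub / u) by field; rewrite gt_eqF.
  have t2 : 2 / (Ub + 2) <= 1 - ub / u.
    rewrite ler_pdivrMr; last slra.
    rewrite mulrBl mul1r -[X in _ - X]mulrA.
    have : ub * (u^-1 * (Ub + 2)) <= ub * 1.
      rewrite ler_wpM2l//; first slra.
      by rewrite mulrC ler_pdivrMr// mul1r; slra.
    slra.
  have t0 : 0 < 2 / (Ub + 2) by rewrite divr_gt0//; slra.
  have tl1 : 2 / (Ub + 2) <= 1 by rewrite ler_pdivrMr; slra.
  rewrite powRM ?(ltW u0)//; last by apply: le_trans t2; exact: ltW.
  rewrite mulrA mulrC; apply: ler_pM; rewrite ?exprn_ge0 ?(ltW u0) ?(ltW t0)//.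
    rewrite -powR_mulrn ?(ltW u0)// -powR_add//; apply: ler_powR => //.
    slra.
  apply: (@le_trans _ _ ((2 / (Ub + 2)) `^ s)); last by apply: le_powR_pos => //; slra.
  by apply: ger1_powR => //; rewrite t0.
have -> : potential_term a phi u ub ^+ 2 = `|potential_term a phi u ub| ^+ 2.
  by rewrite real_normK// num_real.
apply: (@le_trans _ _ (2 / (Ub + 2) * u ^+ 3 * (a * (d / 2) / u ^+ 2) ^+ 2)).
  rewrite -subr_ge0 [X in 0 <= X](_ : _ = 0)//; field.
  by rewrite gt_eqF//=; slra.
apply: ler_pM => //.
- by rewrite mulr_ge0 ?exprn_ge0 ?divr_ge0//; slra.
- exact: sqr_ge0.
- rewrite lerXn2r// nnegrE// divr_ge0 ?sqr_ge0// mulr_ge0//; slra.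
Qed.

(** The means over all intervals [1/2, ub] vanish in the limit, so the limit
profile itself vanishes: a nonzero value would persist, by continuity, on an
interval of ub and by the rate 1 / u for all larger u.  Then the rate of
convergence is a rate of decay. *)
Lemma high_decay a s M Ub phi phiu : 0 < a -> a <= 1 / 4 -> 3 / 4 <= s ->
  s <= 1 -> 0 <= M -> 1 / 2 < Ub -> flux_control a s M Ub phi phiu ->
  (forall ub, 1 / 2 <= ub -> ub <= Ub -> (weighted_sq s phiu ub < +oo)%E) ->
  exists C : R, 0 <= C /\ forall u x, 1 / 2 <= x -> x <= Ub -> lowu x <= u ->
    `|phi u x| <= C / u.
Proof.
move=> a0 a4 s34 s1 M0 Ub12 fc adm.
have cphi := fc_cont fc.
have [K [K0 hK]] := high_bounded (ltW a0) a4 s34 s1 M0 fc.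
have [C [C0 hC]] := high_rate (ltW a0) a4 s34 s1 M0 (ltW Ub12) fc.
have mean := high_mean_small a0 a4 s34 s1 M0 (ltW Ub12) fc adm C0 hC.
have far u x : 1 / 2 <= x -> x <= Ub -> Ub + 2 <= u -> `|phi u x| <= C / u.
  move=> x12 xU Uu; rewrite leNgt; apply/negP => hlt.
  have u0 : 0 < u by slra.
  pose d : R := (`|phi u x| - C / u) / 2.
  have d0 : 0 < d by rewrite divr_gt0// subr_gt0.
  have [eta eta0 hcont] : exists2 eta : R, 0 < eta &
      forall y, `|y - x| < eta -> `|phi u y - phi u x| < d.
    have /cvgrPdist_lt/(_ _ d0) := @continuous_slice _ _ u cphi x.
    move=> /nbhs_ballP[e e0 he]; exists e => // y yx.
    by rewrite distrC; apply: he; rewrite /ball/= distrC.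
  pose x1 := Num.max (1 / 2) (x - eta / 2).
  pose x2 := Num.min Ub (x + eta / 2).
  have x112 : 1 / 2 <= x1 by rewrite le_max lexx.
  have x2U : x2 <= Ub by rewrite ge_min lexx.
  have x1x2 : x1 < x2.
    by rewrite lt_min !gt_max; apply/andP; split; apply/andP; split; slra.
  have near y : x1 <= y -> y <= x2 -> `|phi u y - phi u x| < d.
    move=> h1 h2; apply: hcont.
    have : x - eta / 2 <= y by apply: le_trans h1; rewrite le_max lexx orbT.
    have : y <= x + eta / 2 by apply: (le_trans h2); rewrite ge_min lexx orbT.
    by move=> ? ?; rewrite ltr_norml; apply/andP; split; slra.
  pose sg : R := if 0 <= phi u x then 1 else -1.
  have sgE : `|phi u x| = sg * phi u x.
    rewrite /sg; case: ifPn => [h|]; first by rewrite ger0_norm// mul1r.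
    by rewrite -ltNge => h; rewrite ltr0_norm// mulN1r.
  have sg1 : `|sg| = 1.
    by rewrite /sg; case: ifPn; rewrite ?normrN normr1.
  have lower v y : u <= v -> x1 <= y -> y <= x2 -> d <= sg * phi v y.
    move=> uv y1 y2.
    have h1 : `|phi v y - phi u y| <= C / u.
      by apply: hC => //; [exact: le_trans y1|exact: le_trans x2U].
    have h2 := near _ y1 y2.
    have h3 : `|sg * (phi v y - phi u x)| <= C / u + d.
      rewrite normrM sg1 mul1r -[X in `|X|](_ : phi v y - phi u y + (phi u y - phi u x) = _).
        by rewrite (le_trans (ler_normD _ _))// lerD// ltW.
      by ring.
    have h4 := ler_norm (- (sg * (phi v y - phi u x))); rewrite normrN in h4.
    have h5 : sg * phi v y = `|phi u x| + sg * (phi v y - phi u x).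
      by rewrite sgE; ring.
    have h6 : `|phi u x| = C / u + 2 * d by rewrite /d; field; rewrite gt_eqF.
    by rewrite h5 h6; slra.
  pose L := x2 - x1.
  have L0 : 0 < L by rewrite subr_gt0.
  (* so large that the means over [1/2, x1] and [1/2, x2] add up to less than d L *)
  pose v := Num.max u (2 * (Ub * C) / (d * L) + 1).
  have uv : u <= v by rewrite le_max lexx.
  have v0 : 0 < v by exact: lt_le_trans uv.
  have Iv : d * L <= `|\int[leb]_(y in `[x1, x2]) phi v y|.
    have -> : `|\int[leb]_(y in `[x1, x2]) phi v y| = `|\int[leb]_(y in `[x1, x2]) (sg * phi v y)|.
      rewrite RintegralZl//; last exact/continuous_integrable/continuous_slice.
      by rewrite normrM sg1 mul1r.
    apply: le_trans (ler_norm _).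
    have -> : d * L = \int[leb]_(y in `[x1, x2]) d.
      by rewrite /Rintegral integral_cst_itv// ltW.
    apply: le_Rintegral => //.
    - by apply: continuous_integrable => y; exact: cvg_cst.
    - apply: continuous_integrable => y; apply: cvgM; first exact: cvg_cst.
      exact: continuous_slice.
    - by move=> y /=; rewrite in_itv/= => /andP[y1 y2]; exact: lower.
  have split : \int[leb]_(y in `[x1, x2]) phi v y =
      \int[leb]_(y in `[1 / 2, x2]) phi v y - \int[leb]_(y in `[1 / 2, x1]) phi v y.
    rewrite (@Rintegral_itvB _ _ (BLeft (1 / 2)) (BRight x2) x1).
    - rewrite Rintegral_itv_obnd_cbnd//.
      have ic : leb.-integrable `[x1, x2] (EFin \o phi v).
        exact/continuous_integrable/continuous_slice.
      apply: integrableS ic => // y /=.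
      by rewrite !in_itv/= => /andP[/ltW-> ->].
    - exact/continuous_integrable/continuous_slice.
    - by rewrite bnd_simp.
    - by rewrite bnd_simp ltW.
  have h1 := mean _ _ (le_trans x112 (ltW x1x2)) x2U (le_trans Uu uv).
  have h2 := mean _ _ x112 (le_trans (ltW x1x2) x2U) (le_trans Uu uv).
  have h3 : d * L <= 2 * (Ub * C) / v.
    apply: (le_trans Iv); rewrite split (le_trans (ler_normB _ _))//.
    by rewrite -mulrA; slra.
  move: h3; rewrite ler_pdivlMr// leNgt => /negP; apply.
  rewrite [ltRHS]mulrC -ltr_pdivrMr ?(mulr_gt0 d0 L0)//.
  by rewrite /v lt_max ltrDl ltr01 orbT.
exists (K * (Ub + 2) + C); split; first by rewrite addr_ge0// mulr_ge0//; slra.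
move=> u x x12 xU xu; have [l1 l2 l3] := lowuP x.
have u0 : 0 < u by slra.
rewrite mulrDl.
have [uU|Uu] := leP u (Ub + 2).
  apply: (@le_trans _ _ K); first exact: hK.
  apply: (@le_trans _ _ (K * (Ub + 2) / u)); last by rewrite lerDl divr_ge0// ltW.
  by rewrite ler_pdivlMr// ler_wpM2l.
apply: (le_trans (far _ _ x12 xU (ltW Uu))).
by rewrite lerDr divr_ge0 ?(ltW u0)// mulr_ge0//; slra.
Qed.

Lemma weightE s u ub : 0 < u -> ub <= u ->
  weight s u ub = u `^ (4 * s) * (1 - ub / u) `^ s.
Proof.
move=> u0 uu; rewrite /weight.
have -> : u - ub = u * (1 - ub / u) by field; rewrite gt_eqF.
rewrite powRM ?(ltW u0)//; last by rewrite subr_ge0 ler_pdivrMr// mul1r.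
by rewrite mulrA -powR_add//; congr (_ `^ _ * _); ring.
Qed.

(** The decay makes the norms uniformly finite in ub, which starts the bootstrap.
Integrating from infinity, where phi vanishes, the Cauchy-Schwarz inequality
bounds phi by the supremum Y of the squared norms, and the potential returns
2 a^2 Y <= Y / 8. *)
Lemma high_regime a s M Ub phi phiu : 0 < a -> a <= 1 / 4 -> 3 / 4 <= s ->
  s <= 1 -> 0 <= M -> flux_control a s M Ub phi phiu ->
  (forall ub, 1 / 2 <= ub -> ub <= Ub -> (weighted_sq s phiu ub < +oo)%E) ->
  forall ub, 1 / 2 <= ub -> ub <= Ub ->
  (weighted_sq s phiu ub <= (3 * M ^+ 2)%:E)%E.
Proof.
move=> a0 a4 s34 s1 M0 fc adm ub0' ub0'12 ub0'U.
have cphi := fc_cont fc.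
have M20 : 0 <= M ^+ 2 by exact: sqr_ge0.
have r1 : -2 < -1 :> R by slra.
have [Ub12|Ub12] := leP Ub (1 / 2).
  have [K [K0 hK]] := high_bounded (ltW a0) a4 s34 s1 M0 fc.
  apply: (le_trans (fc_norm fc ub0'12 ub0'U (lexx 0) r1 _)).
    move=> u uu; rewrite mul0r.
    have := potential_term_le_cst (ltW a0) cphi ub0'12 uu K0
      (fun x h1 h2 h3 => hK _ _ h1 (le_trans h2 ub0'U) h3).
    rewrite (_ : ub0' = 1 / 2) ?subrr ?mulr0 ?mul0r ?normr_le0; last slra.
    by move=> /eqP ->; rewrite expr0n mulr0.
  by rewrite mul0r mulr0 addr0 lee_fin; slra.
have [C [C0 hC]] := high_decay a0 a4 s34 s1 M0 Ub12 fc adm.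
pose k : R := (a * C * Ub) ^+ 2.
have unif ub : 1 / 2 <= ub -> ub <= Ub -> (weighted_sq s phiu ub <= (2 * M ^+ 2 + 2 * k)%:E)%E.
  move=> ub12 ubU; have [l1 l2 l3] := lowuP ub.
  have k0 : 0 <= k by exact: sqr_ge0.
  apply: (le_trans (fc_norm fc ub12 ubU k0 r1 _)).
    move=> u uu; have u0 : 0 < u by slra.
    have u1 : 1 <= u by slra.
    have p0 : 0 <= C / u by rewrite divr_ge0// ltW.
    have hp := potential_term_le_cst (ltW a0) cphi ub12 uu p0
      (fun x h1 h2 h3 => hC _ _ h1 (le_trans h2 ubU) h3).
    have hp' : `|potential_term a phi u ub| <= a * C * Ub / u ^+ 3.
      apply: (le_trans hp).
      have -> : a * (C / u) * (ub - 1 / 2) / u ^+ 2 = a * C * (ub - 1 / 2) / u ^+ 3.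
        by field; rewrite gt_eqF.
      rewrite ler_pM2r ?invr_gt0 ?exprn_gt0// ler_wpM2l//; last slra.
      by rewrite mulr_ge0// ltW.
    have -> : potential_term a phi u ub ^+ 2 = `|potential_term a phi u ub| ^+ 2.
      by rewrite real_normK// num_real.
    apply: (@le_trans _ _ (u ^+ 4 * (a * C * Ub / u ^+ 3) ^+ 2)).
      apply: ler_pM; rewrite ?weight_ge0 ?sqr_ge0//.
        apply: (@le_trans _ _ (u `^ (4 * s))); first by apply: weight_le => //; slra.
        rewrite -powR_mulrn ?(ltW u0)//; apply: ler_powR => //; slra.
      rewrite lerXn2r// nnegrE//; apply: divr_ge0; last by rewrite exprn_ge0// ltW.
      by rewrite !mulr_ge0//; slra.
    rewrite powRN2 ?(ltW u0)// /k.
    rewrite -subr_ge0 [X in 0 <= X](_ : _ = 0)//; field.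
    by rewrite gt_eqF.
  have -> : -2 + 1 = -1 :> R by ring.
  rewrite opprK divr1 powR_inv1; last slra.
  rewrite lee_fin lerD2l ler_wpM2l// -[leRHS]mulr1 ler_wpM2l// invf_le1//; slra.
have unif' ub : 1 / 2 <= ub -> ub <= Ub ->
    weighted_sq s phiu ub = (fine (weighted_sq s phiu ub))%:E.
  move=> h1 h2; rewrite fineK// ge0_fin_numE; first exact: adm.
  by apply: integral_ge0 => u _; rewrite lee_fin mulr_ge0 ?sqr_ge0// mulr_ge0 ?powR_ge0.
pose D := [set ub | 1 / 2 <= ub /\ ub <= Ub].
pose X ub : R := fine (weighted_sq s phiu ub).
have X0 ub : D ub -> 0 <= X ub.
  move=> _; apply: fine_ge0; apply: integral_ge0 => u _.
  by rewrite lee_fin mulr_ge0 ?sqr_ge0// mulr_ge0 ?powR_ge0.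
rewrite unif'// lee_fin.
suff : X ub0' <= (2 * M ^+ 2) / (1 - 1 / 8).
  move/le_trans; apply; rewrite ler_pdivrMr; slra.
apply: (@contraction_bound _ _ D X) => //; first slra.
  exists (2 * M ^+ 2 + 2 * k) => ub [ub12 ubU].
  by rewrite -lee_fin /X -unif'//; exact: unif.
move=> Y Y0 XY ub [ub12 ubU].
rewrite -lee_fin /X -unif'//.
have [l1 l2 l3] := lowuP ub.
pose N : R := Num.sqrt Y.
have N0 : 0 <= N by exact: sqrtr_ge0.
have NY : N ^+ 2 = Y by exact: sqr_sqrtr.
have k0 : 0 <= a ^+ 2 * Y * ub by rewrite !mulr_ge0 ?sqr_ge0//; slra.
apply: (le_trans (fc_norm fc ub12 ubU k0 r1 _)).
  move=> u uu; have u0 : 0 < u by slra.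
  have ubu : ub <= u by slra.
  rewrite weightE//.
  have [->|ubnu] := eqVneq ub u.
    rewrite divff ?gt_eqF// subrr powR0; last by rewrite gt_eqF//; slra.
    by rewrite mulr0 mul0r; rewrite !mulr_ge0 ?sqr_ge0 ?powR_ge0// ltW.
  have {}ubnu : ub < u by rewrite lt_neqAle ubnu.
  pose t : R := 1 - ub / u.
  have t0 : 0 < t by rewrite subr_gt0 ltr_pdivrMr// mul1r.
  pose J := u `^ ((1 - 4 * s) / 2) * t `^ (- s / 2).
  have J0 : 0 <= J by rewrite mulr_ge0 ?powR_ge0.
  have hphi x : 1 / 2 <= x -> x <= ub -> lowu x <= u -> `|phi u x| <= N * J.
    move=> x12 xub xu.
    have xU := le_trans xub ubU.
    have xlu : x < u by exact: le_lt_trans ubnu.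
    have x0 : 0 < x by slra.
    have s12 : 1 / 2 <= s by slra.
    have hJ B : u <= B -> (\int[leb]_(z in `[u, B]) (inv_weight s z x)%:E <= (J ^+ 2)%:E)%E.
      move=> uB; apply: (le_trans (integral_inv_weight_far s12 x0 xlu uB)).
      rewrite lee_fin exprMn !powR_sq.
      have -> : 2 * ((1 - 4 * s) / 2) = 1 - 4 * s by field.
      have -> : 2 * (- s / 2) = - s by field.
      rewrite ler_wpM2l ?powR_ge0//; apply: le_powR_neg => //; last slra.
      by rewrite lerD2l lerN2 ler_pM2r ?invr_gt0.
    have hN : (weighted_sq s phiu x <= (N ^+ 2)%:E)%E.
      by rewrite NY unif'// lee_fin; apply: XY.
    apply/ler_addgt0Pr => e e0.
    pose B := Num.max u (C / e).
    have uB : u <= B by rewrite le_max lexx.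
    have B0 : 0 < B by exact: lt_le_trans uB.
    have hB : `|phi B x| <= e.
      apply: (le_trans (hC _ _ x12 xU (le_trans xu uB))).
      rewrite ler_pdivrMr// -ler_pdivrMl// mulrC.
      by rewrite le_max lexx orbT.
    have hd := fc_cs fc x12 xU xu uB N0 J0 hN (hJ B uB).
    rewrite -[phi u x](subKr (phi B x)) (le_trans (ler_normB _ _))//.
    by rewrite [leRHS]addrC lerD.
  have NJ0 : 0 <= N * J by rewrite mulr_ge0.
  have hp := potential_term_le_cst (ltW a0) cphi ub12 uu NJ0 hphi.
  have hp' : `|potential_term a phi u ub| <= a * (N * J) * ub / u ^+ 2.
    apply: (le_trans hp); rewrite ler_pM2r ?invr_gt0 ?exprn_gt0// ler_wpM2l//; last slra.
    by rewrite mulr_ge0// ltW.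
  have -> : potential_term a phi u ub ^+ 2 = `|potential_term a phi u ub| ^+ 2.
    by rewrite real_normK// num_real.
  apply: (@le_trans _ _ (u `^ (4 * s) * t `^ s * (a * (N * J) * ub / u ^+ 2) ^+ 2)).
    apply: ler_wpM2l; first by rewrite mulr_ge0 ?powR_ge0.
    rewrite lerXn2r// nnegrE//; apply: divr_ge0; last exact: sqr_ge0.
    apply: mulr_ge0; last by clear -ub12; lra.
    by apply: mulr_ge0 => //; exact: ltW.
  have JE : u `^ (4 * s) * t `^ s * J ^+ 2 = u.
    rewrite /J exprMn !powR_sq.
    have -> : 2 * ((1 - 4 * s) / 2) = 1 - 4 * s by field.
    have -> : 2 * (- s / 2) = - s by field.
    rewrite mulrACA -!powR_add// addrN powRr0 mulr1.
    by rewrite (_ : 4 * s + (1 - 4 * s) = 1) ?powRr1 ?(ltW u0)//; ring.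
  have -> : u `^ (4 * s) * t `^ s * (a * (N * J) * ub / u ^+ 2) ^+ 2 =
      (u `^ (4 * s) * t `^ s * J ^+ 2) * (a ^+ 2 * N ^+ 2 * ub ^+ 2 / u ^+ 4).
    by field; rewrite gt_eqF.
  rewrite JE NY powRN2 ?(ltW u0)//.
  have -> : u * (a ^+ 2 * Y * ub ^+ 2 / u ^+ 4) = a ^+ 2 * Y * ub / u ^+ 2 * (ub / u).
    by field; rewrite gt_eqF.
  rewrite -[leRHS]mulr1; apply: ler_wpM2l.
    by rewrite divr_ge0 ?sqr_ge0.
  by rewrite ler_pdivrMr// mul1r.
have -> : -2 + 1 = -1 :> R by ring.
rewrite opprK divr1 powR_inv1; last slra.
rewrite lee_fin lerD2l.
have h1 : ub / lowu ub <= 1 by rewrite ler_pdivrMr ?mul1r//; slra.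
have h2 : a ^+ 2 <= 1 / 16 by nra.
have h3 : a ^+ 2 * Y <= 1 / 16 * Y by rewrite ler_wpM2r.
have h4 : a ^+ 2 * Y * (ub / lowu ub) <= a ^+ 2 * Y * 1.
  by rewrite ler_wpM2l// mulr_ge0 ?sqr_ge0.
rewrite mulr1 in h4; rewrite -mulrA.
by clear -h3 h4; lra.
Qed.

End high_regime.

(** * The regime 1/2 <= s < 3/4 *)

Section mid_regime.
Context (R : realType).
Local Notation leb := (@lebesgue_measure R).
Implicit Types (a s M Ub u x ub : R) (phi phiu : R -> R -> R).

Lemma inv_weight_axis_sq s ub u1 u2 : 1 / 2 <= s -> s <= 3 / 4 -> 0 < ub ->
  ub <= u1 -> u1 <= u2 ->
  (\int[leb]_(u in `[u1, u2]) (inv_weight s u ub)%:E <=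
   ((2 * u1 `^ (- ((4 * s - 1) / 2))) ^+ 2)%:E)%E.
Proof.
move=> s12 s34 ub0 uu u12.
have s1 : s < 1 by slra.
apply: (le_trans (integral_inv_weight_tail s12 s1 ub0 uu u12)).
rewrite lee_fin exprMn powR_sq.
have -> : 2 * - ((4 * s - 1) / 2) = 1 - 4 * s by field.
rewrite mulrC ler_wpM2r ?powR_ge0// -[leLHS]div1r ler_pdivrMr; slra.
Qed.

(** On the strip of small ub the potential is a contraction in the supremum
norm. *)
Lemma mid_strip a s M Ub phi phiu u ub :
  0 <= a -> a <= 1 / 4 -> 1 / 2 <= s -> s <= 3 / 4 -> 0 <= M ->
  flux_control a s M Ub phi phiu ->
  1 / 2 <= ub -> ub <= Ub -> ub <= 2 -> lowu ub <= u -> `|phi u ub| <= 5 * M.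
Proof.
move=> a0 a4 s12 s34 M0 fc ub12 ubU ub2 uu.
have cphi := fc_cont fc.
have [K hK] := bounded_on_strip Ub u cphi.
pose D := [set t : R * R | [/\ 1 / 2 <= t.2, t.2 <= Ub, t.2 <= 2, lowu t.2 <= t.1 & t.1 <= u]].
pose X (t : R * R) : R := `|phi t.1 t.2|.
have Xle : X (u, ub) <= (3 * M) / (1 - 3 / 8).
  apply: (@contraction_bound _ _ D X) => //; first slra.
  - exists K => -[v x] [/= x12 xU x2 vx vu]; rewrite /X/=.
    have [l1 l2 l3] := lowuP x; apply: hK => //; clear -x12 vx l1; slra.
  - move=> P P0 XP [v x] [/= x12 xU x2 vx vu]; rewrite /X/=.
    have [l1 l2 l3] := lowuP x.
    have x0 : 0 < x by clear -x12; slra.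
    have w0 : 0 < lowu x by clear -l1; slra.
    have hJ := inv_weight_axis_sq s12 s34 x0 l2 vx.
    set J := 2 * lowu x `^ _ in hJ.
    have J0 : 0 <= J by rewrite mulr_ge0 ?powR_ge0.
    have J2 : J <= 2.
      rewrite /J -[leRHS]mulr1 ler_wpM2l// powRN invf_le1 ?powR_gt0//.
      have q0 : 0 <= (4 * s - 1) / 2 by clear -s12; slra.
      by rewrite -[leLHS](powRr0 (lowu x)); apply: ler_powR.
    have hp z : lowu x <= z -> z <= v ->
        `|potential_term a phi z x| <= a * P * (x - 1 / 2) / z ^+ 2.
      move=> z1 z2; apply: potential_term_le_cst => // y y1 y2 y3.
      apply: (XP (z, y)); split => //=.
      - exact: le_trans xU.
      - exact: le_trans x2.
      - exact: le_trans vu.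
    have hd := flux_step fc x12 xU (lexx _) vx J0 hJ hp.
    have hlow : `|phi (lowu x) x| <= M.
      have [x1|x1] := leP x 1; first exact: (fc_init fc).
      by rewrite lowu_id ?(ltW x1)// (fc_axis fc (ltW x1) xU) normr0.
    have hc : a * P * (x - 1 / 2) * ((lowu x)^-1 - v^-1) <= 3 / 8 * P.
      have aP : a * P <= 1 / 4 * P by rewrite ler_wpM2r.
      have aP0 : 0 <= a * P by rewrite mulr_ge0.
      have i1 : (lowu x)^-1 - v^-1 <= 1.
        rewrite (@le_trans _ _ (lowu x)^-1)// ?gerBl ?invr_ge0.
          by rewrite (le_trans (ltW w0)).
        by rewrite invf_le1.
      have xx : 0 <= a * P * (x - 1 / 2).
        by rewrite mulr_ge0//; clear -x12; slra.
      apply: (@le_trans _ _ (a * P * (x - 1 / 2) * 1)); first by rewrite ler_wpM2l.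
      rewrite mulr1; apply: (@le_trans _ _ (a * P * (3 / 2))).
        by rewrite ler_wpM2l//; clear -x2; slra.
      by clear -aP; slra.
    have MJ : M * J <= M * 2 by rewrite ler_wpM2l.
    rewrite -[phi v x](subrK (phi (lowu x) x)) (le_trans (ler_normD _ _))//.
    by clear -hd hlow hc MJ; slra.
  - by move=> t _; exact: normr_ge0.
apply: (le_trans Xle).
by rewrite ler_pdivrMr; clear -M0; slra.
Qed.

(** The scalar equation y h' = r - a h with h(2) = 0, integrated with the
factor y^a; only the sizes of r and of h survive. *)
Lemma linear_ode_bound (a b c r0 : R) (f : R -> R) : 0 <= a -> 0 < b -> b < 1 ->
  2 <= c -> 0 <= r0 -> continuous f ->
  let H x := \int[leb]_(y in `[2, x]) f y in
  (forall x, 2 <= x -> x <= c -> `|f x + a / x * H x| <= r0 * x `^ (- b)) ->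
  forall x, 2 <= x -> x <= c -> `|H x| <= r0 / (a + 1 - b) * x `^ (1 - b).
Proof.
move=> a0 b0 b1 c2 r00 cf H hH.
have ab0 : 0 < a + 1 - b by slra.
have key (sg : R) : `|sg| = 1 -> forall x, 2 <= x -> x <= c ->
    sg * H x <= r0 / (a + 1 - b) * x `^ (1 - b).
  move=> sg1 x x2 xc.
  have x0 : 0 < x by slra.
  pose S (y : R) : R := sg * (y `^ a * H y) - r0 / (a + 1 - b) * y `^ (a + 1 - b).
  have dH (y : R) : 2 < y -> is_derive y (1 : R) H (f y).
    move=> y2.
    have [d1 d2] := @continuous_FTC1_closed _ f 2 y (y + 1) (ltr_pwDr ltr01 (lexx y))
      (continuous_integrable _ _ cf) y2 (cf y).
    by rewrite -d2 derive1E; exact: derivableP.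
  have dS (y : R) : 2 < y -> is_derive y (1 : R) S
      (sg * (y `^ a * f y + (a * y `^ (a - 1)) * H y) -
       r0 / (a + 1 - b) * ((a + 1 - b) * y `^ (a + 1 - b - 1))).
    move=> y2; have y0 : 0 < y by slra.
    have h1 := dH _ y2.
    have h2 := is_derive1_powR a y0.
    have h3 := is_derive1_powR (a + 1 - b) y0.
    rewrite /S.
    apply: is_derive_eq.
    by rewrite /GRing.scale/=; ring.
  have cS : {within `[2, x], continuous S}.
    have cpow r : {within `[2, x], continuous (fun y : R => y `^ r)}.
      apply: continuous_in_subspaceT => y; rewrite inE/= in_itv/= => /andP[y2 _].
      by apply: continuous_powR_pos; slra.
    have cH : {within `[2, x], continuous H}.
      by apply: parameterized_integral_continuous => //; exact: continuous_integrable.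
    move=> y; apply: cvgB; apply: cvgM; try exact: cvg_cst; last exact: cpow.
    by apply: cvgM; [exact: cpow|exact: cH].
  have : S x <= S 2.
    apply: (ler0_derive1_le_cc (a := 2) (b := x)) => //; rewrite ?in_itv/= ?lexx//.
    - by move=> y; rewrite in_itv/= => /andP[/dS[]].
    - move=> y; rewrite in_itv/= => /andP[y2 yx].
      have [y0 yc] : 0 < y /\ y <= c by split; [slra|slra].
      have := dS _ y2 => dSy; rewrite derive1E (derive_val (is_derive := dSy)).
      have E : y `^ a * f y + (a * y `^ (a - 1)) * H y = y `^ a * (f y + a / y * H y).
        have -> : y `^ (a - 1) = y `^ a / y.
          by rewrite powR_add// powR_inv1// ltW.
        by field; rewrite gt_eqF.
      have hQ : sg * (f y + a / y * H y) <= r0 * y `^ (- b).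
        by apply: (le_trans (ler_norm _)); rewrite normrM sg1 mul1r; apply: hH => //; exact: ltW.
      have -> : a + 1 - b - 1 = a + - b by ring.
      rewrite E powR_add//.
      have -> : sg * (y `^ a * (f y + a / y * H y)) -
          r0 / (a + 1 - b) * ((a + 1 - b) * (y `^ a * y `^ (- b))) =
          y `^ a * (sg * (f y + a / y * H y) - r0 * y `^ (- b)).
        have q0 : a + 1 - b != 0 by rewrite gt_eqF.
        by rewrite [X in _ - X]mulrA divfK//; ring.
      by rewrite mulr_ge0_le0 ?powR_ge0// subr_le0.
    - by rewrite x2.
  have H2 : H 2 = 0 by rewrite /H set_itv1 Rintegral_set1.
  rewrite {2}/S H2 !mulr0 sub0r => SxS2.
  have Sx0 : S x <= 0.
    by apply: (le_trans SxS2); rewrite oppr_le0 mulr_ge0 ?powR_ge0// divr_ge0// ltW.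
  have xa0 : 0 < x `^ a by rewrite powR_gt0.
  rewrite -(ler_pM2l xa0); move: Sx0; rewrite /S subr_le0.
  have -> : a + 1 - b = a + (1 - b) by ring.
  by rewrite powR_add// mulrCA [X in _ <= X -> _]mulrCA.
move=> x x2 xc; rewrite ler_norml; apply/andP; split.
  have := key (-1) _ x x2 xc; rewrite normrN normr1 mulN1r lerNl; exact.
by have := key 1 (normr1 _) x x2 xc; rewrite mul1r.
Qed.

(** The power decreases in b, and (z^(1/2) - 1)^2 >= 0. *)
Lemma powR_half_le (z b : R) : 0 < z -> z <= 1 -> 1 / 2 <= b -> z `^ b <= (1 + z) / 2.
Proof.
move=> z0 z1 b12.
apply: (@le_trans _ _ (z `^ (1 / 2))); first by apply: ger_powR => //; rewrite z0.
have h2 := powR_half_sq (ltW z0); set h := z `^ (1 / 2) in h2 *.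
rewrite ler_pdivlMr; last slra.
have := sqr_ge0 (h - 1); rewrite -h2 sqrrB1 => ?; slra.
Qed.

(** The potential splits into its value for the profile at u = B, which is
H / u^2 for the primitive H of the profile, and two errors: the variation of
(u + x)^-2 in x, and the difference between phi at u and at B. *)
Lemma mid_potential a s M Ub phi phiu (b T Z B : R) ub u1 u :
  0 <= a -> a <= 1 / 4 -> 1 / 2 <= s -> s <= 3 / 4 -> 0 <= M ->
  flux_control a s M Ub phi phiu ->
  1 / 2 <= b -> b <= 1 -> 0 <= T -> 0 <= Z ->
  (forall x v, 2 <= x -> x <= Ub -> x <= v -> v <= B ->
    `|phi B x - phi v x| <= T * v `^ (- b)) ->
  (forall x, 2 <= x -> x <= Ub -> `|phi B x| <= Z * x `^ (- b)) ->
  2 <= ub -> ub <= Ub -> ub <= u1 -> u1 <= u -> u <= B ->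
  `|potential_term a phi u ub - a * (\int[leb]_(x in `[2, ub]) phi B x) / u ^+ 2| <=
   (2 * M + a * T * ub * u1 `^ (- b) / 2) / u ^+ 2 +
   2 * (a * Z * ub `^ (2 - b) + a * T * ub * u1 `^ (- b) * u1 / 4) / u ^+ 3.
Proof.
move=> a0 a4 s12 s34 M0 fc b12 b1 T0 Z0 hT hZ ub2 ubU uu1 u1u uB.
have cphi := fc_cont fc.
have u0 : 0 < u by slra.
have u10 : 0 < u1 by slra.
have ub0 : 0 < ub by slra.
have ubu : ub <= u by slra.
have ig (c d v : R) : 0 <= c -> 0 < v ->
    leb.-integrable `[c, d] (EFin \o (fun x => phi v x / (v + x) ^+ 2)).
  move=> c0 v0; apply: continuous_compact_integrable; first exact: segment_compact.
  exact: continuous_potential.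
have split : potential_term a phi u ub =
    a * \int[leb]_(x in `[1 / 2, 2]) (phi u x / (u + x) ^+ 2) +
    a * \int[leb]_(x in `[2, ub]) (phi u x / (u + x) ^+ 2).
  rewrite /potential_term (_ : Num.max (1 / 2) (2 - u) = 1 / 2); last first.
    by apply/max_idPl; slra.
  rewrite -mulrDr; congr (a * _).
  have i1 := ig (1 / 2) ub u (ltW (divr_gt0 ltr01 (ltr0n _ 2))) u0.
  have := @Rintegral_itvB R _ (BLeft (1 / 2)) (BRight ub) 2 i1.
  rewrite !bnd_simp => /(_ _ ub2) E.
  rewrite -[X in _ = _ + X]Rintegral_itv_obnd_cbnd; last first.
    by apply: integrableS (ig 2 ub u (ler0n _ 2) u0) => // y /=; rewrite !in_itv/= => /andP[/ltW-> ->].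
  rewrite -E; first by rewrite addrC subrK.
  by slra.
rewrite split -addrA (le_trans (ler_normD _ _))// normrM (ger0_norm a0).
have e1 : a * `|\int[leb]_(x in `[1 / 2, 2]) (phi u x / (u + x) ^+ 2)| <= 2 * M / u ^+ 2.
  have hstrip x : 1 / 2 <= x -> x <= 2 -> `|phi u x| <= 5 * M * x `^ 0.
    move=> x12 x2; rewrite powRr0 mulr1; apply: (mid_strip a0 a4 s12 s34 M0 fc) => //.
      by slra.
    by rewrite lowu_le; apply/andP; split; slra.
  have h12 : 0 <= 1 / 2 :> R by slra.
  have h122 : 1 / 2 <= 2 :> R by slra.
  have r1 : -1 < 0 :> R by slra.
  have M50 : 0 <= 5 * M by slra.
  have := potential_piece_le cphi u0 h12 h122 r1 M50 hstrip.
  rewrite add0r divr1 !powRr1 ?(ltW (divr_gt0 ltr01 (ltr0n _ 2)))//.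
  move=> h; apply: (@le_trans _ _ (1 / 4 * (5 * M * (2 - 1 / 2) / u ^+ 2))).
    by apply: ler_pM => //; exact: normr_ge0.
  rewrite mulrA ler_pM2r ?invr_gt0 ?exprn_gt0//; slra.
have e2 : `|a * \int[leb]_(x in `[2, ub]) (phi u x / (u + x) ^+ 2) -
    a * (\int[leb]_(x in `[2, ub]) phi B x) / u ^+ 2| <=
    a * ((2 * Z * ub `^ (1 - b) / u ^+ 3 + T * u `^ (- b) / u ^+ 2) * (ub - 2)).
  have iB : leb.-integrable `[2, ub] (EFin \o phi B).
    exact/continuous_integrable/continuous_slice.
  rewrite -mulrA -mulrBr normrM (ger0_norm a0) ler_wpM2l// -RintegralZr//.
  rewrite -RintegralB//; last 2 first.
  - exact: ig.
  - apply: (@continuous_integrable R (fun x => phi B x / u ^+ 2)) => y.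
    by apply: cvgM; [exact: continuous_slice|exact: cvg_cst].
  apply: (@Rintegral_bound _ _ (fun=> 2 * Z * ub `^ (1 - b) / u ^+ 3 + T * u `^ (- b) / u ^+ 2)) => //.
  - have cB : {within `[2, ub], continuous (fun x => phi B x / u ^+ 2)}.
      apply: continuous_subspaceT => z.
      by apply: cvgM; [exact: continuous_slice|exact: cvg_cst].
    by move=> y; apply: cvgB; [exact: continuous_potential|exact: cB].
  - move=> x x2 xub.
    have xU : x <= Ub by slra.
    have x0 : 0 < x by slra.
    have xu : x <= u by slra.
    have ux0 : 0 < u + x by slra.
    have -> : phi u x / (u + x) ^+ 2 - phi B x / u ^+ 2 =
       - (phi B x * (x * (2 * u + x) / (u ^+ 2 * (u + x) ^+ 2))) -
       (phi B x - phi u x) / (u + x) ^+ 2.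
      by field; rewrite !gt_eqF.
    rewrite (le_trans (ler_normB _ _))//; apply: lerD.
      rewrite normrN normrM.
      have q0 : 0 <= x * (2 * u + x) / (u ^+ 2 * (u + x) ^+ 2).
        apply: divr_ge0; first by apply: mulr_ge0; slra.
        by rewrite mulr_ge0 ?sqr_ge0.
      rewrite (ger0_norm q0).
      have q1 : x * (2 * u + x) / (u ^+ 2 * (u + x) ^+ 2) <= 2 * x / u ^+ 3.
        rewrite ler_pdivrMr; last by rewrite mulr_gt0 ?exprn_gt0.
        have -> : 2 * x / u ^+ 3 * (u ^+ 2 * (u + x) ^+ 2) = x * (2 * (u + x) ^+ 2 / u).
          by field; rewrite gt_eqF.
        rewrite ler_pM2l// ler_pdivlMr//; clear -u0 x0; nra.
      apply: (@le_trans _ _ (Z * x `^ (- b) * (2 * x / u ^+ 3))).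
        by apply: ler_pM => //; exact: hZ.
      have -> : Z * x `^ (- b) * (2 * x / u ^+ 3) = 2 * Z * (x `^ (- b) * x) / u ^+ 3 by ring.
      rewrite ler_pM2r ?invr_gt0 ?exprn_gt0// ler_wpM2l//; first by rewrite mulr_ge0.
      rewrite -{2}(powRr1 (ltW x0)) -powR_add// addrC.
      by apply: le_powR_pos => //; [exact: ltW|slra].
    rewrite normrM normfV (ger0_norm (sqr_ge0 _)).
    apply: ler_pM => //; first by rewrite invr_ge0 sqr_ge0.
      exact: hT.
    by rewrite lef_pV2 ?posrE ?exprn_gt0// lerXn2r ?nnegrE ?(ltW u0) ?(ltW ux0)//; slra.
  - by rewrite integral_cst_itv.
apply: (le_trans (lerD e1 e2)).
have hz : u `^ (- b) <= u1 `^ (- b) * ((1 + u1 / u) / 2).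
  have z0 : 0 < u1 / u by rewrite divr_gt0.
  have z1 : u1 / u <= 1 by rewrite ler_pdivrMr// mul1r.
  have := powR_half_le z0 z1 b12.
  rewrite powRM ?(ltW u10) ?invr_ge0 ?(ltW u0)// powR_invl// -powRN => h.
  by rewrite [X in _ <= X * _]powRN ler_pdivlMl ?powR_gt0.
have p1 : ub `^ (2 - b) = ub `^ (1 - b) * ub.
  by rewrite -{3}(powRr1 (ltW ub0)) -powR_add//; congr (_ `^ _); ring.
have w0 : 0 <= u1 `^ (- b) by exact: powR_ge0.
have y0 : 0 <= ub `^ (1 - b) by exact: powR_ge0.
rewrite p1; set w := u1 `^ (- b) in hz w0 *; set y := ub `^ (1 - b) in y0 *.
apply: (@le_trans _ _ (2 * M / u ^+ 2 + a * ((2 * Z * y / u ^+ 3 + T * (w * ((1 + u1 / u) / 2)) / u ^+ 2) * ub))).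
  rewrite lerD2l ler_wpM2l//; apply: ler_pM => //.
  - apply: addr_ge0; apply: divr_ge0; rewrite ?exprn_ge0 ?(ltW u0)//.
      by rewrite !mulr_ge0.
    by rewrite mulr_ge0 ?powR_ge0.
  - slra.
  - by rewrite lerD2l ler_pM2r ?invr_gt0 ?exprn_gt0// ler_wpM2l.
  - slra.
rewrite le_eqVlt; apply/orP; left; apply/eqP; field.
by rewrite gt_eqF.
Qed.

(** Trades decay in the first variable for decay in the second. *)
Lemma powR_exchange (x y b r : R) : 0 < x -> x <= y -> b <= r ->
  x `^ (r - b) / y `^ r <= y `^ (- b).
Proof.
move=> x0 xy br; have y0 := lt_le_trans x0 xy.
rewrite ler_pdivrMr ?powR_gt0// -powR_add// addrC.
apply: le_powR_pos => //; first exact: ltW.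
by rewrite addrC subr_ge0.
Qed.

(** Step estimate between the abscissas u1 and B, the part of the potential
coming from the profile at B being integrated exactly. *)
Lemma mid_step a s M Ub phi phiu (b T Z B : R) ub u1 :
  0 <= a -> a <= 1 / 4 -> 1 / 2 <= s -> s <= 3 / 4 -> 0 <= M ->
  flux_control a s M Ub phi phiu ->
  b = (4 * s - 1) / 2 -> 0 <= T -> 0 <= Z ->
  (forall x v, 2 <= x -> x <= Ub -> x <= v -> v <= B ->
    `|phi B x - phi v x| <= T * v `^ (- b)) ->
  (forall x, 2 <= x -> x <= Ub -> `|phi B x| <= Z * x `^ (- b)) ->
  2 <= ub -> ub <= Ub -> ub <= u1 -> u1 <= B ->
  `|phi B ub - phi u1 ub +
    a * (\int[leb]_(x in `[2, ub]) phi B x) * (u1^-1 - B^-1)| <=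
  (4 * M + 3 / 16 * T + 1 / 4 * Z) * u1 `^ (- b).
Proof.
move=> a0 a4 s12 s34 M0 fc bE T0 Z0 hT hZ ub2 ubU uu1 u1B.
have b12 : 1 / 2 <= b by clear -bE s12; slra.
have b1 : b <= 1 by clear -bE s34; slra.
have ub0 : 0 < ub by clear -ub2; slra.
have u10 : 0 < u1 by clear -ub2 uu1; slra.
have u11 : 1 <= u1 by clear -ub2 uu1; slra.
have B0 : 0 < B by clear -u10 u1B; slra.
have ub12 : 1 / 2 <= ub by clear -ub2; slra.
have ub1 : 1 <= ub by clear -ub2; slra.
have lo : lowu ub <= u1 by rewrite lowu_id.
have hJ := inv_weight_axis_sq s12 s34 ub0 uu1 u1B.
rewrite -bE in hJ.
have J0 : 0 <= 2 * u1 `^ (- b) by rewrite mulr_ge0 ?powR_ge0.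
have hp u : u1 <= u -> u <= B -> _ := fun h1 h2 =>
  mid_potential a0 a4 s12 s34 M0 fc b12 b1 T0 Z0 hT hZ ub2 ubU uu1 h1 h2.
have := fc_step fc ub12 ubU lo u1B J0 hJ hp.
move/le_trans; apply.
have w1 : u1^-1 <= u1 `^ (- b).
  by rewrite -powR_inv1 ?(ltW u10)//; apply: ler_powR; rewrite ?lerN2.
have w2 : ub `^ (2 - b) / u1 ^+ 2 <= u1 `^ (- b).
  rewrite -powR_mulrn ?(ltW u10)//; apply: powR_exchange => //.
  by clear -b1; slra.
set w := u1 `^ (- b) in w1 w2 *; set y := ub `^ (2 - b) in w2 *.
have w0 : 0 <= w by exact: powR_ge0.
have y0 : 0 <= y by exact: powR_ge0.
have aT0 : 0 <= a * T * ub * w by rewrite !mulr_ge0// ltW.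
have aZ0 : 0 <= a * Z * y by rewrite !mulr_ge0.
have aTw : a * (T * w) <= 1 / 4 * (T * w) by rewrite ler_wpM2r// mulr_ge0.
have aZw : a * Z * w <= 1 / 4 * (Z * w) by rewrite -mulrA ler_wpM2r// mulr_ge0.
have ubu : ub / u1 <= 1 by rewrite ler_pdivrMr// mul1r.
have aTu : a * (T * w) * (ub / u1) <= a * (T * w).
  by rewrite -[leRHS]mulr1 ler_wpM2l// !mulr_ge0.
have d1 : (2 * M + a * T * ub * w / 2) * (u1^-1 - B^-1) <=
    2 * (M * w) + 1 / 2 * (a * (T * w)).
  apply: (@le_trans _ _ ((2 * M + a * T * ub * w / 2) * u1^-1)).
    rewrite ler_wpM2l ?gerBl ?invr_ge0 ?(ltW B0)//.
    by apply: addr_ge0; [exact: mulr_ge0|exact: divr_ge0].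
  have -> : (2 * M + a * T * ub * w / 2) * u1^-1 =
     2 * (M * u1^-1) + 1 / 2 * (a * (T * w) * (ub / u1)) by field; rewrite gt_eqF.
  have Mw : M * u1^-1 <= M * w by rewrite ler_wpM2l.
  by clear -Mw aTu; slra.
have d2 : (a * Z * y + a * T * ub * w * u1 / 4) * (u1 ^- 2 - B ^- 2) <=
    a * Z * w + 1 / 4 * (a * (T * w)).
  apply: (@le_trans _ _ ((a * Z * y + a * T * ub * w * u1 / 4) * u1 ^- 2)).
    rewrite ler_wpM2l ?gerBl ?invr_ge0 ?sqr_ge0// addr_ge0//.
    by rewrite divr_ge0// mulr_ge0// ltW.
  have -> : (a * Z * y + a * T * ub * w * u1 / 4) * u1 ^- 2 =
     a * Z * (y / u1 ^+ 2) + 1 / 4 * (a * (T * w) * (ub / u1)).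
    by field; rewrite gt_eqF.
  have Zw : a * Z * (y / u1 ^+ 2) <= a * Z * w by rewrite ler_wpM2l// mulr_ge0.
  by clear -Zw aTu; slra.
apply: (le_trans (lerD (lexx _) (lerD d1 d2))).
rewrite mulrCA !mulrDl -!mulrA.
by clear -aTw aZw; slra.
Qed.

(** As phi vanishes on the axis, the step from the axis to the abscissa B is a
linear equation for the primitive H of the profile phi B, with a source of size
r0.  The lower bound on B makes the term H / B contribute at most 1/100 to the
coefficient of Z. *)
Lemma mid_limit_step a s M Ub phi phiu (b T Z B : R) ub :
  0 <= a -> a <= 1 / 4 -> 1 / 2 <= s -> s < 3 / 4 -> 0 <= M ->
  flux_control a s M Ub phi phiu ->
  b = (4 * s - 1) / 2 -> 0 <= T -> 0 <= Z -> 100 * Ub ^+ 2 <= B ->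
  (forall x v, 2 <= x -> x <= Ub -> x <= v -> v <= B ->
    `|phi B x - phi v x| <= T * v `^ (- b)) ->
  (forall x, 2 <= x -> x <= Ub -> `|phi B x| <= Z * x `^ (- b)) ->
  2 <= ub -> ub <= Ub ->
  let r0 := 4 * M + 3 / 16 * T + 26 / 100 * Z in
  a * `|\int[leb]_(x in `[2, ub]) phi B x| <= r0 * ub `^ (1 - b) /\
  `|phi B ub| <= 2 * r0 * ub `^ (- b).
Proof.
move=> a0 a4 s12 s34 M0 fc bE T0 Z0 hB hT hZ ub2 ubU r0.
have cphi := fc_cont fc.
have b12 : 1 / 2 <= b by clear -bE s12; slra.
have b1 : b < 1 by clear -bE s34; slra.
have b0 : 0 < b by clear -b12; slra.
have r00 : 0 <= r0 by rewrite /r0; clear -M0 T0 Z0; slra.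
have Ub2 : 2 <= Ub by exact: le_trans ubU.
have UB : Ub <= B by clear -hB Ub2; nra.
have B0 : 0 < B by clear -UB Ub2; slra.
have cf := @continuous_slice _ _ B cphi.
have ode x : 2 <= x -> x <= Ub ->
    `|phi B x + a / x * (\int[leb]_(y in `[2, x]) phi B y)| <= r0 * x `^ (- b).
  move=> x2 xU.
  have x0 : 0 < x by clear -x2; slra.
  have x1 : 1 <= x by clear -x2; slra.
  have xB := le_trans xU UB.
  have h := mid_step a0 a4 s12 (ltW s34) M0 fc bE T0 Z0 hT hZ x2 xU (lexx x) xB.
  rewrite (fc_axis fc x1 xU) subr0 in h.
  have hH : `|\int[leb]_(y in `[2, x]) phi B y| <= Z * (x - 2).
    apply: Rintegral_cst_bound => // y y2 yx.
    apply: (le_trans (hZ y y2 (le_trans yx xU))).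
    rewrite -[leRHS]mulr1 ler_wpM2l// powRN invf_le1 ?powR_gt0//; last first.
      by clear -y2; slra.
    rewrite -[leLHS](powRr0 y); apply: ler_powR; last exact: ltW.
    by clear -y2; slra.
  have xb : x^-1 <= x `^ (- b).
    by rewrite -powR_inv1 ?(ltW x0)//; apply: ler_powR; rewrite ?lerN2// ltW.
  set H := \int[leb]_(y in _) _ in h hH *; set w := x `^ (- b) in h xb *.
  have -> : phi B x + a / x * H = phi B x + a * H * (x^-1 - B^-1) + a * H / B.
    by field; rewrite !gt_eqF.
  apply: (le_trans (ler_normD _ _)).
  have t1 : `|a * H / B| <= 1 / 100 * (Z * w).
    rewrite !normrM normfV (gtr0_norm B0) (ger0_norm a0).
    have aH : a * `|H| <= 1 / 4 * (Z * x).
      apply: ler_pM => //; apply: (le_trans hH); rewrite ler_wpM2l//.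
      by clear; slra.
    apply: (@le_trans _ _ (1 / 4 * (Z * x) / (100 * x ^+ 2))).
      apply: ler_pM => //; first by rewrite mulr_ge0.
        by rewrite invr_ge0 ltW.
      rewrite lef_pV2 ?posrE//; last by rewrite mulr_gt0 ?exprn_gt0.
      apply: le_trans hB; rewrite ler_pM2l// lerXn2r ?nnegrE ?(ltW x0)//.
      by clear -Ub2; slra.
    have -> : 1 / 4 * (Z * x) / (100 * x ^+ 2) = 1 / 400 * (Z * x^-1).
      by field; rewrite gt_eqF.
    have Zw : Z * x^-1 <= Z * w by rewrite ler_wpM2l.
    have Zx : 0 <= Z * x^-1 by rewrite mulr_ge0// invr_ge0 ltW.
    by clear -Zw Zx; slra.
  apply: (le_trans (lerD h t1)); rewrite /r0 !mulrDl -!mulrA.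
  by clear; slra.
have ub0 : 0 < ub by clear -ub2; slra.
have hH := linear_ode_bound a0 b0 b1 Ub2 r00 cf ode ub2 ubU.
have hphi := ode ub ub2 ubU.
have p1 : ub `^ (1 - b) = ub * ub `^ (- b) by rewrite powR_add// powRr1// ltW.
rewrite p1 in hH *.
have w0 : 0 <= ub `^ (- b) by exact: powR_ge0.
set H := \int[leb]_(y in _) _ in hH hphi *; set w := ub `^ (- b) in hH hphi w0 *.
have aH : a * `|H| <= r0 * (ub * w).
  have d0 : 0 < a + 1 - b by clear -a0 b1; slra.
  apply: (@le_trans _ _ (a * (r0 / (a + 1 - b) * (ub * w)))).
    by rewrite ler_wpM2l.
  have -> : a * (r0 / (a + 1 - b) * (ub * w)) = a / (a + 1 - b) * (r0 * (ub * w)).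
    by field; rewrite gt_eqF.
  rewrite -[leRHS]mul1r ler_wpM2r//; first by rewrite !mulr_ge0// ltW.
  by rewrite ler_pdivrMr//; clear -a0 b1; slra.
split => //.
have -> : phi B ub = (phi B ub + a / ub * H) - a / ub * H by rewrite addrK.
apply: (le_trans (ler_normB _ _)).
have -> : 2 * r0 * w = r0 * w + r0 * w by ring.
apply: lerD => //.
rewrite !normrM normfV (gtr0_norm ub0) (ger0_norm a0) mulrAC ler_pdivrMr//.
by rewrite mulrAC -mulrA.
Qed.

(** Bootstrap on the profile at B, given the rate T at which phi approaches it. *)
Lemma mid_limit a s M Ub phi phiu (b T B : R) x :
  0 <= a -> a <= 1 / 4 -> 1 / 2 <= s -> s < 3 / 4 -> 0 <= M ->
  flux_control a s M Ub phi phiu ->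
  b = (4 * s - 1) / 2 -> 0 <= T -> 100 * Ub ^+ 2 <= B ->
  (forall x v, 2 <= x -> x <= Ub -> x <= v -> v <= B ->
    `|phi B x - phi v x| <= T * v `^ (- b)) ->
  2 <= x -> x <= Ub ->
  `|phi B x| <= (8 * M + 3 / 8 * T) / (48 / 100) * x `^ (- b).
Proof.
move=> a0 a4 s12 s34 M0 fc bE T0 hB hT x2 xU.
have cphi := fc_cont fc.
have b0 : 0 <= b by clear -bE s12; slra.
have B0 : 0 <= B by apply: le_trans hB; rewrite mulr_ge0 ?sqr_ge0.
have [K hK] := bounded_on_strip Ub B cphi.
pose D := [set y : R | 2 <= y /\ y <= Ub].
pose X (y : R) : R := `|phi B y| * y `^ b.
have Xle : X x <= (8 * M + 3 / 8 * T) / (1 - 52 / 100).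
  apply: (@contraction_bound _ _ D X) => //; first by clear; slra.
  - exists (K * Ub `^ b) => y [y2 yU]; rewrite /X.
    apply: ler_pM; rewrite ?powR_ge0//.
      by apply: hK => //; clear -y2; slra.
    by apply: le_powR_pos => //; clear -y2; slra.
  - move=> P P0 XP y [y2 yU].
    have hP z : 2 <= z -> z <= Ub -> `|phi B z| <= P * z `^ (- b).
      move=> z2 zU; have z0 : 0 < z by clear -z2; slra.
      by rewrite powRN ler_pdivlMr ?powR_gt0//; apply: (XP z).
    have [_ h] := mid_limit_step a0 a4 s12 s34 M0 fc bE T0 P0 hB hT hP y2 yU.
    have y0 : 0 < y by clear -y2; slra.
    move: h; rewrite powRN ler_pdivlMr ?powR_gt0// => /le_trans; apply.
    by clear; slra.
  - by move=> t _; rewrite mulr_ge0 ?powR_ge0.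
have x0 : 0 < x by clear -x2; slra.
rewrite powRN ler_pdivlMr ?powR_gt0//; apply: (le_trans Xle).
by have -> : 1 - 52 / 100 = 48 / 100 :> R by field.
Qed.

(** Bootstrap on the rate of approach itself, the profile being controlled by the
previous lemma; the constants 3/16 and 3/8 leave the factor 78/100 < 1. *)
Lemma mid_rate a s M Ub phi phiu (b B : R) x v :
  0 <= a -> a <= 1 / 4 -> 1 / 2 <= s -> s < 3 / 4 -> 0 <= M ->
  flux_control a s M Ub phi phiu ->
  b = (4 * s - 1) / 2 -> 100 * Ub ^+ 2 <= B ->
  2 <= x -> x <= Ub -> x <= v -> v <= B ->
  `|phi B x - phi v x| <= 80 * M * v `^ (- b).
Proof.
move=> a0 a4 s12 s34 M0 fc bE hB x2 xU xv vB.
have cphi := fc_cont fc.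
have b0 : 0 <= b by clear -bE s12; slra.
have b1 : b <= 1 by clear -bE s34; slra.
have B0 : 0 <= B by apply: le_trans hB; rewrite mulr_ge0 ?sqr_ge0.
have [K hK] := bounded_on_strip Ub B cphi.
pose D := [set t : R * R | [/\ 2 <= t.1, t.1 <= Ub, t.1 <= t.2 & t.2 <= B]].
pose X (t : R * R) : R := `|phi B t.1 - phi t.2 t.1| * t.2 `^ b.
have Xle : X (x, v) <= (17 * M) / (1 - 78 / 100).
  apply: (@contraction_bound _ _ D X) => //; first by clear; slra.
  - exists ((K + K) * B `^ b) => -[y w] [/= y2 yU yw wB]; rewrite /X/=.
    apply: ler_pM; rewrite ?powR_ge0//.
      apply: (le_trans (ler_normB _ _)); apply: lerD; apply: hK => //.
      + by clear -y2; slra.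
      + by clear -y2; slra.
      + by clear -y2 yw; slra.
    by apply: le_powR_pos => //; clear -y2 yw; slra.
  - move=> P P0 XP [y w] [/= y2 yU yw wB].
    have y0 : 0 < y by clear -y2; slra.
    have w0 : 0 < w by clear -y0 yw; slra.
    have hP z q : 2 <= z -> z <= Ub -> z <= q -> q <= B ->
        `|phi B z - phi q z| <= P * q `^ (- b).
      move=> z2 zU zq qB; have q0 : 0 < q by clear -z2 zq; slra.
      by rewrite powRN ler_pdivlMr ?powR_gt0//; apply: (XP (z, q)).
    have hZ z : 2 <= z -> z <= Ub -> _ := fun h1 h2 =>
      mid_limit a0 a4 s12 s34 M0 fc bE P0 hB hP h1 h2.
    have ZE : 48 / 100 * ((8 * M + 3 / 8 * P) / (48 / 100)) = 8 * M + 3 / 8 * P.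
      by rewrite mulrC divfK// gt_eqF//; clear; slra.
    set Z := _ / (48 / 100) in hZ ZE.
    have Z0 : 0 <= Z by clear -ZE M0 P0; slra.
    have [h1 _] := mid_limit_step a0 a4 s12 s34 M0 fc bE P0 Z0 hB hP hZ y2 yU.
    have h2 := mid_step a0 a4 s12 (ltW s34) M0 fc bE P0 Z0 hP hZ y2 yU yw wB.
    set H := \int[leb]_(q in _) _ in h1 h2.
    set r0 := 4 * M + 3 / 16 * P + 26 / 100 * Z in h1.
    have r00 : 0 <= r0 by rewrite /r0; clear -M0 P0 Z0; slra.
    have h3 : `|a * H * (w^-1 - B^-1)| <= r0 * w `^ (- b).
      have wB0 : 0 <= w^-1 - B^-1.
        by rewrite subr_ge0 lef_pV2 ?posrE//; clear -w0 wB; slra.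
      rewrite !normrM (ger0_norm a0) (ger0_norm wB0).
      apply: (@le_trans _ _ (r0 * y `^ (1 - b) * w^-1)).
        apply: ler_pM => //; first by rewrite mulr_ge0.
        by rewrite gerBl invr_ge0.
      rewrite -mulrA ler_wpM2l//.
      by rewrite -[X in _ / X](powRr1 (ltW w0)); apply: powR_exchange.
    rewrite /X/= -ler_pdivlMr ?powR_gt0// -powRN.
    set h := a * H * _ in h2 h3.
    have -> : phi B y - phi w y = (phi B y - phi w y + h) - h by rewrite addrK.
    apply: (le_trans (ler_normB _ _)); apply: (le_trans (lerD h2 h3)).
    rewrite -mulrDl ler_wpM2r ?powR_ge0// /r0.
    by clear -ZE M0 P0; slra.
  - by move=> t _; rewrite mulr_ge0 ?powR_ge0.
have v0 : 0 < v by clear -x2 xv; slra.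
rewrite powRN ler_pdivlMr ?powR_gt0//; apply: (le_trans Xle).
by rewrite ler_pdivrMr; clear -M0; slra.
Qed.

(** Letting the comparison abscissa B be at least u removes the profile. *)
Lemma mid_pointwise a s M Ub phi phiu (b : R) u x :
  0 <= a -> a <= 1 / 4 -> 1 / 2 <= s -> s < 3 / 4 -> 0 <= M ->
  flux_control a s M Ub phi phiu -> b = (4 * s - 1) / 2 ->
  1 / 2 <= x -> x <= Ub -> lowu x <= u ->
  `|phi u x| <= 160 * M * x `^ (- b).
Proof.
move=> a0 a4 s12 s34 M0 fc bE x12 xU xu.
have b0 : 0 <= b by clear -bE s12; slra.
have b1 : b <= 1 by clear -bE s34; slra.
have x0 : 0 < x by clear -x12; slra.
have [x2|x2] := leP x 2.
  apply: (le_trans (mid_strip a0 a4 s12 (ltW s34) M0 fc x12 xU x2 xu)).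
  rewrite powRN ler_pdivlMr ?powR_gt0//.
  have : x `^ b <= 2.
    apply: (@le_trans _ _ (2 `^ b)); first by apply: le_powR_pos => //; exact: ltW.
    by rewrite -[leRHS]powRr1//; apply: ler_powR => //; rewrite ler1n.
  have M50 : 0 <= 5 * M by clear -M0; slra.
  move=> h; apply: (@le_trans _ _ (5 * M * 2)); first by rewrite ler_wpM2l.
  by clear -M0; slra.
have x1 : 1 <= x by clear -x2; slra.
rewrite lowu_id// in xu.
pose B : R := Num.max u (100 * Ub ^+ 2).
have uB : u <= B by rewrite /B le_max lexx.
have hB : 100 * Ub ^+ 2 <= B by rewrite /B le_max lexx orbT.
have hT y v : 2 <= y -> y <= Ub -> y <= v -> v <= B -> _ := fun h1 h2 h3 h4 =>
  mid_rate a0 a4 s12 s34 M0 fc bE hB h1 h2 h3 h4.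
have M80 : 0 <= 80 * M by clear -M0; slra.
have h1 := mid_limit a0 a4 s12 s34 M0 fc bE M80 hB hT (ltW x2) xU.
have h2 := hT x u (ltW x2) xU xu uB.
have -> : phi u x = phi B x - (phi B x - phi u x) by rewrite subKr.
apply: (le_trans (ler_normB _ _)).
have h3 : 80 * M * u `^ (- b) <= 80 * M * x `^ (- b).
  by rewrite ler_wpM2l//; apply: le_powR_neg; rewrite ?oppr_le0.
have -> : 160 * M * x `^ (- b) = 80 * M * x `^ (- b) + 80 * M * x `^ (- b) by ring.
apply: lerD; last exact: le_trans h3.
apply: (le_trans h1); rewrite ler_wpM2r ?powR_ge0//.
by rewrite ler_pdivrMr; clear -M0; slra.
Qed.

(** The rate b = (4 s - 1) / 2 is less than 1, so it is integrable in ub and the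
potential is O (ub^(1 - b) / u^2); the loss 1 / (3 - 4 s) comes from 1 - b and
from the tail of u^(4 s - 4). *)
Lemma mid_regime a s M Ub phi phiu ub :
  0 <= a -> a <= 1 / 4 -> 1 / 2 <= s -> s < 3 / 4 -> 0 <= M ->
  flux_control a s M Ub phi phiu -> 1 / 2 <= ub -> ub <= Ub ->
  (weighted_sq s phiu ub <= ((2 + 2 * 80 ^+ 2 / (3 - 4 * s) ^+ 3) * M ^+ 2)%:E)%E.
Proof.
move=> a0 a4 s12 s34 M0 fc ub12 ubU.
have cphi := fc_cont fc.
have [l1 l2 l3] := lowuP ub.
have ub0 : 0 < ub by clear -ub12; slra.
have d0 : 0 < 3 - 4 * s by clear -s34; slra.
have [b bE] : exists b : R, b = (4 * s - 1) / 2 by exists ((4 * s - 1) / 2).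
have bd : 1 - b = (3 - 4 * s) / 2 by rewrite bE; field.
have y20 : (ub `^ (1 - b)) ^+ 2 = ub `^ (3 - 4 * s).
  by rewrite powR_sq bd; congr (_ `^ _); field.
pose k : R := (80 * M / (3 - 4 * s)) ^+ 2 * ub `^ (3 - 4 * s).
have k0 : 0 <= k by rewrite mulr_ge0 ?sqr_ge0 ?powR_ge0.
have r1 : 4 * s - 4 < -1 by clear -s34; slra.
apply: (le_trans (fc_norm fc ub12 ubU k0 r1 _)).
  move=> u uu; have u0 : 0 < u by clear -uu l1; slra.
  have rb : -1 < - b by clear -bE s34; slra.
  have M160 : 0 <= 160 * M by clear -M0; slra.
  have := potential_term_le a0 cphi ub12 uu rb M160.
  have hmid x : 1 / 2 <= x -> x <= ub -> lowu x <= u -> `|phi u x| <= 160 * M * x `^ (- b).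
    by move=> x1 x2 x3; apply: (mid_pointwise a0 a4 s12 s34 M0 fc bE) => //; exact: le_trans ubU.
  move=> /(_ hmid).
  have -> : - b + 1 = 1 - b by ring.
  set y := ub `^ (1 - b) in y20 *; set y' := _ `^ (1 - b) => hpot.
  have y0 : 0 <= y by exact: powR_ge0.
  have y'0 : 0 <= y' by exact: powR_ge0.
  have yM : 0 <= M * y by rewrite mulr_ge0.
  have hpot2 : `|potential_term a phi u ub| <= 80 * M / (3 - 4 * s) * y / u ^+ 2.
    apply: (le_trans hpot); rewrite mulrA ler_wpM2r ?invr_ge0 ?sqr_ge0// bd.
    have -> : 80 * M / (3 - 4 * s) * y = 1 / 4 * (160 * M * (y / ((3 - 4 * s) / 2))).
      by field; rewrite gt_eqF.
    have -> : a * (160 * M * ((y - y') / ((3 - 4 * s) / 2))) =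
        a * (160 * M * (y / ((3 - 4 * s) / 2))) - a * (160 * M * (y' / ((3 - 4 * s) / 2))).
      by field; rewrite gt_eqF.
    rewrite lerBlDr; apply: ler_wpDr.
      by rewrite !mulr_ge0// invr_ge0 divr_ge0// ltW.
    by rewrite ler_wpM2r// !mulr_ge0// invr_ge0 divr_ge0// ltW.
  have : potential_term a phi u ub ^+ 2 <= (80 * M / (3 - 4 * s) * y / u ^+ 2) ^+ 2.
    by rewrite -real_normK ?num_real// lerXn2r ?nnegrE// (le_trans _ hpot2).
  have s0 : 0 <= s by clear -s12; slra.
  have uub : ub <= u by exact: le_trans uu.
  move=> /(ler_pM (weight_ge0 s u ub) (sqr_ge0 _) (weight_le s0 (ltW ub0) uub u0)).
  move/le_trans; apply.
  have -> : u `^ (4 * s) * (80 * M / (3 - 4 * s) * y / u ^+ 2) ^+ 2 =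
      k * (u `^ (4 * s) / u ^+ 4).
    by rewrite /k -y20; field; rewrite !gt_eqF.
  rewrite ler_wpM2l// -(powR_invn _ (ltW u0)) -powR_add//.
have -> : 4 * s - 4 + 1 = - (3 - 4 * s) by ring.
rewrite (opprK (3 - 4 * s)) lee_fin [leRHS]mulrDl lerD2l.
have q : ub `^ (3 - 4 * s) * lowu ub `^ (- (3 - 4 * s)) <= 1.
  rewrite powRN ler_pdivrMr ?powR_gt0 ?mul1r//; last by clear -l1; slra.
  by apply: le_powR_pos => //; exact: ltW.
have -> : 2 * (k * (lowu ub `^ (- (3 - 4 * s)) / (3 - 4 * s))) =
    2 * 80 ^+ 2 / (3 - 4 * s) ^+ 3 * M ^+ 2 * (ub `^ (3 - 4 * s) * lowu ub `^ (- (3 - 4 * s))).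
  by rewrite /k; field; rewrite gt_eqF.
rewrite -[leRHS]mulr1; apply: ler_wpM2l => //.
rewrite mulr_ge0 ?sqr_ge0// divr_ge0 ?exprn_ge0 ?(ltW d0)//.
Qed.

End mid_regime.

(** * Integration in polar coordinates *)

Section radial_integral.
Context (R : realType).
Local Notation leb := (@lebesgue_measure R).

(** The library pushforward with its measure structure, which the measurability
proof carries. *)
Definition image_measure d1 d2 (T1 : measurableType d1) (T2 : measurableType d2)
    (m : {measure set T1 -> \bar R}) (f : T1 -> T2) (mf : measurable_fun setT f) :
  {measure set T2 -> \bar R} :=
  measure_function_pushforward__canonical__measure_function_Measure m mf.

(** Affine change of variables, by uniqueness of Lebesgue measure. *)
Lemma ge0_integral_affine (al be : R) (f : R -> \bar R) : be != 0 ->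
  measurable_fun setT f -> (forall x, 0 <= f x)%E ->
  (\int[leb]_x f (al + be * x)%R = (`|be|^-1)%:E * \int[leb]_x f x)%E.
Proof.
move=> be0 mf f0.
have b0 : 0 < `|be| by rewrite normr_gt0.
have mt : measurable_fun setT (fun x : measurableTypeR R => al + be * x : measurableTypeR R).
  by apply: measurable_funD => //; exact: measurable_funM.
pose nu : {measure set (measurableTypeR R) -> \bar R} :=
  mscale (NngNum (ltW b0)) (image_measure leb mt).
have nuE (A : set (measurableTypeR R)) : measurable A -> leb A = nu A.
  apply: lebesgue_measure_unique => X [[a b] _ <-] /=.
  rewrite /mscale/= /pushforward.
  have [bp|bn] := ltP 0 be.
    have -> : (fun x : R => al + be * x) @^-1` `]a, b] = `]((a - al) / be), ((b - al) / be)]%classic.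
      apply/seteqP; split => x /=; rewrite !in_itv/= ltr_pdivrMr// ler_pdivlMr// (mulrC be);
      by rewrite ltrBlDl lerBrDl.
    rewrite !lebesgue_measure_itv/= !lte_fin ltr_pM2r ?invr_gt0// ltrD2r gtr0_norm//.
    by case: ifPn => _; rewrite ?mule0// -!EFinB -EFinM; congr EFin; field; rewrite gt_eqF.
  have bn' : be < 0 by rewrite lt_neqAle be0.
  have -> : (fun x : R => al + be * x) @^-1` `]a, b] = `[((b - al) / be), ((a - al) / be)[%classic.
    apply/seteqP; split => x /=; rewrite !in_itv/= ltr_ndivlMr// ler_ndivrMr// (mulrC be);
    by rewrite ltrBlDl lerBrDl andbC.
  rewrite !lebesgue_measure_itv/= !lte_fin ltr_nM2r ?invr_lt0// ltrD2r ltr0_norm//.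
  by case: ifPn => _; rewrite ?mule0// -!EFinB -EFinM; congr EFin; field; rewrite lt_eqF.
have -> : (\int[leb]_x f x = \int[nu]_x f x)%E.
  by apply: eq_measure_integral => A mA _; exact: nuE.
rewrite ge0_integral_mscale//= ge0_integral_pushforward// preimage_setT.
by rewrite muleA -EFinM mulVf ?mul1e// gt_eqF.
Qed.

(** [sigma] multiplies integrals by the constant k. *)
Definition dilation_law d (T : measurableType d) (m : set T -> \bar R)
    (sigma : T -> T) (k : R) : Prop :=
  measurable_fun setT sigma /\
  forall f : T -> \bar R, measurable_fun setT f -> (forall x, 0 <= f x)%E ->
    (\int[m]_x f (sigma x) = k%:E * \int[m]_x f x)%E.

Lemma dilation_line (t : R) : 0 < t -> dilation_law leb (fun x : R => t * x) t^-1.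
Proof.
move=> t0; split=> [|f mf f0]; first exact: measurable_funM.
have t0' : t != 0 by rewrite gt_eqF.
have := ge0_integral_affine 0 t0' mf f0; rewrite (gtr0_norm t0) => <-.
by apply: eq_integral => x _; rewrite add0r.
Qed.

Lemma dilation_prod d1 d2 (T1 : measurableType d1) (T2 : measurableType d2)
  (m1 : {sigma_finite_measure set T1 -> \bar R})
  (m2 : {sigma_finite_measure set T2 -> \bar R}) s1 s2 (k1 k2 : R) : 0 <= k1 -> 0 <= k2 ->
  dilation_law m1 s1 k1 -> dilation_law m2 s2 k2 ->
  dilation_law (m1 \x m2)%E (fun p => (s1 p.1, s2 p.2)) (k1 * k2).
Proof.
move=> k10 k20 [ms1 h1] [ms2 h2].
have ms : measurable_fun [set: T1 * T2] (fun p => (s1 p.1, s2 p.2)).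
  apply: measurable_fun_pair; first exact: (measurableT_comp ms1).
  exact: (measurableT_comp ms2).
split=> // f mf f0.
have mfs : measurable_fun setT (fun p : T1 * T2 => f (s1 p.1, s2 p.2)).
  exact: (measurableT_comp mf).
rewrite !fubini_tonelli1//= /fubini_F/=.
have mF := @measurable_fun_fubini_tonelli_F _ _ _ _ _ m2 _ mf f0.
rewrite /fubini_F in mF.
have F0 x : (0 <= \int[m2]_y f (x, y))%E by exact: integral_ge0.
transitivity (\int[m1]_x (k2%:E * \int[m2]_y f (s1 x, y)))%E.
  apply: eq_integral => x _; rewrite (h2 (fun y => f (s1 x, y)))//.
  by apply: (measurableT_comp mf); exact: measurable_pair1.
rewrite ge0_integralZl//.
- by rewrite (h1 (fun x => \int[m2]_y f (x, y))%E)// muleA -EFinM mulrC.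
- exact: (measurableT_comp mF).
Qed.

Lemma sigma_finite_leb2 : sigma_finite setT (@leb2 R).
Proof.
have /sigma_finiteP[F [TF ndF Foo]] := sigma_finiteT leb.
exists (fun k => F k `*` F k).
  rewrite -setXTT TF predeqE => -[x y]; split.
    move=> [/= [n _ Fnx] [k _ Gky]]; exists (maxn n k) => //; split.
    - by move: x Fnx; exact/subsetPset/ndF/leq_maxl.
    - by move: y Gky; exact/subsetPset/ndF/leq_maxr.
  by move=> [n _ []/= ? ?]; split; exists n.
move=> k; have [mF Fk] := Foo k.
split; first exact: measurableX.
suff -> : @leb2 R (F k `*` F k) = (leb (F k) * leb (F k))%E; last exact: product_measure1E.
by rewrite lte_mul_pinfty// ge0_fin_numE.
Qed.

HB.instance Definition _ := Measure.on (@leb2 R).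
HB.instance Definition _ :=
  Measure_isSigmaFinite.Build _ _ _ (@leb2 R) sigma_finite_leb2.

HB.instance Definition _ := Measure.on (@leb3 R).

Lemma dilation_space (t : R) : 0 < t ->
  dilation_law (@leb3 R) (fun p => ((t * p.1.1, t * p.1.2), t * p.2)) (t^-1 * t^-1 * t^-1).
Proof.
move=> t0.
have t0' : 0 <= t^-1 by rewrite invr_ge0 ltW.
have h2 : dilation_law (@leb2 R) (fun p => (t * p.1, t * p.2)) (t^-1 * t^-1).
  exact: (dilation_prod t0' t0' (dilation_line t0) (dilation_line t0)).
have h3 := dilation_prod (mulr_ge0 t0' t0') t0' h2 (dilation_line t0).
exact: h3.
Qed.

Lemma measurable_enorm3 : measurable_fun setT (@enorm3 R).
Proof.
rewrite /enorm3; apply: (@measurableT_comp _ _ _ _ _ _ (@Num.sqrt R)).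
  by apply: continuous_measurable_fun; exact: sqrt_continuous.
have m1 : measurable_fun [set: R * R * R] (fun x => x.1) by exact: measurable_fst.
have m2 : measurable_fun [set: R * R * R] (fun x => x.2) by exact: measurable_snd.
apply: measurable_funD; last exact: measurable_funX.
apply: measurable_funD; apply: measurable_funX.
  exact: (measurableT_comp measurable_fst m1).
exact: (measurableT_comp measurable_snd m1).
Qed.

Definition ball_volume (t : R) : \bar R := @leb3 R [set x | enorm3 x <= t].

Lemma measurable_ball3 (t : R) : measurable [set x : R * R * R | enorm3 x <= t].
Proof.
have -> : [set x : R * R * R | enorm3 x <= t] = setT `&` (@enorm3 R) @^-1` `]-oo, t].
  by rewrite setTI; apply/seteqP; split => x /=; rewrite in_itv.
by apply: measurable_enorm3.
Qed.

Lemma enorm3_scale (t : R) (x : R * R * R) : 0 <= t ->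
  enorm3 ((t * x.1.1, t * x.1.2), t * x.2) = t * enorm3 x.
Proof.
move=> t0; rewrite /enorm3/= !exprMn -!mulrDr sqrtrM ?sqr_ge0//.
by rewrite sqrtr_sqr ger0_norm.
Qed.

Lemma ball_volume_scale (t : R) : 0 < t -> ball_volume t = ((t ^+ 3)%:E * ball_volume 1)%E.
Proof.
move=> t0.
have [_ h] := dilation_space t0.
have volE (r : R) : ball_volume r = (\int[@leb3 R]_x (\1_[set x : R * R * R | enorm3 x <= r] x)%:E)%E.
  by rewrite integral_indic// ?setIT//; exact: measurable_ball3.
rewrite !volE.
have := h (fun x => (\1_[set x : R * R * R | enorm3 x <= t] x)%:E).
have -> : (fun x : R * R * R => (\1_[set x | enorm3 x <= t] ((t * x.1.1, t * x.1.2), t * x.2))%:E : \bar R) =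
    (fun x => (\1_[set x : R * R * R | enorm3 x <= 1] x)%:E).
  apply/funext => x; rewrite !indicE; congr (((nat_of_bool _)%:R)%:E).
  apply/idP/idP; rewrite !inE/= enorm3_scale ?(ltW t0)//.
    by rewrite -ler_pdivlMl// mulVf ?gt_eqF.
  by move=> hx; rewrite -[leRHS]mulr1 ler_pM2l.
move=> ->.
- rewrite muleA -EFinM (_ : t ^+ 3 * _ = 1) ?mul1e//; field; by rewrite gt_eqF.
- apply/measurable_EFinP; apply: measurable_indic; exact: measurable_ball3.
- by move=> x; rewrite lee_fin.
Qed.

Lemma box_volume (a b : R) : a <= b ->
  @leb3 R ((`[a, b] `*` `[a, b]) `*` `[a, b]) = ((b - a) ^+ 3)%:E.
Proof.
move=> ab; have mI : measurable (`[a, b]%classic : set R) by [].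
transitivity (@leb2 R (`[a, b] `*` `[a, b]) * leb `[a, b])%E.
  exact: (product_measure1E (@leb2 R) leb (measurableX mI mI) mI).
transitivity (leb `[a, b] * leb `[a, b] * leb `[a, b])%E.
  by congr (_ * _)%E; exact: product_measure1E.
rewrite lebesgue_measure_itv/= lte_fin.
have [ab'|ba] := ltP a b; first by rewrite -EFinB -!EFinM -!expr2 -exprSr.
by have -> : a = b; [apply/eqP; rewrite eq_le ab|rewrite !mul0e subrr expr0n].
Qed.

Lemma ball_volume_gt0 : (0 < ball_volume 1)%E.
Proof.
apply: (@lt_le_trans _ _ (((1 / 2 - 0) ^+ 3)%:E)).
  by rewrite lte_fin subr0 exprn_gt0.
rewrite -box_volume; last by rewrite divr_ge0.
apply: le_measure; rewrite ?inE.
- by apply: measurableX => //; apply: measurableX.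
- exact: measurable_ball3.
- move=> [[x y] z] /= [[]]; rewrite !in_itv/= => /andP[x0 x1] /andP[y0 y1] /andP[z0 z1].
  rewrite /enorm3/= -[leRHS](@sqrtr1 R) ler_wsqrtr//.
  have : x ^+ 2 <= (1 / 2) ^+ 2 by rewrite lerXn2r ?nnegrE//; slra.
  have : y ^+ 2 <= (1 / 2) ^+ 2 by rewrite lerXn2r ?nnegrE//; slra.
  have : z ^+ 2 <= (1 / 2) ^+ 2 by rewrite lerXn2r ?nnegrE//; slra.
  slra.
Qed.

Lemma ball_volume_fin_num : ball_volume 1 \is a fin_num.
Proof.
rewrite ge0_fin_numE; last exact: measure_ge0.
apply: (@le_lt_trans _ _ (((1 - (-1)) ^+ 3)%:E)); last exact: ltry.
rewrite -box_volume; last slra.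
apply: le_measure; rewrite ?inE.
- exact: measurable_ball3.
- by apply: measurableX => //; apply: measurableX.
- have key (x a : R) : 0 <= a -> x ^+ 2 + a <= 1 -> -1 <= x <= 1.
    by move=> a0 h; rewrite -ler_norml -(@expr_le1 _ 2)// real_normK ?num_real//; slra.
  move=> [[x y] z] /=; rewrite /enorm3/= -{1}(@sqrtr1 R) ler_sqrt// => h.
  have hx := sqr_ge0 x; have hy := sqr_ge0 y; have hz := sqr_ge0 z.
  rewrite !in_itv/=; split; first split.
  + by apply: (key _ (y ^+ 2 + z ^+ 2)); slra.
  + by apply: (key _ (x ^+ 2 + z ^+ 2)); slra.
  + by apply: (key _ (x ^+ 2 + y ^+ 2)); slra.
Qed.

(** The density measure is realised as the image under the first projection of
planar measure on the region under the graph of h, and it is determined by its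
values on intervals. *)
Lemma ge0_integral_density (nu : {measure set (measurableTypeR R) -> \bar R})
    (h : measurableTypeR R -> R) (F : measurableTypeR R -> \bar R) :
  measurable_fun setT h -> (forall x, 0 <= h x) ->
  (forall a b : R, (nu `]a, b]%classic < +oo)%E) ->
  (forall a b : R, nu `]a, b]%classic = \int[leb]_(x in `]a, b]) (h x)%:E)%E ->
  measurable_fun setT F -> (forall x, 0 <= F x)%E ->
  (\int[nu]_x F x = \int[leb]_x (F x * (h x)%:E))%E.
Proof.
move=> mh h0 nufin nuE mF F0.
pose T := measurableTypeR R.
pose E : set (T * T) := [set p | 0 <= p.2 /\ p.2 <= h p.1].
have m1 : measurable_fun [set: T * T] (fun x => x.1) by exact: measurable_fst.
have m2 : measurable_fun [set: T * T] (fun x => x.2) by exact: measurable_snd.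
have mE : measurable E.
  have -> : E = ([set: T * T] `&` [set p | 0 <= p.2]) `&` ([set: T * T] `&` [set p | p.2 <= h p.1]).
    by rewrite !setTI.
  apply: measurableI; apply: measurable_fun_le => //.
  exact: (measurableT_comp mh m1).
pose lam := image_measure (mrestr (@leb2 R) mE) m1.
have lamE (f : T -> \bar R) : measurable_fun setT f -> (forall x, 0 <= f x)%E ->
    (\int[lam]_x f x = \int[leb]_x (f x * (h x)%:E))%E.
  move=> mf f0.
  have mf1 : measurable_fun [set: T * T] (fun p => f p.1) by exact: (measurableT_comp mf m1).
  have f1 p : (0 <= f p.1)%E by [].
  rewrite ge0_integral_pushforward// preimage_setT/=.
  have mnE : measurable (~` E) by exact: measurableC.
  rewrite (@ge0_negligible_integral _ _ _ (mrestr (@leb2 R) mE) setT (~` E))//; last first.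
    by rewrite /= /mrestr setICl measure0.
  rewrite setTD setCK (eq_measure_integral (@leb2 R)); last first.
    by move=> A mA AE; rewrite /= /mrestr (setIidl AE).
  rewrite integral_mkcond epatch_indic fubini_tonelli1//=; last 2 first.
  - apply: emeasurable_funM => //; apply/measurable_EFinP.
    exact: measurable_indic.
  - by move=> p; rewrite mule_ge0// lee_fin.
  apply: eq_integral => x _; rewrite /fubini_F/=.
  rewrite ge0_integralZl//; last first.
    apply/measurable_EFinP; apply: (measurableT_comp (measurable_indic mE)).
    exact: measurable_pair1.
  congr (_ * _)%E.
  transitivity (\int[leb]_y (\1_(`[0, h x]%classic : set T) y)%:E)%E.
    apply: eq_integral => y _; rewrite !indicE; congr (((nat_of_bool _)%:R)%:E).
    apply/idP/idP; rewrite !inE/= in_itv/=; first by move=> [-> ->].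
    by move=> /andP[].
  transitivity (leb `[0, h x]%classic); first by rewrite integral_indic// setIT.
  rewrite lebesgue_measure_itv/= lte_fin oppr0 adde0.
  case: ltP => // hx.
  by have -> : h x = 0 by apply/eqP; rewrite eq_le hx h0.
have -> : (\int[nu]_x F x = \int[lam]_x F x)%E.
  apply: eq_measure_integral => A mA _.
  pose I (k : nat) : set T := `](- k%:R : R), (k%:R : R)]%classic.
  apply: (@measure_unique _ _ T (@ocitv R) I _ _ _ _ nu lam) => //.
  - exact: ocitvI.
  - by move=> k; exists (- k%:R, k%:R).
  - apply/seteqP; split => // x _.
    exists (Num.bound `|x|); rewrite // /I/= in_itv/=.
    have : `|x| < (Num.bound `|x|)%:R := archi_boundP (normr_ge0 x).
    by rewrite ltr_norml => /andP[-> /ltW].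
  - move=> _ [[a b] _ <-]/=; rewrite nuE.
    have mab : measurable (`]a, b]%classic : set T) by [].
    transitivity (\int[lam]_x (\1_(`]a, b]%classic : set T) x)%:E)%E; last first.
      by rewrite integral_indic// setIT.
    rewrite lamE; last 2 first.
    + by apply/measurable_EFinP; exact: measurable_indic.
    + by move=> x; rewrite lee_fin.
    rewrite integral_mkcond epatch_indic; apply: eq_integral => x _.
    by rewrite muleC.
  - by move=> k; exact: nufin.
exact: lamE.
Qed.

Lemma ball_volumeE (t : R) :
  ball_volume t = ((Num.max t 0 ^+ 3) * fine (ball_volume 1))%:E.
Proof.
rewrite EFinM fineK ?ball_volume_fin_num//.
have [t0|t0] := ltP 0 t.
  by rewrite ball_volume_scale.
rewrite expr0n/= mul0e.
apply/eqP; rewrite eq_le measure_ge0 andbT.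
apply/lee_addgt0Pr => e e0; rewrite add0e.
pose d := Num.min 1 (e / (1 + fine (ball_volume 1))).
have c0 : 0 <= fine (ball_volume 1) by apply: fine_ge0; exact: measure_ge0.
have d0 : 0 < d by rewrite lt_min ltr01 divr_gt0//; slra.
apply: (@le_trans _ _ (ball_volume d)).
  apply: le_measure; rewrite ?inE; [exact: measurable_ball3|exact: measurable_ball3|].
  by move=> x /= h; apply: (le_trans h); exact: le_trans (ltW d0).
rewrite ball_volume_scale// -(fineK ball_volume_fin_num) -EFinM lee_fin.
apply: (@le_trans _ _ (d * (1 + fine (ball_volume 1)))).
  apply: ler_pM; rewrite ?exprn_ge0 ?(ltW d0)//; last by rewrite lerDr.
  rewrite -[leRHS]expr1; apply: ler_wiXn2l => //; first exact: ltW.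
  by rewrite ge_min lexx.
rewrite -ler_pdivlMr; first by rewrite ge_min lexx orbT.
by slra.
Qed.

Definition sphere_area : R := 3 * fine (ball_volume 1).

Lemma sphere_area_gt0 : 0 < sphere_area.
Proof.
by rewrite mulr_gt0// fine_gt0// ball_volume_gt0/= ltey_eq ball_volume_fin_num.
Qed.

Lemma integral_FTC (F f : R -> R) (a b : R) : a <= b ->
  (forall x, a <= x -> x <= b -> is_derive x (1 : R) F (f x)) ->
  {within `[a, b], continuous f} ->
  (\int[leb]_(x in `[a, b]) (f x)%:E = (F b - F a)%:E)%E.
Proof.
rewrite le_eqVlt => /predU1P[->|ab] dF cf.
  by rewrite set_itv1 integral_set1 subrr.
have cF x : a <= x -> x <= b -> {for x, continuous F}.
  move=> ax xb; have [d _] := dF x ax xb.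
  exact/differentiable_continuous/derivable1_diffP.
rewrite (continuous_FTC2 ab cf (F := F))// ?EFinB//.
- split.
  + by move=> x; rewrite in_itv/= => /andP[/ltW ax /ltW xb]; have [] := dF x ax xb.
  + by apply: cvg_at_right_filter; apply: cF => //; exact: ltW.
  + by apply: cvg_at_left_filter; apply: cF => //; exact: ltW.
- move=> x; rewrite in_itv/= => /andP[/ltW ax /ltW xb].
  by rewrite derive1E (derive_val (is_derive := dF x ax xb)).
Qed.

(** Integration in polar coordinates: the distribution of the Euclidean norm
has distribution function t^3 |B|, hence density 3 |B| r^2. *)
Lemma ge0_integral_radial (F : R -> \bar R) :
  measurable_fun setT F -> (forall x, 0 <= F x)%E ->
  (\int[@leb3 R]_x F (enorm3 x) =
   \int[leb]_(r in `[0%R, +oo[) (F r * (sphere_area * r ^+ 2)%:E))%E.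
Proof.
move=> mF F0.
have men : measurable_fun setT (@enorm3 R : R * R * R -> measurableTypeR R).
  exact: measurable_enorm3.
pose nu := image_measure (@leb3 R) men.
pose h (r : R) : R := sphere_area * Num.max r 0 ^+ 2.
have mmax : measurable_fun [set: R] (fun r : R => Num.max r 0).
  exact: measurable_maxr.
have mh : measurable_fun [set: R] h.
  by apply: measurable_funM => //; exact: measurable_funX.
have A0 := sphere_area_gt0.
have h0 x : 0 <= h x by rewrite mulr_ge0 ?sqr_ge0// ltW.
pose V (t : R) := Num.max t 0 ^+ 3 * fine (ball_volume 1).
have nuB (t : R) : nu `]-oo, t]%classic = (V t)%:E.
  by rewrite -ball_volumeE /nu /= /pushforward /ball_volume; congr (leb3 _).
have nuV (a b : R) : a <= b -> nu `]a, b]%classic = (V b - V a)%:E.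
  move=> ab.
  have -> : `]a, b]%classic = `]-oo, b]%classic `\` `]-oo, a]%classic :> set R.
    apply/seteqP; split => x /=; rewrite !in_itv/=.
      by move=> /andP[ax xb]; split => //; apply/negP; rewrite -ltNge.
    by move=> [xb /negP]; rewrite -ltNge xb => ->.
  rewrite measureD//; last by have := ltry (V b); rewrite -nuB.
  rewrite setIidr; last first.
    by move=> x /=; rewrite !in_itv/= => xa; exact: le_trans ab.
  by rewrite EFinB -!nuB.
have nuE (a b : R) : (nu `]a, b]%classic = \int[leb]_(x in `]a, b]) (h x)%:E)%E.
  have [ab|ba] := leP a b; last first.
    by rewrite set_itv_ge ?measure0 ?integral_set0// bnd_simp -leNgt ltW.
  rewrite nuV//.
  transitivity (\int[leb]_(x in `](Num.max a 0)%R, (Num.max b 0)%R]) (sphere_area * x ^+ 2)%:E)%E; last first.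
    rewrite integral_mkcond [RHS]integral_mkcond; apply: eq_integral => x _.
    rewrite /patch /h !mem_setE !in_itv/= gt_max le_max.
    have [x0|x0] := ltP 0 x; rewrite ?andbT ?orbF ?andbF//=; last first.
      by rewrite expr0n/= mulr0; case: ifP.
  rewrite integral_itv_obnd_cbnd; last first.
    by apply/measurable_EFinP; apply: measurable_funM => //; exact: measurable_funX.
  apply/esym; apply: (@integral_FTC (fun x : R => x ^+ 3 * fine (ball_volume 1))).
  - by rewrite ge_max !le_max ab lexx orbT.
  - move=> x _ _; apply: is_derive_eq.
    by rewrite /GRing.scale/= /sphere_area; ring.
  - apply: continuous_subspaceT => x; apply: cvgM; first exact: cvg_cst.
    exact: exprn_continuous.
have := @ge0_integral_density nu h F mh h0 _ nuE mF F0.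
rewrite ge0_integral_pushforward// preimage_setT => ->; last first.
  move=> a b; have [ab|ba] := leP a b; first by rewrite nuV// ltry.
  by rewrite set_itv_ge ?measure0// bnd_simp -leNgt ltW.
rewrite [RHS]integral_mkcond; apply: eq_integral => x _.
rewrite /patch mem_setE in_itv/= andbT /h.
by case: ltP; rewrite ?expr0n/= ?mulr0 ?mule0// => ->.
Qed.

Lemma integral_radial (F : R -> R) : measurable_fun setT F ->
  (\int[@leb3 R]_x (F (enorm3 x))%:E =
   \int[leb]_(r in `[0%R, +oo[) (F r * (sphere_area * r ^+ 2))%:E)%E.
Proof.
move=> mF; pose F' (r : R) : \bar R := (F r)%:E.
have mF' : measurable_fun setT F' by exact/measurable_EFinP.
have A0 := sphere_area_gt0.
have h0 (r : R) : 0 <= sphere_area * r ^+ 2 by rewrite mulr_ge0 ?sqr_ge0// ltW.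
rewrite integralE [RHS]integralE; congr (_ - _)%E.
- transitivity (\int[@leb3 R]_x (F'^\+)%E (enorm3 x))%E.
    by apply: eq_integral => x _; rewrite ?funeposE ?funenegE.
  rewrite ge0_integral_radial//; last exact: measurable_funepos.
  apply: eq_integral => r _; rewrite !funeposE /F'.
  by rewrite -!EFin_max -EFinM maxr_pMl// mul0r.
- transitivity (\int[@leb3 R]_x (F'^\-)%E (enorm3 x))%E.
    by apply: eq_integral => x _; rewrite ?funeposE ?funenegE.
  rewrite ge0_integral_radial//; last exact: measurable_funeneg.
  apply: eq_integral => r _; rewrite !funenegE /F'.
  by rewrite -!EFinN -!EFin_max -EFinM maxr_pMl// mul0r mulNr.
Qed.

End radial_integral.

(** * Weak gradients of radial functions *)

Section calculus.
Context (R : realType).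
Local Notation leb := (@lebesgue_measure R).

Lemma Rintegral_chasles (f : R -> R) (a b c : R) : a <= b -> b <= c ->
  leb.-integrable `[a, c] (EFin \o f) ->
  \int[leb]_(x in `[a, c]) f x = \int[leb]_(x in `[a, b]) f x + \int[leb]_(x in `[b, c]) f x.
Proof.
move=> ab bc intf.
have := @Rintegral_itvB R f (BLeft a) (BRight c) b intf.
rewrite !bnd_simp => /(_ ab bc) E.
rewrite -[X in _ = _ + X]Rintegral_itv_obnd_cbnd; last first.
  by apply: integrableS intf => // x /=; rewrite !in_itv/= => /andP[/ltW bx ->]; rewrite (le_trans ab).
by rewrite -E addrC subrK.
Qed.

Lemma exists_antiderivative (f : R -> R) : continuous f ->
  exists F : R -> R, forall x : R, is_derive x (1 : R) F (f x).
Proof.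
move=> cf.
pose F x := \int[leb]_(y in `[0, x]) f y - \int[leb]_(y in `[x, 0]) f y.
exists F => x.
pose c := Num.min x 0 - 1.
have cx : c < x by rewrite ltrBlDr (@le_lt_trans _ _ x)// ?ge_min ?lexx// ltrDl.
have c0 : c <= 0 by rewrite lerBlDr (@le_trans _ _ 0)// ?ge_min ?lexx ?orbT// addr_ge0.
have FE y : c < y -> F y = \int[leb]_(z in `[c, y]) f z - \int[leb]_(z in `[c, 0]) f z.
  move=> cy; rewrite /F; have [y0|y0] := leP 0 y.
    rewrite (@Rintegral_chasles f c 0 y)//; last exact: continuous_integrable.
    rewrite addrAC subrr add0r; move: y0; rewrite le_eqVlt => /predU1P[<-|y0].
      by rewrite subrr set_itv1 Rintegral_set1.
    by rewrite [X in _ - X](_ : _ = 0) ?subr0// set_itv_ge ?Rintegral_set0// bnd_simp -ltNge.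
  rewrite (@Rintegral_chasles f c y 0) ?(ltW cy) ?(ltW y0)//; last exact: continuous_integrable.
  rewrite opprD addrA subrr sub0r.
  by rewrite [X in X - _](_ : _ = 0) ?sub0r// set_itv_ge ?Rintegral_set0// bnd_simp -ltNge.
have [d1 d2] := @continuous_FTC1_closed _ f c x (x + 1) (ltr_pwDr ltr01 (lexx x))
  (continuous_integrable _ _ cf) cx (cf x).
apply: (@near_eq_is_derive _ _ _ (fun y => \int[leb]_(z in `[c, y]) f z - \int[leb]_(z in `[c, 0]) f z)).
  near=> y; apply/esym/FE; near: y; exact: lt_nbhsr.
have h1 : is_derive x (1 : R) (fun y : R => \int[leb]_(z in `[c, y]) f z) (f x).
  by rewrite -d2 derive1E; exact: derivableP.
by apply: is_derive_eq; rewrite subr0.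
Unshelve. all: by end_near. Qed.

Lemma is_derive_continuous (F : R -> R) (x l : R) :
  is_derive x (1 : R) F l -> {for x, continuous F}.
Proof. by move=> [d _]; exact/differentiable_continuous/derivable1_diffP. Qed.

Lemma Rintegral_FTC (F f : R -> R) (a b : R) : a <= b ->
  (forall x, a <= x -> x <= b -> is_derive x (1 : R) F (f x)) ->
  {within `[a, b], continuous f} ->
  \int[leb]_(x in `[a, b]) f x = F b - F a.
Proof. by move=> ab dF cf; rewrite /Rintegral (integral_FTC ab dF cf). Qed.

Lemma is_derive_line (V : normedModType R) (f : V -> R) (x v : V) (l : R) :
  is_derive (0 : R) (1 : R) (fun h : R => f (h *: v + x)) l -> is_derive x v f l.
Proof.
move=> [d e].
have E : (fun h : R => h^-1 *: ((f \o shift x) (h *: v) - f x)) =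
    (fun h : R => h^-1 *: (((fun h : R => f (h *: v + x)) \o shift 0) (h *: 1) - (fun h : R => f (h *: v + x)) 0)).
  by apply/funext => h /=; rewrite addr0 scale0r add0r [h *: 1]mulr1.
split; first by rewrite /derivable E.
by rewrite /derive E.
Qed.

End calculus.

Section test_fields.
Context (R : realType).
Local Notation leb := (@lebesgue_measure R).
Implicit Types x : R * R * R.

Definition sqn x : R := x.1.1 ^+ 2 + x.1.2 ^+ 2 + x.2 ^+ 2.

Lemma sqn_ge0 x : 0 <= sqn x.
Proof. by rewrite !addr_ge0 ?sqr_ge0. Qed.

Lemma sqn_enorm3 x : sqn x = enorm3 x ^+ 2.
Proof. by rewrite /enorm3 sqr_sqrtr// sqn_ge0. Qed.

Definition coord3 (i : 'I_3) x : R :=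
  if i == 0 :> nat then x.1.1 else if i == 1 :> nat then x.1.2 else x.2.

Lemma ord3P (P : 'I_3 -> Prop) :
  P (@Ordinal 3 0 isT) -> P (@Ordinal 3 1 isT) -> P (@Ordinal 3 2 isT) -> forall i, P i.
Proof.
move=> P0 P1 P2 [[|[|[|//]]] h].
- by rewrite (_ : Ordinal h = @Ordinal 3 0 isT)//; exact: val_inj.
- by rewrite (_ : Ordinal h = @Ordinal 3 1 isT)//; exact: val_inj.
- by rewrite (_ : Ordinal h = @Ordinal 3 2 isT)//; exact: val_inj.
Qed.

Lemma coord3_line i j (h : R) x :
  coord3 i (h *: @basis3 R j + x) = coord3 i x + h * (i == j)%:R.
Proof.
move: i j; apply: ord3P; apply: ord3P; rewrite /coord3/= /GRing.scale/=; ring.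
Qed.

Lemma sqn_line j (h : R) x :
  sqn (h *: @basis3 R j + x) = sqn x + 2 * h * coord3 j x + h ^+ 2.
Proof.
move: j; apply: ord3P; rewrite /sqn /coord3/= /GRing.scale/=; ring.
Qed.

Lemma sum_coord3 x : \sum_(i < 3) coord3 i x ^+ 2 = sqn x.
Proof. by rewrite !big_ord_recl big_ord0 /coord3/= /sqn addr0 addrA. Qed.

Lemma continuous_coord3 i : continuous (coord3 i).
Proof.
have c1 : continuous (fun x : R * R * R => x.1) by move=> x; exact: cvg_fst.
move: i; apply: ord3P => x; rewrite /coord3/=.
- by apply: continuous_comp; [exact: c1|exact: cvg_fst].
- by apply: continuous_comp; [exact: c1|exact: cvg_snd].
- exact: cvg_snd.
Qed.

Lemma continuous_sqn : continuous sqn.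
Proof.
have cX i : continuous (fun x => coord3 i x ^+ 2).
  move=> x; apply: (@continuous_comp _ _ _ (coord3 i) (fun y : R => y ^+ 2)).
    exact: continuous_coord3.
  exact: exprn_continuous.
move=> x; apply: cvgD; first apply: cvgD.
- exact: (cX (@Ordinal 3 0 isT)).
- exact: (cX (@Ordinal 3 1 isT)).
- exact: (cX (@Ordinal 3 2 isT)).
Qed.

Definition test_field (z : R -> R) (i : 'I_3) x : R := z (sqn x) * coord3 i x.

Definition test_field_derivative (z z' : R -> R) (i j : 'I_3) x : R :=
  2 * z' (sqn x) * coord3 j x * coord3 i x + z (sqn x) * (i == j)%:R.

Lemma is_derive_test_field z z' i j x : (forall q : R, is_derive q (1 : R) z (z' q)) ->
  is_derive x (@basis3 R j) (test_field z i) (test_field_derivative z z' i j x).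
Proof.
move=> dz; apply: is_derive_line.
pose q (h : R) : R := sqn x + 2 * h * coord3 j x + h ^+ 2.
have -> : (fun h : R => test_field z i (h *: @basis3 R j + x)) =
    (fun h : R => z (q h) * (coord3 i x + h * (i == j)%:R)).
  by apply/funext => h; rewrite /test_field coord3_line sqn_line.
have q0 : q 0 = sqn x by rewrite /q expr0n mulr0 mul0r !addr0.
have dq : is_derive (0 : R) (1 : R) q (2 * coord3 j x).
  by rewrite /q; apply: is_derive_eq; rewrite /GRing.scale/=; ring.
have dzq : is_derive (0 : R) (1 : R) (fun h => z (q h)) (z' (q 0) * (2 * coord3 j x)).
  exact: is_derive1_comp.
apply: is_derive_eq.
by rewrite q0 /GRing.scale/= /test_field_derivative; ring.
Qed.

Lemma test_function_field z z' (Q : R) i : (forall q : R, is_derive q (1 : R) z (z' q)) ->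
  continuous z' -> (forall q, Q < q -> z q = 0) -> test_function (test_field z i).
Proof.
move=> dz cz' zQ.
have cz : continuous z by move=> q; exact: (is_derive_continuous (dz q)).
have dE j : (fun x => 'D_(@basis3 R j) (test_field z i) x) = test_field_derivative z z' i j.
  apply/funext => x; have := @is_derive_test_field z z' i j x dz => h.
  exact: derive_val.
split.
- by move=> j x; have [] := @is_derive_test_field z z' i j x dz.
- move=> j; rewrite dE => x.
  have c1 : {for x, continuous (fun x => z' (sqn x))}.
    by apply: continuous_comp; [exact: continuous_sqn|exact: cz'].
  have c2 : {for x, continuous (fun x => z (sqn x))}.
    by apply: continuous_comp; [exact: continuous_sqn|exact: cz].
  apply: cvgD; last by apply: cvgM; [exact: c2|exact: cvg_cst].
  apply: cvgM; last exact: continuous_coord3.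
  apply: cvgM; last exact: continuous_coord3.
  by apply: cvgM; [exact: cvg_cst|exact: c1].
- exists (Num.max 1 Q) => x; rewrite gt_max => /andP[x1 xQ].
  rewrite /test_field zQ ?mul0r// sqn_enorm3 (lt_le_trans xQ)// expr2.
  by rewrite ler_peMr// ltW// (lt_trans _ x1).
Qed.

Lemma test_field_divergence z z' x :
  \sum_(i < 3) test_field_derivative z z' i i x = 2 * z' (sqn x) * sqn x + 3 * z (sqn x).
Proof.
rewrite /test_field_derivative; under eq_bigr => i _ do rewrite eqxx mulr1.
rewrite -sum_coord3 !big_ord_recl !big_ord0; ring.
Qed.

End test_fields.

Section gradient.
Context (R : realType).
Local Notation leb := (@lebesgue_measure R).
Implicit Types x : R * R * R.

Lemma L2_product (f g : R * R * R -> R) : in_L2 f -> in_L2 g ->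
  (@leb3 R).-integrable setT (EFin \o (fun x => f x * g x)) /\
  `|\int[@leb3 R]_x (f x * g x)| <= (fine (sqL2 f) + fine (sqL2 g)) / 2.
Proof.
move=> [mf f2] [mg g2].
have sq_int (h : R * R * R -> R) : measurable_fun setT h -> (sqL2 h < +oo)%E ->
    (@leb3 R).-integrable setT (EFin \o (fun x => h x ^+ 2)).
  move=> mh h2; apply/integrableP; split.
    by apply/measurable_EFinP; exact: measurable_funX.
  apply: le_lt_trans h2; rewrite le_eqVlt; apply/orP; left; apply/eqP.
  by apply: eq_integral => x _ /=; rewrite ger0_norm ?sqr_ge0.
have if2 := sq_int f mf f2.
have ig2 := sq_int g mg g2.
have isq : (@leb3 R).-integrable setT (fun x => (f x ^+ 2)%R%:E + (g x ^+ 2)%R%:E)%E.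
  exact: integrableD.
have isum : (@leb3 R).-integrable setT (EFin \o (fun x => (f x ^+ 2 + g x ^+ 2) / 2)).
  have -> : EFin \o (fun x => (f x ^+ 2 + g x ^+ 2) / 2) =
     (fun x => (2^-1)%:E * ((f x ^+ 2)%R%:E + (g x ^+ 2)%R%:E))%E.
    by apply/funext => x /=; rewrite mulrC.
  exact: integrableZl.
have le2 x : `|f x * g x| <= (f x ^+ 2 + g x ^+ 2) / 2.
  rewrite normrM ler_pdivlMr// -[f x ^+ 2]real_normK ?num_real// -[g x ^+ 2]real_normK ?num_real//.
  have := sqr_ge0 (`|f x| - `|g x|); rewrite sqrrB => h.
  by rewrite -subr_ge0; apply: le_trans h _; rewrite le_eqVlt; apply/orP; left; apply/eqP; ring.
have ifg : (@leb3 R).-integrable setT (EFin \o (fun x => f x * g x)).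
  apply: le_integrable isum => //; first by apply/measurable_EFinP; exact: measurable_funM.
  by move=> x _ /=; rewrite lee_fin (le_trans (le2 x))// ler_norm.
split => //.
apply: (le_trans (le_normr_Rintegral _ ifg)) => //.
apply: (le_trans (le_Rintegral _ _ isum _)) => //.
- have -> : (EFin \o (fun x => `|f x * g x|)) = (abse \o (EFin \o (fun x => f x * g x))) by [].
  exact: integrable_abse.
- by rewrite RintegralZr// RintegralD.
Qed.

Lemma measurable_coord3 i : measurable_fun setT (@coord3 R i).
Proof.
have m1 : measurable_fun [set: R * R * R] (fun x => x.1) by exact: measurable_fst.
have m2 : measurable_fun [set: R * R * R] (fun x => x.2) by exact: measurable_snd.
move: i; apply: ord3P; rewrite /coord3/=.
- exact: (measurableT_comp measurable_fst m1).
- exact: (measurableT_comp measurable_snd m1).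
- exact: m2.
Qed.

Lemma measurable_sqn : measurable_fun setT (@sqn R).
Proof.
apply: measurable_funD; first apply: measurable_funD; apply: measurable_funX.
- exact: (measurable_coord3 (@Ordinal 3 0 isT)).
- exact: (measurable_coord3 (@Ordinal 3 1 isT)).
- exact: (measurable_coord3 (@Ordinal 3 2 isT)).
Qed.

Lemma in_L2_bounded (f : R * R * R -> R) (K Q : R) : measurable_fun setT f ->
  (forall x, sqn x <= Q -> `|f x| <= K) -> (forall x, Q < sqn x -> f x = 0) ->
  in_L2 f.
Proof.
move=> mf fK fQ; split=> //.
pose B := [set x : R * R * R | enorm3 x <= Num.max 1 Q].
have mB : measurable B by exact: measurable_ball3.
apply: (@le_lt_trans _ _ (\int[@leb3 R]_x ((K ^+ 2)%:E * (\1_B x)%:E))%E).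
  apply: ge0_le_integral => //.
  - by move=> x _; rewrite lee_fin sqr_ge0.
  - by apply/measurable_EFinP; exact: measurable_funX.
  - by apply: emeasurable_funM => //; apply/measurable_EFinP; exact: measurable_indic.
  - move=> x _; rewrite -EFinM lee_fin indicE.
    have [xQ|Qx] := leP (sqn x) Q; last first.
      by rewrite fQ// expr0n mulr_ge0// sqr_ge0.
    have -> : x \in B.
      rewrite inE /B/= /enorm3 -/(sqn x) le_max.
      have [s1|s1] := leP (sqn x) 1; first by rewrite -[X in _ <= X]sqrtr1 ler_wsqrtr.
      apply/orP; right; apply: le_trans xQ.
      rewrite -[leRHS](ger0_norm (sqn_ge0 x)) -sqrtr_sqr ler_wsqrtr//.
      by rewrite expr2 ler_peMr ?sqn_ge0// ltW.
    rewrite mulr1 -[leLHS]real_normK ?num_real// lerXn2r ?nnegrE//; first exact: le_trans (fK x xQ).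
    exact: fK.
rewrite ge0_integralZl//; last 2 first.
- by apply/measurable_EFinP; exact: measurable_indic.
- by rewrite lee_fin sqr_ge0.
have -> : (\int[@leb3 R]_x (\1_B x)%:E = ball_volume (Num.max 1 Q)%R)%E.
  by rewrite integral_indic// setIT.
by rewrite ball_volumeE -EFinM ltry.
Qed.

Lemma measurable_radial_profile (psi0 : R -> R) : measurable_fun setT (radial psi0) ->
  measurable_fun setT (fun r : R => psi0 `|r|).
Proof.
move=> mpsi.
have -> : (fun r : R => psi0 `|r|) = radial psi0 \o (fun r : R => ((r, 0), 0)).
  by apply/funext => r /=; rewrite /radial /enorm3/= expr0n !addr0 sqrtr_sqr.
apply: measurableT_comp => //.
by apply: measurable_fun_pair => //; apply: measurable_fun_pair.
Qed.

(** The field x -> z(|x|^2) x has divergence 2 z' |x|^2 + 3 z; Young's inequality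
makes the right-hand side quadratic in the gradient and in the field, which is
the form that duality needs. *)
Lemma gradient_test (f : R * R * R -> R) (g : 'I_3 -> R * R * R -> R) (z z' : R -> R) (Q : R) :
  in_H1 f g -> (forall q : R, is_derive q (1 : R) z (z' q)) -> continuous z' ->
  (forall q, Q < q -> z q = 0) -> (forall q, Q < q -> z' q = 0) ->
  \int[@leb3 R]_x (f x * (2 * z' (sqn x) * sqn x + 3 * z (sqn x))) <=
  (\sum_(i < 3) fine (sqL2 (g i)) +
   fine (\int[@leb3 R]_x (z (sqn x) ^+ 2 * sqn x)%:E)%E) / 2.
Proof.
move=> [Lf Lg wg] dz cz' zQ z'Q.
have cz : continuous z by move=> q; exact: (is_derive_continuous (dz q)).
have bounded (h : R -> R) : continuous h -> exists K : R, forall q : R, 0 <= q -> q <= Q -> `|h q| <= K.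
  move=> ch.
  have : compact (h @` `[0, Q]).
    apply: continuous_compact; first exact: continuous_subspaceT.
    exact: segment_compact.
  move=> /compact_bounded[N [Nr hN]]; exists (N + 1) => q q0 qQ.
  apply: (hN (N + 1)); first by rewrite ltrDl.
  by exists q => //=; rewrite in_itv/= q0.
have [K hK] := bounded _ cz.
have [K' hK'] := bounded _ cz'.
have mz : measurable_fun setT (fun x => z (sqn x)).
  by apply: measurableT_comp; [exact: continuous_measurable_fun|exact: measurable_sqn].
have mz' : measurable_fun setT (fun x => z' (sqn x)).
  by apply: measurableT_comp; [exact: continuous_measurable_fun|exact: measurable_sqn].
have coord_le i x : coord3 i x ^+ 2 <= sqn x.
  rewrite -sum_coord3 (bigD1 i)//= lerDl; apply: sumr_ge0 => j _.
  exact: sqr_ge0.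
have Ld i : in_L2 (test_field_derivative z z' i i).
  apply: (@in_L2_bounded _ (2 * K' * Q + K) Q).
  - apply: measurable_funD; last by apply: measurable_funM.
    apply: measurable_funM; last exact: measurable_coord3.
    apply: measurable_funM; last exact: measurable_coord3.
    exact: measurable_funM.
  - move=> x xQ; rewrite /test_field_derivative eqxx mulr1 -mulrA -expr2.
    have hz := hK _ (sqn_ge0 x) xQ; have hz' := hK' _ (sqn_ge0 x) xQ.
    apply: (le_trans (ler_normD _ _)); apply: lerD => //.
    rewrite (normrM (2 * _)) (normrM 2) (ger0_norm (sqr_ge0 _)) (ger0_norm (ler0n _ 2)).
    apply: ler_pM; [exact: mulr_ge0|exact: sqr_ge0|by rewrite ler_pM2l|].
    exact: le_trans (coord_le i x) xQ.
  - by move=> x Qx; rewrite /test_field_derivative zQ// z'Q// !mulr0 !mul0r addr0.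
have Lt i : in_L2 (test_field z i).
  apply: (@in_L2_bounded _ (K * (1 + Q)) Q).
  - by apply: measurable_funM => //; exact: measurable_coord3.
  - move=> x xQ; rewrite /test_field normrM; apply: ler_pM => //.
      exact: hK (sqn_ge0 x) xQ.
    have [c1|c1] := leP `|coord3 i x| 1.
      by rewrite (le_trans c1)// lerDl (le_trans (sqn_ge0 x)).
    apply: (@le_trans _ _ (coord3 i x ^+ 2)).
      by rewrite -[leRHS]real_normK ?num_real// expr2 ler_peMr// ltW.
    by rewrite (le_trans (coord_le i x))// (le_trans xQ)// lerDr.
  - by move=> x Qx; rewrite /test_field zQ// mul0r.
have DE i : (fun x => 'D_(@basis3 R i) (test_field z i) x) = test_field_derivative z z' i i.
  by apply/funext => x; have h := @is_derive_test_field R z z' i i x dz; exact: derive_val.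
have tst i : \int[@leb3 R]_x (f x * test_field_derivative z z' i i x) <=
    (fine (sqL2 (g i)) + fine (sqL2 (test_field z i))) / 2.
  have := wg i _ (test_function_field i dz cz' zQ); rewrite -DE => ->.
  rewrite (le_trans (ler_norm _))// normrN.
  by have [_] := L2_product (Lg i) (Lt i).
have E1 : \int[@leb3 R]_x (f x * (2 * z' (sqn x) * sqn x + 3 * z (sqn x))) =
    \sum_(i < 3) \int[@leb3 R]_x (f x * test_field_derivative z z' i i x).
  have iP i := (L2_product Lf (Ld i)).1.
  rewrite !big_ord_recl big_ord0 addr0.
  have iP2 : (@leb3 R).-integrable setT (fun x =>
    (f x * test_field_derivative z z' (lift ord0 ord0) (lift ord0 ord0) x)%R%:E +
    (f x * test_field_derivative z z' (lift ord0 (lift ord0 ord0)) (lift ord0 (lift ord0 ord0)) x)%R%:E)%E.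
    by apply: integrableD => //; exact: iP.
  rewrite -RintegralD//.
  rewrite -RintegralD//.
  apply: eq_Rintegral => x _; rewrite -test_field_divergence !big_ord_recl big_ord0; ring.
have E2 : fine (\int[@leb3 R]_x (z (sqn x) ^+ 2 * sqn x)%:E)%E = \sum_(i < 3) fine (sqL2 (test_field z i)).
  have fin i : sqL2 (test_field z i) \is a fin_num.
    rewrite ge0_fin_numE; first by have [] := Lt i.
    by apply: integral_ge0 => x _; rewrite lee_fin sqr_ge0.
  rewrite sum_fine//; congr fine.
  transitivity (\int[@leb3 R]_x (\sum_(i < 3) (test_field z i x ^+ 2)%:E)%E)%E.
    apply: eq_integral => x _; rewrite sumEFin -[X in (_ * X)%:E]sum_coord3 mulr_sumr; congr (_%:E).
    by apply: eq_bigr => i _; rewrite /test_field exprMn.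
  rewrite ge0_integral_sum//.
  - by move=> i; apply/measurable_EFinP; apply: measurable_funX; have [] := Lt i.
  - by move=> i x _; rewrite lee_fin sqr_ge0.
rewrite E1 E2 -big_split/= mulr_suml.
by apply: ler_sum => i _; exact: tst.
Qed.

(** The radial form of the previous lemma: with z(q) = k(sqrt q) / q the field
is k(r) / r^2 times x, and f = W / r gives r^2 f div = W (k' + k / r). *)
Lemma radial_gradient_test (psi0 : R -> R) g (W k k' : R -> R) (a b : R) :
  in_H1 (radial psi0) g -> continuous W ->
  {ae leb, forall r : R, 0 <= r -> W r = r * psi0 r} ->
  0 < a -> a <= b ->
  (forall r : R, 0 < r -> is_derive r (1 : R) k (k' r)) -> continuous k -> continuous k' ->
  (forall r, r < a -> k r = 0 /\ k' r = 0) -> (forall r, b < r -> k r = 0 /\ k' r = 0) ->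
  sphere_area R * \int[leb]_(r in `[a, b]) (W r * (k' r + k r / r)) <=
  (\sum_(i < 3) fine (sqL2 (g i)) +
   sphere_area R * \int[leb]_(r in `[a, b]) (k r ^+ 2)) / 2.
Proof.
move=> Hf cW WE a0 ab dk ck ck' ka kb.
have [[mf f2] _ _] := Hf.
pose z (q : R) : R := k (Num.sqrt q) / q.
pose z' (q : R) : R := (k' (Num.sqrt q) / (2 * Num.sqrt q) - k (Num.sqrt q) / q) / q.
have z0 q : q < a ^+ 2 -> z q = 0 /\ z' q = 0.
  move=> qa; have sa : Num.sqrt q < a by rewrite -[ltRHS](ger0_norm (ltW a0)) -sqrtr_sqr ltr_sqrt// exprn_gt0.
  by rewrite /z /z' (ka _ sa).1 (ka _ sa).2 !mul0r subrr mul0r.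
have zQ q : b ^+ 2 < q -> z q = 0 /\ z' q = 0.
  move=> bq.
  have b0 : 0 < b by exact: lt_le_trans ab.
  have q0 : 0 < q by apply: lt_trans bq; rewrite exprn_gt0.
  have sb : b < Num.sqrt q by rewrite -[ltLHS](ger0_norm (ltW b0)) -sqrtr_sqr ltr_sqrt.
  by rewrite /z /z' (kb _ sb).1 (kb _ sb).2 !mul0r subrr mul0r.
have a20 : 0 < a ^+ 2 by rewrite exprn_gt0.
have dz (q : R) : is_derive q (1 : R) z (z' q).
  have [qa|aq] := ltP q (a ^+ 2).
    rewrite (z0 q qa).2; apply: (@near_eq_is_derive _ _ _ (cst 0)).
      by near=> y; rewrite (z0 y _).1//; near: y; exact: lt_nbhsl.
  have q0 := lt_le_trans a20 aq.
  have s0 : 0 < Num.sqrt q by rewrite sqrtr_gt0.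
  have d1 := is_derive1_sqrt q0.
  have dks : is_derive q (1 : R) (fun y => k (Num.sqrt y)) (k' (Num.sqrt q) * (2 * Num.sqrt q)^-1).
    have d2 := dk _ s0; exact: is_derive1_comp.
  have qn0 : q != 0 by rewrite gt_eqF.
  have iV := is_derive_invr qn0.
  rewrite /z; apply: is_derive_eq.
  rewrite /GRing.scale/= /z'; field.
  by rewrite qn0 gt_eqF.
have cz' : continuous z'.
  move=> q; have [qa|aq] := ltP q (a ^+ 2).
    suff : z' y @[y --> q] --> z' q by [].
    rewrite (z0 q qa).2; apply: cvg_near_cst.
    by near=> y; rewrite (z0 y _).2//; near: y; exact: lt_nbhsl.
  have q0 := lt_le_trans a20 aq.
  have s0 : 0 < Num.sqrt q by rewrite sqrtr_gt0.
  have cs : {for q, continuous (@Num.sqrt R)} by exact: sqrt_continuous.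
  have qn0 : q != 0 by rewrite gt_eqF.
  have ciV : {for q, continuous (fun y : R => y^-1)} by exact: inv_continuous.
  apply: cvgM; last exact: ciV.
  apply: cvgB; last first.
    by apply: cvgM; [apply: continuous_comp; [exact: cs|exact: ck]|exact: ciV].
  apply: cvgM; first by apply: continuous_comp; [exact: cs|exact: ck'].
  apply: cvgV; first by rewrite gt_eqF// mulr_gt0.
  by apply: cvgM; [exact: cvg_cst|exact: cs].
have main := gradient_test Hf dz cz' (fun q h => (zQ q h).1) (fun q h => (zQ q h).2).
have cz : continuous z by move=> q; exact: (is_derive_continuous (dz q)).
pose f0 (r : R) : R := psi0 `|r|.
have mf0 : measurable_fun setT f0 by exact: measurable_radial_profile.
have msq : measurable_fun [set: R] (fun r : R => r ^+ 2) by exact: measurable_funX.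
have mz : measurable_fun setT (fun r : R => z (r ^+ 2)).
  by apply: measurableT_comp => //; exact: continuous_measurable_fun.
have mz' : measurable_fun setT (fun r : R => z' (r ^+ 2)).
  by apply: measurableT_comp => //; exact: continuous_measurable_fun.
have zr r : 0 <= r -> z (r ^+ 2) = k r / r ^+ 2.
  by move=> r0; rewrite /z sqrtr_sqr ger0_norm.
have z'r r : 0 <= r -> z' (r ^+ 2) = (k' r / (2 * r) - k r / r ^+ 2) / r ^+ 2.
  by move=> r0; rewrite /z' sqrtr_sqr ger0_norm.
have A0 := sphere_area_gt0 R.
have kr r : 0 <= r -> k r / r ^+ 2 * r ^+ 2 = k r.
  move=> r0; have [ra|ar] := ltP r a; first by rewrite (ka r ra).1 !mul0r.
  by rewrite divfK// expf_neq0// gt_eqF// (lt_le_trans a0).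
have E1 : \int[@leb3 R]_x (radial psi0 x * (2 * z' (sqn x) * sqn x + 3 * z (sqn x))) =
    sphere_area R * \int[leb]_(r in `[a, b]) (W r * (k' r + k r / r)).
  pose F1 (r : R) : R := f0 r * (2 * z' (r ^+ 2) * r ^+ 2 + 3 * z (r ^+ 2)).
  have mF1 : measurable_fun setT F1.
    apply: measurable_funM => //; apply: measurable_funD; apply: measurable_funM => //.
    by apply: measurable_funM.
  transitivity (fine (\int[@leb3 R]_x (F1 (enorm3 x))%:E)%E).
    congr fine; apply: eq_integral => x _; rewrite /F1 -sqn_enorm3 /f0 /radial ger0_norm//.
    exact: sqrtr_ge0.
  rewrite (integral_radial mF1) /F1.
  have cWk : {within `[a, b], continuous (fun r => W r * (k' r + k r / r))}.
    apply: continuous_in_subspaceT => r; rewrite inE/= in_itv/= => /andP[ar _].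
    apply: cvgM; first exact: cW.
    apply: cvgD; first exact: ck'.
    by apply: cvgM; [exact: ck|apply: continuous_invr; rewrite gt_eqF// (lt_le_trans a0)].
  rewrite -RintegralZl//; last first.
    by apply: continuous_compact_integrable => //; exact: segment_compact.
  rewrite /Rintegral; congr fine.
  have mWk : measurable_fun `[a, b] (fun r : R => (sphere_area R * (W r * (k' r + k r / r)))%:E).
    apply/measurable_EFinP; apply: measurable_funM => //.
    apply: (subspace_continuous_measurable_fun _ cWk) => //.
  rewrite [LHS]integral_mkcond [RHS]integral_mkcond.
  apply: ae_eq_integral => //.
  - apply/(measurable_restrictT _ _).1 => //; apply: measurable_funTS; apply/measurable_EFinP.
    by apply: measurable_funM => //; exact: measurable_funM.
  - exact/(measurable_restrictT _ _).1.
  - move: WE; apply: filterS; first exact: (ae_filter_ringOfSetsType leb).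
    move=> r Wr _; rewrite /patch !mem_setE !in_itv/= andbT.
    case: ifPn => [r0|]; last first.
      by rewrite -ltNge => r0; rewrite leNgt (lt_trans r0).
    rewrite /f0 (ger0_norm r0) zr// z'r//.
    have [ra|ar] /= := ltP r a.
      by rewrite (ka r ra).1 (ka r ra).2 !mul0r subrr mul0r !mulr0 mul0r addr0 mulr0 mul0r.
    have r1 : 0 < r by exact: lt_le_trans ar.
    have [rb|br] /= := leP r b; last first.
      by rewrite (kb r br).1 (kb r br).2 !mul0r subrr mul0r !mulr0 mul0r addr0 mulr0 mul0r.
    rewrite (Wr r0); congr (_%:E); field.
    by rewrite gt_eqF.
have E2 : fine (\int[@leb3 R]_x (z (sqn x) ^+ 2 * sqn x)%:E)%E =
    sphere_area R * \int[leb]_(r in `[a, b]) (k r ^+ 2).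
  pose F2 (r : R) : R := z (r ^+ 2) ^+ 2 * r ^+ 2.
  have mF2 : measurable_fun setT F2.
    by apply: measurable_funM => //; exact: measurable_funX.
  transitivity (fine (\int[@leb3 R]_x (F2 (enorm3 x))%:E)%E).
    by congr fine; apply: eq_integral => x _; rewrite /F2 -sqn_enorm3.
  rewrite (integral_radial mF2) /F2.
  have ck2 : continuous (fun r => k r ^+ 2).
    by move=> r; apply: (@continuous_comp _ _ _ k (fun y : R => y ^+ 2)); [exact: ck|exact: exprn_continuous].
  rewrite -RintegralZl//; last exact: continuous_integrable.
  rewrite /Rintegral; congr fine.
  rewrite [LHS]integral_mkcond [RHS]integral_mkcond.
  apply: eq_integral => r _; rewrite /patch !mem_setE !in_itv/= andbT.
  case: ifPn => [r0|]; last first.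
    by rewrite -ltNge => r0; rewrite leNgt (lt_trans r0).
  rewrite zr//.
  have [ra|ar] /= := ltP r a; first by rewrite (ka r ra).1 !mul0r expr0n !mul0r.
  have [rb|br] /= := leP r b; last by rewrite (kb r br).1 !mul0r expr0n !mul0r.
  congr (_%:E); field; rewrite gt_eqF//; exact: lt_le_trans ar.
by rewrite -E1 -E2.
Unshelve. all: by end_near. Qed.

End gradient.

(** * Square integrability of the derivative of the first datum *)

Lemma continuous_maxr (R : realType) (T : topologicalType) (f g : T -> R) :
  continuous f -> continuous g -> continuous (fun r => Num.max (f r) (g r)).
Proof. by move=> cf cg x; exact: (@continuous_max R T f g x (cf x) (cg x)). Qed.

Lemma continuous_minr (R : realType) (T : topologicalType) (f g : T -> R) :
  continuous f -> continuous g -> continuous (fun r => Num.min (f r) (g r)).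
Proof. by move=> cf cg x; exact: (@continuous_min R T f g x (cf x) (cg x)). Qed.

Section steklov.
Context (R : realType).
Local Notation leb := (@lebesgue_measure R).

Lemma antiderivative_cst (F f : R -> R) (a b : R) : a <= b ->
  (forall x, is_derive x (1 : R) F (f x)) -> continuous f ->
  (forall x, a <= x -> x <= b -> f x = 0) -> F a = F b.
Proof.
move=> ab dF cf f0.
have := Rintegral_cst_bound (K := 0) ab cf.
rewrite (Rintegral_FTC ab (fun x _ _ => dF x)); last exact: continuous_subspaceT.
rewrite mul0r => h; apply/esym/eqP; rewrite -subr_eq0 -normr_eq0 eq_le normr_ge0 andbT.
by apply: h => x ax xb; rewrite f0// normr0.
Qed.

Lemma continuous_shift (f : R -> R) (c : R) : continuous f -> continuous (fun x => f (x + c)).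
Proof.
move=> cf x; apply: (@continuous_comp _ _ _ (fun y : R => y + c) f); last exact: cf.
by apply: cvgD; [exact: cvg_id|exact: cvg_cst].
Qed.

Lemma is_derive_shift (F f : R -> R) (c x : R) : (forall x, is_derive x (1 : R) F (f x)) ->
  is_derive x (1 : R) (fun x => F (x + c)) (f (x + c)).
Proof.
move=> dF; have h : is_derive x (1 : R) (fun y : R => y + c) 1.
  by apply: is_derive_eq; rewrite addr0.
have h2 := dF (x + c).
by rewrite -[f _]mulr1; exact: (@is_derive1_comp R F (fun y : R => y + c)).
Qed.

(** Jensen's inequality on each window, whose proof is the nonnegativity of the
variance of kappa there; the averages of kappa^2 then telescope. *)
Lemma steklov_contraction (kappa K : R -> R) (al be d : R) : al <= be -> 0 < d ->
  continuous kappa -> (forall r, r <= al -> kappa r = 0) -> (forall r, be <= r -> kappa r = 0) ->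
  (forall x, is_derive x (1 : R) K (kappa x)) ->
  \int[leb]_(r in `[al, be + d]) (((K r - K (r - d)) / d) ^+ 2) <=
  \int[leb]_(r in `[al, be]) (kappa r ^+ 2).
Proof.
move=> albe d0 ck ka kb dK.
have ck2 : continuous (fun r => kappa r ^+ 2).
  by move=> r; apply: (@continuous_comp _ _ _ kappa (fun y : R => y ^+ 2)); [exact: ck|exact: exprn_continuous].
have cK : continuous K by move=> r; exact: (is_derive_continuous (dK r)).
have [K2 dK2] := exists_antiderivative ck2.
have cK2 : continuous K2 by move=> r; exact: (is_derive_continuous (dK2 r)).
have [K3 dK3] := exists_antiderivative cK2.
have dn0 : d != 0 by rewrite gt_eqF.
have cs r : ((K r - K (r - d)) / d) ^+ 2 <= (K2 r - K2 (r - d)) / d.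
  pose c := (K r - K (r - d)) / d.
  have dc x : is_derive x (1 : R) (fun x => K2 x - 2 * c * K x + c ^+ 2 * x) ((kappa x - c) ^+ 2).
    have h1 := dK2 x; have h2 := dK x.
    by apply: is_derive_eq; rewrite /GRing.scale/=; ring.
  have cc : continuous (fun x => (kappa x - c) ^+ 2).
    move=> x; apply: (@continuous_comp _ _ _ (fun x => kappa x - c) (fun y : R => y ^+ 2)); last exact: exprn_continuous.
    by apply: cvgB; [exact: ck|exact: cvg_cst].
  have rd : r - d <= r by rewrite gerBl ltW.
  have : 0 <= \int[leb]_(x in `[r - d, r]) ((kappa x - c) ^+ 2).
    by apply: Rintegral_ge0 => x _; exact: sqr_ge0.
  rewrite (Rintegral_FTC rd (fun x _ _ => dc x)); last exact: continuous_subspaceT.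
  have -> : K2 r - 2 * c * K r + c ^+ 2 * r - (K2 (r - d) - 2 * c * K (r - d) + c ^+ 2 * (r - d)) =
     (K2 r - K2 (r - d)) - c ^+ 2 * d by rewrite /c; field.
  by rewrite subr_ge0 ler_pdivlMr.
have bed : al <= be + d by rewrite ler_wpDr// ltW.
have cj : continuous (fun r => (K2 r - K2 (r - d)) / d).
  have cs2 : continuous (fun x => K2 (x - d)) by exact: continuous_shift.
  move=> r; apply: cvgM; last exact: cvg_cst.
  by apply: cvgB; [exact: cK2|exact: (cs2 r)].
have ckd : continuous (fun r => ((K r - K (r - d)) / d) ^+ 2).
  move=> r; apply: (@continuous_comp _ _ _ (fun r => (K r - K (r - d)) / d) (fun y : R => y ^+ 2)); last exact: exprn_continuous.
  have cs1 : continuous (fun x => K (x - d)) by exact: continuous_shift.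
  apply: cvgM; last exact: cvg_cst.
  by apply: cvgB; [exact: cK|exact: (cs1 r)].
apply: (@le_trans _ _ (\int[leb]_(r in `[al, be + d]) ((K2 r - K2 (r - d)) / d))).
  by apply: le_Rintegral => //; exact: continuous_integrable.
have d3 r : is_derive r (1 : R) (fun r => (K3 r - K3 (r - d)) / d) ((K2 r - K2 (r - d)) / d).
  have h1 := dK3 r; have h2 : is_derive r (1 : R) (fun x => K3 (x - d)) (K2 (r - d)) by exact: is_derive_shift.
  by apply: is_derive_eq; rewrite /GRing.scale/=; ring.
rewrite (Rintegral_FTC bed (fun x _ _ => d3 x)); last exact: continuous_subspaceT.
rewrite (Rintegral_FTC albe (fun x _ _ => dK2 x)); last exact: continuous_subspaceT.
have K2c (x y : R) : x <= y -> (y <= al \/ be <= x) -> K2 x = K2 y.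
  move=> xy h; apply: (antiderivative_cst xy dK2 ck2) => z xz zy.
  case: h => h; first by rewrite ka ?expr0n// (le_trans zy).
  by rewrite kb ?expr0n// (le_trans h).
have K3c (x y : R) : x <= y -> (y <= al \/ be <= x) -> K3 y - K3 x = K2 x * (y - x).
  move=> xy h.
  have cx : continuous (fun z => K2 z - K2 x) by move=> z; apply: cvgB; [exact: cK2|exact: cvg_cst].
  have dx z : is_derive z (1 : R) (fun z => K3 z - K2 x * z) (K2 z - K2 x).
    have h1 := dK3 z; by apply: is_derive_eq; rewrite /GRing.scale/= mulr1.
  have := antiderivative_cst xy dx cx.
  move=> /(_ _)/eqP; rewrite subr_eq => E.
  have z0 z : x <= z -> z <= y -> K2 z - K2 x = 0.
    move=> xz zy; rewrite (K2c x z xz) ?subrr//.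
    by case: h => h; [left; exact: le_trans zy h|right].
  move: (E z0) => /eqP->; ring.
have -> : al - d = al + - d by [].
have e1 : K3 (be + d) - K3 (be + d - d) = K2 be * d.
  rewrite addrK K3c; [by rewrite addrAC subrr add0r|by rewrite lerDl ltW|by right].
have e2 : K3 al - K3 (al + - d) = K2 al * d.
  rewrite K3c; [|by rewrite gerBl ltW|by left].
  rewrite (K2c (al - d) al) ?gerBl ?(ltW d0)//; [|by left].
  by rewrite opprB addrCA subrr addr0.
by rewrite e1 e2 !mulfK.
Qed.

(** Testing with the average of kappa moves the difference quotient from kappa
to Y = W - V; this is integration by parts for the averaged test function. *)
Lemma steklov_test (psi0 : R -> R) g (W e V kappa : R -> R) (al be d : R) :
  in_H1 (radial psi0) g -> continuous W ->
  {ae leb, forall r : R, 0 <= r -> W r = r * psi0 r} ->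
  0 < al -> al <= be -> 0 < d ->
  continuous e -> (forall r, al <= r -> e r = W r / r) ->
  (forall x, is_derive x (1 : R) V (e x)) ->
  continuous kappa -> (forall r, r <= al -> kappa r = 0) -> (forall r, be <= r -> kappa r = 0) ->
  sphere_area R * \int[leb]_(r in `[al, be])
     (- (((W (r + d) - V (r + d)) - (W r - V r)) / d * kappa r)) <=
  (\sum_(i < 3) fine (sqL2 (g i)) +
   sphere_area R * \int[leb]_(r in `[al, be]) (kappa r ^+ 2)) / 2.
Proof.
move=> Hf cW WE al0 albe d0 ce eE dV ck ka kb.
have dn0 : d != 0 by rewrite gt_eqF.
have [K dK] := exists_antiderivative ck.
have cK : continuous K by move=> r; exact: (is_derive_continuous (dK r)).
have cV : continuous V by move=> r; exact: (is_derive_continuous (dV r)).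
have Kc (x y : R) : x <= y -> (y <= al \/ be <= x) -> K x = K y.
  move=> xy h; apply: (antiderivative_cst xy dK ck) => z xz zy.
  by case: h => h; [rewrite ka// (le_trans zy)|rewrite kb// (le_trans h)].
pose k (r : R) : R := (K r - K (r - d)) / d.
pose k' (r : R) : R := (kappa r - kappa (r - d)) / d.
have cKd : continuous (fun x => K (x - d)) by exact: continuous_shift.
have ckd : continuous (fun x => kappa (x - d)) by exact: continuous_shift.
have dk (r : R) : is_derive r (1 : R) k (k' r).
  have h1 := dK r.
  have h2 : is_derive r (1 : R) (fun x => K (x - d)) (kappa (r - d)) by exact: is_derive_shift.
  by rewrite /k; apply: is_derive_eq; rewrite /GRing.scale/= /k'; ring.
have ck0 : continuous k by move=> r; exact: (is_derive_continuous (dk r)).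
have ck' : continuous k'.
  move=> r; apply: cvgM; last exact: cvg_cst.
  by apply: cvgB; [exact: ck|exact: ckd].
have k_al r : r <= al -> k r = 0.
  move=> ra; rewrite /k (Kc (r - d) r) ?subrr ?mul0r//; last by left.
  by rewrite gerBl ltW.
have k_be r : be + d <= r -> k r = 0.
  move=> br; rewrite /k (Kc (r - d) r) ?subrr ?mul0r//; last by right; rewrite lerBrDr.
  by rewrite gerBl ltW.
have k0a r : r < al -> k r = 0 /\ k' r = 0.
  move=> ra; split; first by rewrite k_al// ltW.
  by rewrite /k' !ka ?subrr ?mul0r//; [rewrite lerBlDr ler_wpDr// ltW|exact: ltW].
have k0b r : be + d < r -> k r = 0 /\ k' r = 0.
  move=> br; split; first by rewrite k_be// ltW.
  rewrite /k' !kb ?subrr ?mul0r//; first by rewrite lerBrDr ltW.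
  by apply: le_trans (ltW br); rewrite lerDl ltW.
have bed : al <= be + d by rewrite ler_wpDr// ltW.
have := radial_gradient_test Hf cW WE al0 bed (fun r _ => dk r) ck0 ck' k0a k0b.
pose Y (r : R) : R := W r - V r.
have cY : continuous Y by move=> r; apply: cvgB; [exact: cW|exact: cV].
have cYd : continuous (fun r => Y (r + d)) by exact: continuous_shift.
have cL : continuous (fun r => Y r * kappa r) by move=> r; apply: cvgM; [exact: cY|exact: ck].
have cL2 : continuous (fun r => Y (r + d) * kappa r) by move=> r; apply: cvgM; [exact: cYd|exact: ck].
have [L dL] := exists_antiderivative cL.
have [L2 dL2] := exists_antiderivative cL2.
have E1 : \int[leb]_(r in `[al, be + d]) (W r * (k' r + k r / r)) =
    \int[leb]_(r in `[al, be]) (- (((W (r + d) - V (r + d)) - (W r - V r)) / d * kappa r)).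
  have dM (r : R) : al <= r -> is_derive r (1 : R)
      (fun r => V r * k r + (L r - L2 (r - d)) / d) (W r * (k' r + k r / r)).
    move=> ar; have h1 := dV r; have h2 := dk r; have h3 := dL r.
    have h4 : is_derive r (1 : R) (fun x => L2 (x - d)) (Y (r - d + d) * kappa (r - d)).
      exact: (is_derive_shift (F := L2) (f := fun r => Y (r + d) * kappa r)).
    apply: is_derive_eq; rewrite /GRing.scale/= eE// subrK /k' /Y; field.
    by rewrite dn0 gt_eqF// (lt_le_trans al0).
  rewrite (Rintegral_FTC bed (fun x h _ => dM x h)); last first.
    apply: continuous_in_subspaceT => r; rewrite inE/= in_itv/= => /andP[ar _].
    apply: cvgM; first exact: cW.
    apply: cvgD; first exact: ck'.
    by apply: cvgM; [exact: ck0|apply: continuous_invr; rewrite gt_eqF// (lt_le_trans al0)].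
  have dN (r : R) : is_derive r (1 : R) (fun r => (L r - L2 r) / d)
      (- (((W (r + d) - V (r + d)) - (W r - V r)) / d * kappa r)).
    have h1 := dL r; have h2 := dL2 r.
    by apply: is_derive_eq; rewrite /GRing.scale/= /Y; field.
  rewrite (Rintegral_FTC albe (fun x _ _ => dN x)); last first.
    apply: continuous_subspaceT => r; apply: cvgN; apply: cvgM; last exact: ck.
    by apply: cvgM; [apply: cvgB; [exact: cYd|exact: cY]|exact: cvg_cst].
  rewrite k_be// k_al// !mulr0 !add0r addrK.
  have -> : L (be + d) = L be.
    apply/esym/(antiderivative_cst _ dL cL); first by rewrite lerDl ltW.
    by move=> x bx _; rewrite kb ?mulr0.
  have -> : L2 (al - d) = L2 al.
    apply: (antiderivative_cst _ dL2 cL2); first by rewrite gerBl ltW.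
    by move=> x _ xa; rewrite ka ?mulr0.
  by field.
rewrite E1 => /le_trans; apply.
rewrite ler_pM2r ?invr_gt0// lerD2l ler_pM2l ?sphere_area_gt0//.
exact: steklov_contraction.
Qed.

Lemma Rintegral_subset (f : R -> R) (a b al be : R) : continuous f ->
  (forall r, 0 <= f r) -> al <= a -> b <= be ->
  \int[leb]_(r in `[a, b]) f r <= \int[leb]_(r in `[al, be]) f r.
Proof.
move=> cf f0 ala bbe; apply: fine_le.
- exact/integrable_fin_num/continuous_integrable.
- exact/integrable_fin_num/continuous_integrable.
- apply: ge0_subset_integral => //.
  + by apply/measurable_EFinP; exact: measurable_funTS (continuous_measurable_fun cf).
  + by move=> r _; rewrite lee_fin.
  + by move=> r /=; rewrite !in_itv/= => /andP[ar rb]; rewrite (le_trans ala)// (le_trans rb).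
Qed.

(** Duality: the test function kappa is the difference quotient itself, cut
off to a compact subset of the open half line. *)
Lemma steklov_quotient (psi0 : R -> R) g (W e V : R -> R) (a d : R) :
  in_H1 (radial psi0) g -> continuous W ->
  {ae leb, forall r : R, 0 <= r -> W r = r * psi0 r} ->
  0 < a -> a <= 2 -> 0 < d ->
  continuous e -> (forall r, a / 2 <= r -> e r = W r / r) ->
  (forall x, is_derive x (1 : R) V (e x)) ->
  sphere_area R * \int[leb]_(r in `[a, 2])
     ((((W (r + d) - V (r + d)) - (W r - V r)) / d) ^+ 2) <=
  \sum_(i < 3) fine (sqL2 (g i)).
Proof.
move=> Hf cW WE a0 a2 d0 ce eE dV.
have cV : continuous V by move=> r; exact: (is_derive_continuous (dV r)).
pose Y (r : R) : R := W r - V r.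
have cY : continuous Y by move=> r; apply: cvgB; [exact: cW|exact: cV].
have cYd : continuous (fun r => Y (r + d)) by exact: continuous_shift.
pose tau (r : R) : R := (Y (r + d) - Y r) / d.
have ctau : continuous tau.
  move=> r; apply: cvgM; last exact: cvg_cst.
  by apply: cvgB; [exact: cYd|exact: cY].
pose ramp (r : R) : R := Num.min (2 / a * (r - a / 2)) (3 - r).
pose theta (r : R) : R := Num.max 0 (Num.min 1 (ramp r)).
have cramp : continuous ramp.
  apply: continuous_minr => r.
    by apply: cvgM; [exact: cvg_cst|apply: cvgB; [exact: cvg_id|exact: cvg_cst]].
  by apply: cvgB; [exact: cvg_cst|exact: cvg_id].
have ctheta : continuous theta.
  apply: continuous_maxr; first exact: cst_continuous.
  by apply: continuous_minr => //; exact: cst_continuous.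
have th0 r : 0 <= theta r by rewrite /theta le_max lexx.
have th1 r : theta r <= 1 by rewrite /theta ge_max ler01 ge_min lexx.
have tha r : r <= a / 2 -> theta r = 0.
  move=> ra; apply/eqP; rewrite eq_le th0 andbT /theta ge_max lexx ge_min /ramp ge_min.
  by rewrite mulr_ge0_le0 ?orbT ?subr_le0// divr_ge0// ltW.
have thb r : 3 <= r -> theta r = 0.
  move=> rb; apply/eqP; rewrite eq_le th0 andbT /theta ge_max lexx ge_min /ramp ge_min.
  by rewrite [3 - r <= 0]subr_le0 rb !orbT.
have thm r : a <= r -> r <= 2 -> theta r = 1.
  move=> ar rb; apply/eqP; rewrite eq_le th1 /theta le_max; apply/orP; right.
  rewrite le_min lexx /ramp le_min /=; apply/andP; split; last slra.
  rewrite -(@ler_pM2l _ (a / 2)) ?divr_gt0// mulr1 mulrA.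
  have -> : a / 2 * (2 / a) = 1 by field; rewrite gt_eqF.
  by rewrite mul1r; slra.
pose kappa (r : R) : R := - (tau r * theta r).
have ckappa : continuous kappa by move=> r; apply: cvgN; apply: cvgM; [exact: ctau|exact: ctheta].
have ka r : r <= a / 2 -> kappa r = 0 by move=> h; rewrite /kappa tha// mulr0 oppr0.
have kb r : 3 <= r -> kappa r = 0 by move=> h; rewrite /kappa thb// mulr0 oppr0.
have a20 : 0 < a / 2 by rewrite divr_gt0.
have a23 : a / 2 <= 3 by slra.
have := steklov_test Hf cW WE a20 a23 d0 ce eE dV ckappa ka kb.
have ctt : continuous (fun r => tau r ^+ 2 * theta r).
  move=> r; apply: cvgM; last exact: ctheta.
  by apply: (@continuous_comp _ _ _ tau (fun y : R => y ^+ 2)); [exact: ctau|exact: exprn_continuous].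
have ck2 : continuous (fun r => kappa r ^+ 2).
  by move=> r; apply: (@continuous_comp _ _ _ kappa (fun y : R => y ^+ 2)); [exact: ckappa|exact: exprn_continuous].
have E : \int[leb]_(r in `[a / 2, 3]) (- (((W (r + d) - V (r + d)) - (W r - V r)) / d * kappa r)) =
    \int[leb]_(r in `[a / 2, 3]) (tau r ^+ 2 * theta r).
  by apply: eq_Rintegral => r _; rewrite /kappa /tau /Y; ring.
rewrite {}E.
have le1 : \int[leb]_(r in `[a / 2, 3]) (kappa r ^+ 2) <=
    \int[leb]_(r in `[a / 2, 3]) (tau r ^+ 2 * theta r).
  apply: le_Rintegral => //; [exact: continuous_integrable|exact: continuous_integrable|].
  move=> r _; rewrite /kappa sqrrN exprMn ler_wpM2l ?sqr_ge0//.
  by rewrite expr2 ler_piMl.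
have le2 : \int[leb]_(r in `[a, 2]) (tau r ^+ 2) <= \int[leb]_(r in `[a / 2, 3]) (tau r ^+ 2 * theta r).
  have -> : \int[leb]_(r in `[a, 2]) (tau r ^+ 2) = \int[leb]_(r in `[a, 2]) (tau r ^+ 2 * theta r).
    apply: eq_Rintegral => r; rewrite inE/= in_itv/= => /andP[ar rb].
    by rewrite thm// mulr1.
  apply: Rintegral_subset => //; [|slra|slra].
  by move=> r; rewrite mulr_ge0// sqr_ge0.
have A0 := sphere_area_gt0 R.
have conclude (N J K T A : R) : 0 < A -> K <= J -> T <= J -> A * J <= (N + A * K) / 2 -> A * T <= N.
  move=> A1; rewrite -(ler_pM2l A1) => h1; rewrite -(ler_pM2l A1) => h2 h3.
  by clear -h1 h2 h3; slra.
exact: (conclude _ _ _ _ _ A0 le1 le2).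
Qed.

(** Since W' = Y' + W / r and (W^2 / r)' = W'^2 - (W' - W / r)^2, the boundary
term of an average vanishing at 2 has a favourable sign. *)
Lemma steklov_derivative (psi0 : R -> R) g (W : R -> R) (a d S : R) :
  in_H1 (radial psi0) g -> continuous W ->
  {ae leb, forall r : R, 0 <= r -> W r = r * psi0 r} ->
  0 < a -> a <= 2 -> 0 < d -> (forall r, 1 <= r -> W r = 0) -> (forall r, 0 <= r -> `|W r| <= S) ->
  sphere_area R * \int[leb]_(r in `[a, 2]) (((W (r + d) - W r) / d) ^+ 2) <=
  2 * \sum_(i < 3) fine (sqL2 (g i)) + sphere_area R * (4 * (S * d / a ^+ 2) ^+ 2).
Proof.
move=> Hf cW WE a0 a2 d0 W1 WS.
have dn0 : d != 0 by rewrite gt_eqF.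
have S0 : 0 <= S by apply: le_trans (WS 0 (lexx 0)).
pose e (r : R) : R := W r / Num.max r (a / 2).
have a20 : 0 < a / 2 by rewrite divr_gt0.
have ce : continuous e.
  move=> r; apply: cvgM; first exact: cW.
  apply: cvgV; first by rewrite gt_eqF// lt_max a20 orbT.
  have cm : continuous (fun x : R => Num.max x (a / 2)).
    by apply: continuous_maxr; [move=> x; exact: cvg_id|exact: cst_continuous].
  exact: cm.
have eE r : a / 2 <= r -> e r = W r / r by move=> ar; rewrite /e (max_idPl ar).
have [V dV] := exists_antiderivative ce.
have := steklov_quotient Hf cW WE a0 a2 d0 ce eE dV.
have [Om dOm] := exists_antiderivative cW.
have cOm : continuous Om by move=> r; exact: (is_derive_continuous (dOm r)).
have cV : continuous V by move=> r; exact: (is_derive_continuous (dV r)).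
have cWd : continuous (fun r => W (r + d)) by exact: continuous_shift.
have cVd : continuous (fun r => V (r + d)) by exact: continuous_shift.
have cOd : continuous (fun r => Om (r + d)) by exact: continuous_shift.
pose Wd (r : R) : R := (Om (r + d) - Om r) / d.
pose h (r : R) : R := (W (r + d) - W r) / d.
pose tau (r : R) : R := ((W (r + d) - V (r + d)) - (W r - V r)) / d.
have ch : continuous h.
  by move=> r; apply: cvgM; [apply: cvgB; [exact: cWd|exact: cW]|exact: cvg_cst].
have cWd' : continuous Wd.
  by move=> r; apply: cvgM; [apply: cvgB; [exact: cOd|exact: cOm]|exact: cvg_cst].
have ctau : continuous tau.
  move=> r; apply: cvgM; last exact: cvg_cst.
  apply: cvgB; last by apply: cvgB; [exact: cW|exact: cV].
  by apply: cvgB; [exact: cWd|exact: cVd].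
have dWd (r : R) : is_derive r (1 : R) Wd (h r).
  have h1 := dOm r.
  have h2 : is_derive r (1 : R) (fun x => Om (x + d)) (W (r + d)) by exact: is_derive_shift.
  by rewrite /Wd; apply: is_derive_eq; rewrite /GRing.scale/= /h; ring.
have avg r : a <= r -> `|h r - Wd r / r - tau r| <= S * d / a ^+ 2.
  move=> ar; have r0 : 0 < r by exact: lt_le_trans ar.
  have rd : r <= r + d by rewrite lerDl ltW.
  pose w (y : R) : R := e y - W y / r.
  have cw : continuous w.
    by move=> y; apply: cvgB; [exact: ce|apply: cvgM; [exact: cW|exact: cvg_cst]].
  have dw (y : R) : is_derive y (1 : R) (fun y => V y - Om y / r) (w y).
    have h1 := dV y; have h2 := dOm y.
    by apply: is_derive_eq; rewrite /GRing.scale/= /w; ring.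
  have := Rintegral_cst_bound (K := S * d / a ^+ 2) rd cw.
  rewrite (Rintegral_FTC rd (fun y _ _ => dw y)); last exact: continuous_subspaceT.
  have -> : r + d - r = d by ring.
  have -> : V (r + d) - Om (r + d) / r - (V r - Om r / r) = (h r - Wd r / r - tau r) * d.
    by rewrite /h /Wd /tau; field; rewrite dn0 gt_eqF.
  rewrite normrM (gtr0_norm d0) ler_pM2r//; apply.
  move=> y ry yrd; have y0 : 0 < y by exact: lt_le_trans ry.
  have ay : a <= y by exact: le_trans ry.
  rewrite /w eE; last by slra.
  have -> : W y / y - W y / r = - (W y * ((y - r) / (y * r))).
    by field; rewrite !gt_eqF.
  have q0 : 0 <= (y - r) / (y * r) by rewrite divr_ge0 ?subr_ge0// mulr_ge0// ltW.
  rewrite normrN normrM (ger0_norm q0) -mulrA; apply: ler_pM => //; first by apply: WS; exact: ltW.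
  apply: ler_pM; rewrite ?subr_ge0// ?invr_ge0 ?mulr_ge0 ?(ltW y0) ?(ltW r0)//; first by slra.
  rewrite lef_pV2 ?posrE ?mulr_gt0 ?exprn_gt0// expr2.
  by apply: ler_pM => //; exact: ltW.
pose p (r : R) : R := (h r - Wd r / r) ^+ 2.
have dU (r : R) : a <= r -> is_derive r (1 : R) (fun r => Wd r ^+ 2 / r) (h r ^+ 2 - p r).
  move=> ar; have r0 : 0 < r by exact: lt_le_trans ar.
  have rn0 : r != 0 by rewrite gt_eqF.
  have h1 := dWd r; have h2 := is_derive_invr rn0.
  by apply: is_derive_eq; rewrite /GRing.scale/= /p; field.
have ch2 : continuous (fun r => h r ^+ 2).
  by move=> r; apply: (@continuous_comp _ _ _ h (fun y : R => y ^+ 2)); [exact: ch|exact: exprn_continuous].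
have ct2 : continuous (fun r => tau r ^+ 2).
  by move=> r; apply: (@continuous_comp _ _ _ tau (fun y : R => y ^+ 2)); [exact: ctau|exact: exprn_continuous].
have cp : {within `[a, 2], continuous p}.
  apply: continuous_in_subspaceT => r; rewrite inE/= in_itv/= => /andP[ar _].
  apply: (@continuous_comp _ _ _ (fun r => h r - Wd r / r) (fun y : R => y ^+ 2)); last exact: exprn_continuous.
  apply: cvgB; first exact: ch.
  by apply: cvgM; [exact: cWd'|apply: continuous_invr; rewrite gt_eqF// (lt_le_trans a0)].
have ip : leb.-integrable `[a, 2] (EFin \o p).
  by apply: continuous_compact_integrable => //; exact: segment_compact.
have ih : leb.-integrable `[a, 2] (EFin \o (fun r => h r ^+ 2)) by exact: continuous_integrable.
have hp : \int[leb]_(r in `[a, 2]) (h r ^+ 2) <= \int[leb]_(r in `[a, 2]) p r.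
  rewrite -subr_le0 -RintegralB// (Rintegral_FTC a2 (fun r ar _ => dU r ar)); last first.
    move=> r; apply: cvgB; last exact: cp.
    by have := @continuous_subspaceT _ _ `[a, 2] _ ch2; exact.
  have -> : Wd 2 = 0.
    rewrite /Wd (_ : Om (2 + d) = Om 2) ?subrr ?mul0r//.
    apply/esym/(antiderivative_cst _ dOm cW); first by rewrite lerDl ltW.
    by move=> x x2 _; apply: W1; slra.
  by rewrite expr0n mul0r sub0r oppr_le0 divr_ge0 ?sqr_ge0// ltW.
have A0 := sphere_area_gt0 R.
pose c := S * d / a ^+ 2.
have ple : \int[leb]_(r in `[a, 2]) p r <= \int[leb]_(r in `[a, 2]) (2 * tau r ^+ 2 + 2 * c ^+ 2).
  apply: le_Rintegral => //.
    apply: continuous_integrable => r; apply: cvgD; last exact: cvg_cst.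
    by apply: cvgM; [exact: cvg_cst|exact: ct2].
  move=> r /=; rewrite in_itv/= => /andP[ar _].
  have := avg r ar; rewrite /p -/c; set X := h r - Wd r / r => hX.
  have : (X - tau r) ^+ 2 <= c ^+ 2.
    rewrite -real_normK ?num_real// lerXn2r ?nnegrE//.
    exact: le_trans (normr_ge0 _) hX.
  move=> h1; have := sqr_ge0 (X - 2 * tau r); move: h1; clear; nra.
rewrite RintegralD// in ple; last 2 first.
- by apply: continuous_integrable => r; apply: cvgM; [exact: cvg_cst|exact: ct2].
- by apply: continuous_integrable => r; exact: cvg_cst.
rewrite RintegralZl// in ple; last exact: continuous_integrable.
have e2 : \int[leb]_(r in `[a, 2]) (2 * c ^+ 2) <= 2 * c ^+ 2 * 2.
  apply: (le_trans (ler_norm _)); apply: (le_trans (Rintegral_cst_bound a2 _ (K := 2 * c ^+ 2) _)).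
  - exact: cst_continuous.
  - by move=> x _ _; rewrite ger0_norm// mulr_ge0// sqr_ge0.
  - by apply: ler_wpM2l; [rewrite mulr_ge0 ?sqr_ge0|rewrite gerBl ltW].
move=> hN.
have le3 : \int[leb]_(r in `[a, 2]) (h r ^+ 2) <=
    2 * \int[leb]_(r in `[a, 2]) (tau r ^+ 2) + 4 * c ^+ 2.
  apply: (le_trans hp); apply: (le_trans ple); rewrite lerD2l (le_trans e2)//.
  by clear; slra.
rewrite -(ler_pM2l A0) in le3; apply: (le_trans le3).
rewrite mulrDr lerD2r mulrCA ler_pM2l//.
Qed.

Lemma primitive_is_derive (W dW : R -> R) (a b : R) : a < b ->
  primitive_on a b W dW ->
  {ae leb, forall x : R, a < x -> x < b -> is_derive x (1 : R) W (dW x)}.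
Proof.
move=> ab [idW WE].
pose f := dW \_ `[a, b].
have intf : leb.-integrable setT (EFin \o f).
  by move: idW; rewrite integrable_mkcond//= (restrict_EFin dW).
have locf : locally_integrable setT f.
  by apply: open_integrable_locally => //; exact: openT.
have intfy (y : R) : leb.-integrable [set` Interval (BLeft a) (BRight y)] (EFin \o f).
  exact: integrableS intf.
have := FTC1 intfy locf.
apply: filterS; first exact: (ae_filter_ringOfSetsType leb).
move=> x /= + ax xb; rewrite lte_fin => /(_ ax) [d1 d2].
have -> : dW x = f x by rewrite /f patchE mem_set//= in_itv/= !ltW.
apply: (@near_eq_is_derive _ _ _ (fun y => \int[leb]_(t in `[a, y]) f t + W a)).
  near=> y.
  have ay : a < y by near: y; exact: lt_nbhsr.
  have yb : y < b by near: y; exact: lt_nbhsl.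
  have -> : \int[leb]_(t in `[a, y]) f t = \int[leb]_(t in `[a, y]) dW t.
    apply: eq_Rintegral => t; rewrite inE/= in_itv/= => /andP[at_ ty].
    by rewrite /f patchE mem_set//= in_itv/= at_ (le_trans ty)// ltW.
  by rewrite -WE ?subrK// ltW.
have h1 : is_derive x (1 : R) (fun y : R => \int[leb]_(t in `[a, y]) f t) (f x).
  by rewrite -d2 derive1E; exact: derivableP.
by apply: is_derive_eq; rewrite addr0.
Unshelve. all: by end_near. Qed.

Lemma limn_einf_le_cst (u : nat -> \bar R) (C S : R) : 0 <= S ->
  (forall n, (u n <= (C + S / n.+1%:R)%:E)%E) -> (limn_einf u <= C%:E)%E.
Proof.
move=> S0 uC; rewrite limn_einf_lim; apply: lime_le; first exact: is_cvg_einfs.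
near=> n; apply/lee_addgt0Pr => e e0.
pose k := maxn n (Num.bound (S / e)).
apply: (@le_trans _ _ (u k)).
  by apply: ereal_inf_lbound; exists k => //=; rewrite /k leq_maxl.
apply: (le_trans (uC k)); rewrite -EFinD lee_fin lerD2l.
rewrite ler_pdivrMr// -ler_pdivrMl// mulrC.
have h : S / e < (Num.bound (S / e))%:R by apply: archi_boundP; rewrite divr_ge0// ltW.
by apply: (le_trans (ltW h)); rewrite ler_nat /k (leq_trans (leq_maxr n _)).
Unshelve. all: by end_near. Qed.

Lemma radial_derivative_L2 (psi0 : R -> R) g (W dW : R -> R) :
  in_H1 (radial psi0) g -> continuous W ->
  {ae leb, forall r : R, 0 <= r -> W r = r * psi0 r} ->
  (forall r, 1 <= r -> W r = 0) -> primitive_on 0 2 W dW ->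
  (\int[leb]_(r in `]0%R, 2%R[) (dW r ^+ 2)%:E <=
   (2 / sphere_area R * \sum_(i < 3) fine (sqL2 (g i)))%:E)%E.
Proof.
move=> Hf cW WE W1 pW.
have A0 := sphere_area_gt0 R.
have [S S0 WS] : exists2 S : R, 0 <= S & forall r, 0 <= r -> `|W r| <= S.
  have : compact (W @` `[0, 1]).
    apply: continuous_compact; first exact: continuous_subspaceT.
    exact: segment_compact.
  move=> /compact_bounded[N [Nr hN]]; exists `|N + 1| => // r r0.
  have [r1|r1] := leP r 1; last by rewrite W1 ?normr0// ltW.
  apply: le_trans (ler_norm _); apply: (hN (N + 1)); first by rewrite ltrDl.
  by exists r => //=; rewrite in_itv/= r0.
pose an (n : nat) : R := n.+1%:R^-1.
(* the window d leaves an error of order (S d / a^2)^2, which vanishes for d = a^3 *)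
pose dn (n : nat) : R := an n ^+ 3.
have an0 n : 0 < an n by rewrite invr_gt0.
have an1 n : an n <= 1 by rewrite invf_le1// ler1n.
have dn0 n : 0 < dn n by rewrite exprn_gt0.
pose q (n : nat) (r : R) : R := ((W (r + dn n) - W r) / dn n) ^+ 2.
have cq n : continuous (q n).
  move=> r; apply: (@continuous_comp _ _ _ (fun r => (W (r + dn n) - W r) / dn n) (fun y : R => y ^+ 2)); last exact: exprn_continuous.
  have cWd : continuous (fun r => W (r + dn n)) by exact: continuous_shift.
  by apply: cvgM; [apply: cvgB; [exact: cWd|exact: cW]|exact: cvg_cst].
pose fn (n : nat) (r : R) : \bar R := (q n r * \1_(`[an n, 2]%classic) r)%:E.
pose D : set R := `]0%R, 2%R[%classic.
have mD : measurable D by exact: measurable_itv.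
have mfn n : measurable_fun D (fn n).
  apply/measurable_EFinP; apply: measurable_funTS; apply: measurable_funM.
    exact: continuous_measurable_fun.
  exact: measurable_indic.
have fn0 n x : D x -> (0 <= fn n x)%E.
  by move=> _; rewrite lee_fin mulr_ge0// sqr_ge0.
have := fatou leb mD mfn fn0.
pose C : R := 2 / sphere_area R * \sum_(i < 3) fine (sqL2 (g i)).
have bound n : (\int[leb]_(x in D) fn n x <= (C + 4 * S ^+ 2 / n.+1%:R)%:E)%E.
  apply: (@le_trans _ _ (\int[leb]_(x in `[an n, 2%R]) (q n x)%:E)%E).
    rewrite integral_mkcond [leRHS]integral_mkcond.
    apply: ge0_le_integral => //.
    - by move=> x _; rewrite /patch; case: ifP => // /set_mem; exact: fn0.
    - exact: ((measurable_restrictT (fn n) mD).1 (mfn n)).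
    - apply/(measurable_restrictT _ _).1 => //; apply/measurable_EFinP; apply: measurable_funTS.
      exact: continuous_measurable_fun.
    - move=> x _; rewrite /patch /fn indicE; case: (x \in `[an n, 2]%classic); rewrite ?mulr1 ?mulr0.
        by case: ifP => // _; rewrite lee_fin sqr_ge0.
      by case: ifP.
  have an2 : an n <= 2 by apply: (le_trans (an1 n)); slra.
  have h := steklov_derivative Hf cW WE (an0 n) an2 (dn0 n) W1 WS.
  have iq : leb.-integrable `[an n, 2] (EFin \o q n) by exact: continuous_integrable.
  rewrite -(fineK (integrable_fin_num _ iq))//= lee_fin.
  move: h; rewrite -ler_pdivlMl// => /le_trans; apply.
  have -> : S * dn n / an n ^+ 2 = S * an n.
    by rewrite /dn; field; rewrite gt_eqF.
  rewrite exprMn.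
  have -> : (sphere_area R)^-1 * (2 * \sum_(i < 3) fine (sqL2 (g i)) +
      sphere_area R * (4 * (S ^+ 2 * an n ^+ 2))) = C + 4 * S ^+ 2 * an n ^+ 2.
    by rewrite /C; field; rewrite gt_eqF.
  rewrite lerD2l ler_wpM2l//; first by rewrite mulr_ge0 ?sqr_ge0.
  by rewrite expr2 ler_piMl// ltW.
have S4 : 0 <= 4 * S ^+ 2 by rewrite mulr_ge0 ?sqr_ge0.
move=> /le_trans /(_ (limn_einf_le_cst S4 bound)) => h; apply: le_trans h.
have mdW : measurable_fun D dW.
  have [/integrableP[/measurable_EFinP m _] _] := pW.
  by apply: measurable_funS m => // x /=; rewrite !in_itv/= => /andP[/ltW-> /ltW->].
rewrite le_eqVlt; apply/orP; left; apply/eqP; apply: ae_eq_integral => //.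
- by apply/measurable_EFinP; exact: measurable_funX.
- apply: (emeasurable_fun_cvg (fun n x => einfs (fn^~ x) n)).
  + by move=> n; exact: measurable_fun_einfs.
  + by move=> x _; rewrite limn_einf_lim; exact: is_cvg_einfs.
- have := primitive_is_derive (ltr0n _ 2) pW.
  apply: filterS; first exact: (ae_filter_ringOfSetsType leb).
  move=> x dWx; rewrite /D/= in_itv/= => /andP[x0 x2].
  have {dWx} dWx := dWx x0 x2.
  apply/esym; apply: (cvg_limn_einf_sup _).1.
  have can : an n @[n --> \oo] --> (0 : R) by exact: cvg_harmonic.
  apply/fine_cvgP; split; first exact: nearW.
  have cdn : dn n @[n --> \oo] --> (0 : R).
    have -> : (0 : R) = 0 * 0 * 0 by rewrite !mulr0.
    have -> : dn = (fun n => an n * an n * an n).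
      by apply/funext => n; rewrite /dn !exprS expr0 mulr1 mulrA.
    by apply: cvgM => //; apply: cvgM.
  have cquot : (W (x + dn n) - W x) / dn n @[n --> \oo] --> dW x.
    have [d1 <-] := dWx.
    have H := (cvgr_dnbhsP _ _ _).1 d1 dn.
    have -> : (fun n => (W (x + dn n) - W x) / dn n) =
        (fun n => (dn n)^-1 *: ((W \o shift x) (dn n *: 1) - W x)).
      by apply/funext => n /=; rewrite [_ *: 1]mulr1 (addrC x) [RHS]mulrC.
    by apply: H; split => // n; rewrite gt_eqF.
  apply: (@cvg_trans _ (q n x @[n --> \oo])).
    apply: near_eq_cvg; near=> n; rewrite /= /fn/= indicE mem_set ?mulr1//.
    rewrite /= in_itv/= (ltW x2) andbT; near: n.
    by apply: (cvgr_le _ can).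
  exact: (cvgM cquot cquot).
Unshelve. all: by end_near. Qed.

End steklov.

(** * Changes of variables and Fubini's theorem in the plane *)

Section affine.
Context (R : realType).
Local Notation leb := (@lebesgue_measure R).

Lemma ae_affine (al be : R) (P : R -> Prop) : be != 0 ->
  {ae leb, forall x, P x} -> {ae leb, forall x, P (al + be * x)}.
Proof.
move=> be0 [N [mN N0 PN]].
have mt : measurable_fun [set: R] (fun x : R => al + be * x).
  by apply: measurable_funD => //; exact: measurable_funM.
have mN' : measurable ((fun x : R => al + be * x) @^-1` N).
  by rewrite -[X in measurable X]setTI; exact: mt.
exists ((fun x : R => al + be * x) @^-1` N); split => //.
- pose A := (fun x : R => al + be * x) @^-1` N.
  have m1 : measurable_fun setT (fun x : R => (\1_N x)%:E : \bar R).
    by apply/measurable_EFinP; exact: measurable_indic.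
  have h := @ge0_integral_affine R al be (fun x => (\1_N x)%:E) be0 m1 (fun x => _).
  have {}h := h (fun x => ler0n _ _).
  transitivity (\int[leb]_x (\1_A x)%:E)%E; first by rewrite integral_indic// setIT.
  transitivity (\int[leb]_x (\1_N (al + be * x)%R)%:E)%E.
    by apply: eq_integral => x _; rewrite !indicE.
  rewrite h; transitivity ((`|be|^-1)%:E * leb N)%E; last by rewrite N0 mule0.
  by congr (_ * _)%E; rewrite integral_indic// setIT.
- by move=> x /= nP; exact: PN.
Qed.

Lemma integrable_affine (al be : R) (f : R -> R) : be != 0 ->
  leb.-integrable setT (EFin \o f) ->
  leb.-integrable setT (EFin \o (fun x => f (al + be * x))) /\
  \int[leb]_x f (al + be * x) = `|be|^-1 * \int[leb]_x f x.
Proof.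
move=> be0 /integrableP[mf fi].
have mt : measurable_fun [set: R] (fun x : R => al + be * x).
  by apply: measurable_funD => //; exact: measurable_funM.
have mf' : measurable_fun setT (fun x : R => (f (al + be * x))%:E).
  exact: (measurableT_comp mf).
have int : leb.-integrable setT (EFin \o (fun x => f (al + be * x))).
  apply/integrableP; split => //.
  rewrite (@ge0_integral_affine R al be (fun x => `|(f x)%:E|%E))//; last exact: measurableT_comp.
  by rewrite lte_mul_pinfty// lee_fin invr_ge0.
split => //.
rewrite /Rintegral.
have iF : leb.-integrable setT (EFin \o f) by apply/integrableP.
rewrite -[RHS]/(fine (`|be|^-1 * fine (\int[leb]_x (f x)%:E)%E)%:E) EFinM fineK; last first.
  exact: integrable_fin_num.
congr fine; rewrite integralE [X in (_ * X)%E]integralE.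
have E1 := @ge0_integral_affine R al be ((EFin \o f)^\+)%E be0 (measurable_funepos mf) (fun x => funepos_ge0 _ x).
have E2 := @ge0_integral_affine R al be ((EFin \o f)^\-)%E be0 (measurable_funeneg mf) (fun x => funeneg_ge0 _ x).
rewrite muleBr//; last first.
  by apply: fin_num_adde_defl; rewrite fin_numN; exact: integrable_neg_fin_num.
rewrite -E1 -E2; congr (_ - _)%E; apply: eq_integral => x _.
  by rewrite !funeposE.
by rewrite !funenegE.
Qed.

Lemma Rintegral_affine_itv (al be c d : R) (f : R -> R) : 0 < be ->
  leb.-integrable `[al + be * c, al + be * d] (EFin \o f) ->
  leb.-integrable `[c, d] (EFin \o (fun x => f (al + be * x))) /\
  \int[leb]_(x in `[c, d]) f (al + be * x) = be^-1 * \int[leb]_(x in `[al + be * c, al + be * d]) f x.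
Proof.
move=> be0 iF.
have be0' : be != 0 by rewrite gt_eqF.
pose F := f \_ `[al + be * c, al + be * d].
have iF' : leb.-integrable setT (EFin \o F).
  by move: iF; rewrite integrable_mkcond//= (restrict_EFin f).
have [i1 E1] := integrable_affine al be0' iF'.
have FE : (fun x => F (al + be * x)) = (fun x => f (al + be * x)) \_ `[c, d].
  apply/funext => x; rewrite /F !patchE !mem_setE !in_itv/= lerD2l ler_pM2l// lerD2l ler_pM2l//.
rewrite FE in i1 E1; split.
  by move: i1; rewrite -restrict_EFin -integrable_mkcond.
by rewrite Rintegral_mkcond E1 (gtr0_norm be0) [in RHS]Rintegral_mkcond.
Qed.

End affine.

Section planar.
Context (R : realType).
Local Notation leb := (@lebesgue_measure R).

Lemma open_plane_measurable (U : set (R * R)) : open U -> measurable U.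
Proof.
move=> oU.
pose box (q : rat * rat * (rat * rat)) : set (R * R) :=
  `](ratr q.1.1 : R), (ratr q.1.2 : R)[%classic `*` `](ratr q.2.1 : R), (ratr q.2.2 : R)[%classic.
pose F q := if `[< box q `<=` U >] then box q else set0.
have -> : U = \bigcup_q F q.
  apply/seteqP; split => [p Up|p [q _]]; last first.
    by rewrite /F; case: asboolP => // h; exact: h.
  have : nbhs p U by exact: open_nbhs_nbhs.
  move=> [[A B] /= [/nbhs_ballP[e1 /= e10 A1] /nbhs_ballP[e2 /= e20 B2]] AB].
  have /rat_in_itvoo[a1 /itvP ha1] : p.1 - e1 < p.1 by rewrite gtrBl.
  have /rat_in_itvoo[b1 /itvP hb1] : p.1 < p.1 + e1 by rewrite ltrDl.
  have /rat_in_itvoo[a2 /itvP ha2] : p.2 - e2 < p.2 by rewrite gtrBl.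
  have /rat_in_itvoo[b2 /itvP hb2] : p.2 < p.2 + e2 by rewrite ltrDl.
  have bU : box ((a1, b1), (a2, b2)) `<=` U.
    move=> -[x y] [/=]; rewrite !in_itv/= => /andP[x1 x2] /andP[y1 y2].
    apply: (AB (x, y)); split => /=.
      apply: A1; rewrite /ball/= ltr_distlC; apply/andP; split.
        by apply: lt_trans x1; rewrite ha1.
      by apply: (lt_trans x2); rewrite hb1.
    apply: B2; rewrite /ball/= ltr_distlC; apply/andP; split.
      by apply: lt_trans y1; rewrite ha2.
    by apply: (lt_trans y2); rewrite hb2.
  exists ((a1, b1), (a2, b2)) => //; rewrite /F asboolT//.
  by split; rewrite /= in_itv/= ?ha1 ?hb1 ?ha2 ?hb2.
apply: countable_bigcupT_measurable; first exact: countableP.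
move=> q; rewrite /F; case: asboolP => // _.
exact: measurableX.
Qed.

Lemma continuous_plane_measurable (f : R * R -> R) : continuous f -> measurable_fun setT f.
Proof.
move=> cf; apply: (measurability _ (RGenOInfty.measurableE R)) => //.
move=> _ [_ [a ->] <-]; rewrite setTI; apply: open_plane_measurable.
by apply: open_comp.
Qed.

End planar.

Lemma measurable_triangle (R : realType) (c d : R) :
  measurable [set p : R * R | [/\ p.1 <= d, p.2 <= c & 2 <= p.1 + p.2]].
Proof.
have m1 : measurable_fun [set: R * R] (fun x => x.1) by exact: measurable_fst.
have m2 : measurable_fun [set: R * R] (fun x => x.2) by exact: measurable_snd.
rewrite [X in measurable X](_ : _ = ([set: R * R] `&` [set p | p.1 <= d]) `&` (([set: R * R] `&` [set p | p.2 <= c]) `&` ([set: R * R] `&` [set p | 2 <= p.1 + p.2]))).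
  apply: measurableI; first exact: measurable_fun_le.
  apply: measurableI; first exact: measurable_fun_le.
  by apply: measurable_fun_le => //; exact: measurable_funD.
by rewrite !setTI; apply/seteqP; split => p /=; [move=> [h1 h2 h3]; split => //; split => //|by move=> [h1 [h2 h3]]].
Qed.

Section fubini.
Context (R : realType).
Local Notation leb := (@lebesgue_measure R).

Lemma integrable_fine (F : R -> \bar R) : leb.-integrable setT F ->
  leb.-integrable setT (EFin \o (fine \o F)) /\
  (\int[leb]_x F x = \int[leb]_x (fine (F x))%:E)%E.
Proof.
move=> iF; have mF := measurable_int _ iF.
have mfF : measurable_fun setT (EFin \o (fine \o F)).
  by apply/measurable_EFinP; apply: measurableT_comp.
have leF x : (`|(EFin \o (fine \o F)) x| <= `|F x|)%E.
  by rewrite /=; case: (F x) => [r| |]//=; rewrite normr0 ?leey.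
split; first exact: le_integrable iF.
apply: ae_eq_integral => //.
have H : {ae leb, forall x, setT x -> F x \is a fin_num} by exact: (integrable_ae measurableT iF).
suff : {ae leb, forall x, setT x -> F x = (fine (F x))%:E} by [].
move: H; apply: filterS; first exact: (ae_filter_ringOfSetsType leb).
by move=> x /(_ I) fx _ /=; rewrite fineK.
Qed.

Lemma Rintegral_fubini (K : R * R -> R) : (@leb2 R).-integrable setT (EFin \o K) ->
  [/\ leb.-integrable setT (EFin \o (fun x => \int[leb]_y K (x, y))),
      leb.-integrable setT (EFin \o (fun y => \int[leb]_x K (x, y))) &
      \int[leb]_x \int[leb]_y K (x, y) = \int[leb]_y \int[leb]_x K (x, y)].
Proof.
move=> iK.
have [i1 e1] := integrable_fine (integrable_fubini_F iK).
have mK := measurable_int _ iK.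
have iG : leb.-integrable setT (fubini_G leb (EFin \o K)).
  apply/integrableP; split; first exact: (measurable_fubini_G iK).
  have h21 : (\int[leb]_y \int[leb]_x `|(EFin \o K) (x, y)| < +oo)%E.
    by have := (@integrable21ltyP _ _ _ _ _ leb leb _ mK).1; apply.
  apply: le_lt_trans h21.
  apply: ge0_le_integral => //.
  - by apply: measurableT_comp => //; exact: (measurable_fubini_G iK).
  - apply: (@measurable_fun_fubini_tonelli_G _ _ _ _ _ leb (abse \o (EFin \o K))).
      exact: measurableT_comp.
    by move=> z; exact: abse_ge0.
  - move=> y _; apply: le_abse_integral => //.
    exact: (measurableT_comp mK).
have [i2 e2] := integrable_fine iG.
split; [exact: i1|exact: i2|].
rewrite {1 3}/Rintegral; congr fine.
by have := Fubini iK; rewrite -/(fubini_F _ _) -/(fubini_G _ _) e1 e2.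
Qed.

(** Fubini on the triangle cut out by the initial line x + y = 2, whose
vertical and horizontal sections both start on that line. *)
Lemma triangle_fubini (H : R -> R -> R) (c d : R) :
  (@leb2 R).-integrable [set p : R * R | [/\ p.1 <= d, p.2 <= c & 2 <= p.1 + p.2]]
     (fun p => (H p.1 p.2)%:E) ->
  let J1 z := \int[leb]_(y in `[2 - z, c]) H z y in
  let J2 y := \int[leb]_(z in `[2 - y, d]) H z y in
  [/\ leb.-integrable `[2 - c, d] (EFin \o J1), leb.-integrable `[2 - d, c] (EFin \o J2) &
      \int[leb]_(z in `[2 - c, d]) J1 z = \int[leb]_(y in `[2 - d, c]) J2 y].
Proof.
set T := [set p : R * R | _].
pose K := (fun p : R * R => H p.1 p.2) \_ T.
have E1 : (fun x => \int[leb]_y K (x, y)) = (fun z => \int[leb]_(y in `[2 - z, c]) H z y) \_ `[2 - c, d].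
  apply/funext => x; rewrite patchE mem_setE in_itv/=.
  case: ifPn => [/andP[cx xd]|ncd].
    rewrite /= [RHS]Rintegral_mkcond; apply: eq_Rintegral => y _; rewrite /K !patchE.
    congr (if _ then _ else _); apply/idP/idP; rewrite !inE/= in_itv/=.
      by move=> [/= _ yc h]; rewrite yc andbT lerBlDl.
    by move=> /andP[h yc]; split => //=; rewrite -lerBlDl.
  rewrite (_ : (fun y => K (x, y)) = cst 0) ?Rintegral_cst ?mul0r//.
  apply/funext => y; rewrite /K patchE; case: ifPn => // /set_mem [/= xd yc xy].
  by move: ncd; rewrite xd andbT lerBlDr (le_trans xy)// lerD2l.
have E2 : (fun y => \int[leb]_x K (x, y)) = (fun y => \int[leb]_(z in `[2 - y, d]) H z y) \_ `[2 - d, c].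
  apply/funext => y; rewrite patchE mem_setE in_itv/=.
  case: ifPn => [/andP[cx xd]|ncd].
    rewrite /= [RHS]Rintegral_mkcond; apply: eq_Rintegral => x _; rewrite /K !patchE.
    congr (if _ then _ else _); apply/idP/idP; rewrite !inE/= in_itv/=.
      by move=> [/= yc _ h]; rewrite yc andbT lerBlDr.
    by move=> /andP[h yc]; split => //=; rewrite -lerBlDr.
  rewrite (_ : (fun x => K (x, y)) = cst 0) ?Rintegral_cst ?mul0r//.
  apply/funext => x; rewrite /K patchE; case: ifPn => // /set_mem [/= xd yc xy].
  by move: ncd; rewrite yc andbT lerBlDl (le_trans xy)// lerD2r.
move=> iH J1 J2.
have mT : measurable T by exact: measurable_triangle.
have iK : (@leb2 R).-integrable setT (EFin \o K).
  by move: iH; rewrite integrable_mkcond//= (restrict_EFin (fun p : R * R => H p.1 p.2)).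
have [i1 i2 E] := Rintegral_fubini iK.
rewrite E1 in i1 E; rewrite E2 in i2 E; split.
- by move: i1; rewrite -restrict_EFin -integrable_mkcond.
- by move: i2; rewrite -restrict_EFin -integrable_mkcond.
- by rewrite Rintegral_mkcond E [RHS]Rintegral_mkcond.
Qed.

End fubini.

(** * Traces on the initial line *)

Section cauchy_schwarz.
Context (d : measure_display) (T : measurableType d) (R : realType).
Variable m : {measure set T -> \bar R}.

(** Weighted arithmetic-geometric mean inequality, with the weights tuned to
the bounds on the two norms; [e] keeps these weights finite. *)
Lemma cauchy_schwarz (D : set T) (f g : T -> R) (N J : R) : measurable D ->
  measurable_fun D f -> measurable_fun D g -> 0 <= N -> 0 <= J ->
  (\int[m]_(x in D) (f x ^+ 2)%:E <= (N ^+ 2)%:E)%E ->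
  (\int[m]_(x in D) (g x ^+ 2)%:E <= (J ^+ 2)%:E)%E ->
  (\int[m]_(x in D) `|f x * g x|%:E <= (N * J)%:E)%E.
Proof.
move=> mD mf mg N0 J0 fN gJ.
have key (e : R) : 0 < e ->
    (\int[m]_(x in D) `|f x * g x|%:E <= ((N + e) * (J + e))%:E)%E.
  move=> e0.
  have n0 : 0 < N + e by rewrite ltr_wpDl.
  have j0 : 0 < J + e by rewrite ltr_wpDl.
  pose al := (J + e) / (2 * (N + e)); pose be := (N + e) / (2 * (J + e)).
  have al0 : 0 <= al by rewrite divr_ge0 ?mulr_ge0 ?ltW.
  have be0 : 0 <= be by rewrite divr_ge0 ?mulr_ge0 ?ltW.
  apply: (@le_trans _ _ (\int[m]_(x in D) (al%:E * (f x ^+ 2)%:E + be%:E * (g x ^+ 2)%:E))%E).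
    apply: ge0_le_integral => //.
    - by apply/measurable_EFinP; apply: measurableT_comp => //; exact: measurable_funM.
    - apply: emeasurable_funD; apply: measurable_funeM; apply/measurable_EFinP;
      exact: measurable_funX.
    - move=> x _; rewrite -!EFinM -EFinD lee_fin normrM -(real_normK (num_real (f x))) -(real_normK (num_real (g x))).
      have -> : al * `|f x| ^+ 2 + be * `|g x| ^+ 2 = `|f x| * `|g x|
          + (`|f x| * (J + e) - `|g x| * (N + e)) ^+ 2 / (2 * (N + e) * (J + e)).
        by rewrite /al /be; field; rewrite !gt_eqF.
      by rewrite lerDl divr_ge0 ?sqr_ge0// ?mulr_ge0// ltW.
  rewrite ge0_integralD//=; first last.
  - by apply: measurable_funeM; apply/measurable_EFinP; exact: measurable_funX.
  - by move=> x _; rewrite mule_ge0// lee_fin// sqr_ge0.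
  - by apply: measurable_funeM; apply/measurable_EFinP; exact: measurable_funX.
  - by move=> x _; rewrite mule_ge0// lee_fin// sqr_ge0.
  rewrite ge0_integralZl//=; first last.
  - by move=> x _; rewrite lee_fin sqr_ge0.
  - by apply/measurable_EFinP; exact: measurable_funX.
  rewrite ge0_integralZl//=; first last.
  - by move=> x _; rewrite lee_fin sqr_ge0.
  - by apply/measurable_EFinP; exact: measurable_funX.
  apply: (@le_trans _ _ (al%:E * ((N + e) ^+ 2)%:E + be%:E * ((J + e) ^+ 2)%:E)%E).
    apply: leeD; apply: lee_wpmul2l => //.
      by apply: (le_trans fN); rewrite lee_fin lerXn2r ?nnegrE ?(ltW n0) ?lerDl ?(ltW e0).
    by apply: (le_trans gJ); rewrite lee_fin lerXn2r ?nnegrE ?(ltW j0) ?lerDl ?(ltW e0).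
  rewrite -!EFinM -EFinD lee_fin /al /be.
  by rewrite le_eqVlt; apply/orP; left; apply/eqP; field; rewrite !gt_eqF.
apply/lee_addgt0Pr => e e0.
have c0 : 0 < N + J + 1 by rewrite ltr_wpDl// addr_ge0.
pose q := Num.min 1 (e / (N + J + 1)).
have q0 : 0 < q by rewrite lt_min ltr01 divr_gt0.
apply: (le_trans (key q q0)); rewrite -EFinD lee_fin.
have q1 : q <= 1 by rewrite ge_min lexx.
have : q * (N + J + 1) <= e by rewrite -ler_pdivlMr// ge_min lexx orbT.
have : q * q <= q by rewrite ler_piMr// ltW.
slra.
Qed.

End cauchy_schwarz.

Section clamp.
Context (R : realType).
Local Notation leb := (@lebesgue_measure R).

(** Constant extension of [phi ^~ ub] below [lowu ub]: it makes [phi]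
continuous on the whole plane without changing it on [region]. *)
Definition clamp (phi : R -> R -> R) (u ub : R) : R := phi (Num.max u (lowu ub)) ub.

Lemma clampE phi u ub : lowu ub <= u -> clamp phi u ub = phi u ub.
Proof. by move=> h; rewrite /clamp (max_idPl _). Qed.

Lemma continuous_lowu : continuous (@lowu R).
Proof.
apply: continuous_maxr => x; first exact: cvg_id.
by apply: cvgB; [exact: cvg_cst|exact: cvg_id].
Qed.

Lemma continuous_clamp phi : {within @region R, continuous (fun p => phi p.1 p.2)} ->
  continuous (fun p : R * R => clamp phi p.1 p.2).
Proof.
move=> cphi p.
pose c (q : R * R) : R * R := (Num.max q.1 (lowu q.2), q.2).
have cc : {for p, continuous c}.
  apply: (@cvg_pair _ _ _ (nbhs p) (nbhs (Num.max p.1 (lowu p.2))) (nbhs p.2)); last exact: cvg_snd.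
  apply: (@continuous_maxr R (R * R)%type fst (fun q => lowu q.2)).
    by move=> q; exact: cvg_fst.
  move=> q; apply: (@continuous_comp _ _ _ (snd : R * R -> R) (@lowu R)); first exact: cvg_snd.
  exact: continuous_lowu.
have rc q : region (c q) by rewrite /region/= le_max lexx orbT.
move: cphi => /subspace_continuousP/(_ _ (rc p)) h A /= nA.
have {}h : nbhs (c p) [set q | region q -> A (phi q.1 q.2)] by exact: (h A nA).
have h2 : nbhs p (c @^-1` [set q | region q -> A (phi q.1 q.2)]) by exact: (cc _ h).
suff : nbhs p [set q | A (clamp phi q.1 q.2)] by [].
by apply: filterS h2 => q hq; exact: (hq (rc q)).
Qed.

Lemma measurable_region_le (B : R) : measurable (@region R `&` [set p | p.1 <= B]).
Proof.
have ml : measurable_fun setT (@lowu R) by apply: continuous_measurable_fun; exact: continuous_lowu.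
have m1 : measurable_fun [set: R * R] (fun x => x.1) by exact: measurable_fst.
have m2 : measurable_fun [set: R * R] (fun x => lowu x.2).
  by apply: measurableT_comp => //; exact: measurable_snd.
rewrite -[X in measurable (X `&` _)]setTI -[X in measurable (_ `&` X)]setTI.
by apply: measurableI; exact: measurable_fun_le.
Qed.

Lemma bounded_on_box (f : R -> R -> R) (a b c d : R) :
  continuous (fun p : R * R => f p.1 p.2) ->
  exists2 K : R, 0 <= K & forall u x, a <= u <= b -> c <= x <= d -> `|f u x| <= K.
Proof.
move=> cf.
have cK : compact (`[a, b] `*` `[c, d] : set (R * R)).
  by apply: compact_setX; exact: segment_compact.
have : compact ((fun p : R * R => f p.1 p.2) @` (`[a, b] `*` `[c, d])).
  by apply: continuous_compact => //; exact: continuous_subspaceT.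
move=> /compact_bounded[N [Nr hN]]; exists `|N + 1| => // u x hu hx.
apply: le_trans (ler_norm _); apply: (hN (N + 1)); first by rewrite ltrDl.
by exists (u, x) => //; split => /=; rewrite in_itv/=.
Qed.

Lemma Rintegral_affine_itv_rev (al be c d : R) (f : R -> R) : 0 < be ->
  leb.-integrable `[al - be * d, al - be * c] (EFin \o f) ->
  leb.-integrable `[c, d] (EFin \o (fun x => f (al - be * x))) /\
  \int[leb]_(x in `[c, d]) f (al - be * x) = be^-1 * \int[leb]_(x in `[al - be * d, al - be * c]) f x.
Proof.
move=> be0 iF.
have be0' : - be != 0 by rewrite oppr_eq0 gt_eqF.
pose F := f \_ `[al - be * d, al - be * c].
have iF' : leb.-integrable setT (EFin \o F).
  by move: iF; rewrite integrable_mkcond//= (restrict_EFin f).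
have [i1 E1] := integrable_affine al be0' iF'.
have FE : (fun x => F (al + - be * x)) = (fun x => f (al - be * x)) \_ `[c, d].
  apply/funext => x; rewrite /F !patchE !mem_setE !in_itv/= mulNr lerD2l lerN2 ler_pM2l// lerD2l lerN2 ler_pM2l//.
  by rewrite andbC.
rewrite FE in i1 E1; split.
  by move: i1; rewrite -restrict_EFin -integrable_mkcond.
by rewrite Rintegral_mkcond E1 normrN (gtr0_norm be0) [in RHS]Rintegral_mkcond.
Qed.

End clamp.

Section interval_integrals.
Context (R : realType).
Local Notation leb := (@lebesgue_measure R).

Lemma ae_imp2 (P Q S : R -> Prop) : (forall x, P x -> Q x -> S x) ->
  {ae leb, forall x, P x} -> {ae leb, forall x, Q x} -> {ae leb, forall x, S x}.
Proof. by move=> h p q; exact: (@filterS2 _ _ (ae_filter_ringOfSetsType leb) _ _ _ h p q). Qed.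

Lemma integrable_itvZl (k : R) (f : R -> R) (c d : R) :
  leb.-integrable `[c, d] (EFin \o f) -> leb.-integrable `[c, d] (EFin \o (fun x => k * f x)).
Proof.
move=> fi.
have : leb.-integrable `[c, d] (fun x => k%:E * (EFin \o f) x)%E.
  by apply: integrableZl => //; exact: measurable_itv.
by apply: eq_integrable.
Qed.

Lemma integrable_subitv (f : R -> R) (a b c d : R) : a <= c -> d <= b ->
  leb.-integrable `[a, b] (EFin \o f) -> leb.-integrable `[c, d] (EFin \o f).
Proof.
move=> ac db; apply: integrableS; [exact: measurable_itv|exact: measurable_itv|].
by apply: subset_itv; rewrite bnd_simp.
Qed.

Lemma integrable_itvB (f g : R -> R) (c d : R) :
  leb.-integrable `[c, d] (EFin \o f) -> leb.-integrable `[c, d] (EFin \o g) ->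
  leb.-integrable `[c, d] (EFin \o (fun x => f x - g x)).
Proof.
move=> fi gi.
have : leb.-integrable `[c, d] ((EFin \o f) \- (EFin \o g))%E.
  by apply: integrableB => //; exact: measurable_itv.
by apply: eq_integrable.
Qed.

Lemma Rintegral_itvZB (k : R) (f g : R -> R) (c d : R) :
  leb.-integrable `[c, d] (EFin \o f) -> leb.-integrable `[c, d] (EFin \o g) ->
  \int[leb]_(x in `[c, d]) (k * (f x - g x)) =
  k * (\int[leb]_(x in `[c, d]) f x - \int[leb]_(x in `[c, d]) g x).
Proof.
move=> fi gi; have fg := integrable_itvB fi gi.
by rewrite (@RintegralZl _ _ _ leb `[c, d]%classic (fun x => f x - g x))// RintegralB.
Qed.

Lemma le_normr_Rintegral_itv (f : R -> R) (c d : R) :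
  leb.-integrable `[c, d] (EFin \o f) ->
  (`|\int[leb]_(x in `[c, d]) f x|%:E <= \int[leb]_(x in `[c, d]) `|f x|%:E)%E.
Proof.
move=> fi; rewrite -abse_EFin /Rintegral fineK; last exact: integrable_fin_num.
by apply: le_abse_integral => //; exact: measurable_int fi.
Qed.

Lemma ae_eq_RintegralD (h f g : R -> R) (c d : R) :
  leb.-integrable `[c, d] (EFin \o h) -> leb.-integrable `[c, d] (EFin \o f) ->
  leb.-integrable `[c, d] (EFin \o g) ->
  {ae leb, forall x : R, c <= x -> x <= d -> h x = f x + g x} ->
  \int[leb]_(x in `[c, d]) h x = \int[leb]_(x in `[c, d]) f x + \int[leb]_(x in `[c, d]) g x.
Proof.
move=> hi fi gi E.
rewrite -RintegralD//; congr fine; apply: ae_eq_integral => //.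
- exact: measurable_int hi.
- by apply: measurable_int (integrableD _ fi gi).
suff : {ae leb, forall x, `[c, d]%classic x -> (h x)%:E = (f x + g x)%:E} by [].
move: E; apply: filterS; first exact: (ae_filter_ringOfSetsType leb).
by move=> x hx /=; rewrite in_itv/= => /andP[x1 x2]; rewrite hx.
Qed.

Lemma itv_measure_fin_num (c d : R) : leb `[c, d]%classic \is a fin_num.
Proof. by rewrite lebesgue_measure_itv/=; case: ifPn. Qed.

End interval_integrals.

Section trace.
Context (R : realType).
Local Notation leb := (@lebesgue_measure R).
Variables (mu eps : R) (phi phiu phiub G : R -> R -> R) (psi0 psi1 : R -> R).
Hypothesis sol : solution mu phi phiu phiub G eps psi0 psi1.

Local Notation rhs := (phi_uub_rhs mu phi G).

(** The zeroth-order term is continuous and bounded on the triangle cut by an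
abscissa, so the integrability of the source passes to the right-hand side. *)
Lemma rhs_integrable (B : R) : (@leb2 R).-integrable (@region R `&` [set p | p.1 <= B])
  (fun p => (rhs p.1 p.2)%:E).
Proof.
set D := _ `&` _.
have mD : measurable D by exact: measurable_region_le.
have iG := sol_source sol B.
have cphi := continuous_clamp (sol_cont sol).
pose K (p : R * R) := mu * (2 - mu) / 4 * (clamp phi p.1 p.2 / Num.max 2 (p.1 + p.2) ^+ 2).
have m2 (x : R) : 0 < Num.max 2 x by rewrite lt_max ltr0n.
have cK : continuous K.
  move=> p; apply: cvgM; first exact: cvg_cst.
  apply: cvgM; first exact: cphi.
  apply: cvgV; first by rewrite expf_neq0// gt_eqF.
  apply: (@continuous_comp _ _ _ (fun q : R * R => Num.max 2 (q.1 + q.2)) (fun y : R => y ^+ 2)); last exact: exprn_continuous.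
  apply: (@continuous_maxr R (R * R)%type (fun=> 2) (fun q => q.1 + q.2)) => q; first exact: cvg_cst.
  by apply: cvgD; [exact: cvg_fst|exact: cvg_snd].
have DP p : D p -> [/\ 1 <= p.1 <= B, 2 - B <= p.2 <= B & 2 <= p.1 + p.2].
  move=> [/= ]; rewrite /region/= => h pB.
  have [l1 l2 l3] := lowuP p.2.
  by split; [apply/andP; split|apply/andP; split|]; slra.
have [k k0 Kk] : exists2 k : R, 0 <= k & forall u x, 1 <= u <= B -> 2 - B <= x <= B -> `|K (u, x)| <= k.
  apply: (@bounded_on_box R (fun u x => K (u, x))).
  by rewrite (_ : (fun p => _) = K)//; apply/funext => -[].
have iK : (@leb2 R).-integrable D (EFin \o K).
  apply: measurable_bounded_integrable => //.
  - apply: (@le_lt_trans _ _ (leb2 (`[1, B]%classic `*` `[2 - B, B]%classic : set (R * R)))).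
      apply: le_measure; rewrite ?inE//; first exact: measurableX.
      by move=> p /DP[h1 h2 _]; split; rewrite /= in_itv.
    rewrite /leb2 product_measure1E// -!ge0_fin_numE//.
      by rewrite fin_numM//; exact: itv_measure_fin_num.
    by rewrite mule_ge0.
  - by apply: measurable_funTS; exact: continuous_plane_measurable.
  - exists k; split; first exact: num_real.
    move=> y ky p /DP[h1 h2 _]; apply: (le_trans _ (ltW ky)).
    by have := Kk p.1 p.2 h1 h2; rewrite -surjective_pairing.
have : (@leb2 R).-integrable D ((fun p => (G p.1 p.2)%:E) \- (EFin \o K))%E by exact: integrableB.
apply: eq_integrable => // p /set_mem Dp.
have [_ _ h] := DP _ Dp.
have p0 : p.1 + p.2 != 0 by rewrite gt_eqF// (lt_le_trans _ h).
rewrite /= -EFinB; congr EFin; rewrite /phi_uub_rhs /K (max_idPr h) clampE; last by case: Dp.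
by congr (_ - _); field.
Qed.

(** At the initial line only [phiu z (2 - z)] is known from the data; it is the
value of [phiu z 1] minus the integral of the equation. *)
Definition trace_u z := phiu z 1 - \int[leb]_(y in `[2 - z, 1]) rhs z y.
Definition trace_ub y := phiub 2 y - \int[leb]_(z in `[2 - y, 2]) rhs z y.

Lemma triangle_rhs (c d : R) : c <= 1 ->
  (@leb2 R).-integrable [set p : R * R | [/\ p.1 <= d, p.2 <= c & 2 <= p.1 + p.2]]
     (fun p => (rhs p.1 p.2)%:E).
Proof.
move=> c1; have iR := rhs_integrable d; apply: integrableS iR.
- exact: measurable_region_le.
- exact: measurable_triangle.
- move=> p /= [h1 h2 h3]; split => //=; rewrite /region/= lowu_le; apply/andP; split; slra.
Qed.

Lemma integrable_trace_u : leb.-integrable `[1, 2] (EFin \o trace_u).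
Proof.
have [i1 _ _] := triangle_fubini (triangle_rhs 2 (lexx 1)).
have l12 : lowu 1 <= (2 : R) by rewrite lowu_id// ler1n.
have [iu _] := sol_u sol l12.
move: i1; rewrite (_ : 2 - 1 = 1 :> R); last by ring.
rewrite lowu_id// in iu => i1.
exact: integrable_itvB.
Qed.

Lemma integrable_trace_ub : leb.-integrable `[0, 1] (EFin \o trace_ub).
Proof.
have [_ i1 _] := triangle_fubini (triangle_rhs 2 (lexx 1)).
have l12 : 1 <= (2 : R) by rewrite ler1n.
have [iu _] := sol_ub sol l12.
rewrite subrr in i1 iu.
have iu' := integrable_subitv (lexx 0) (ler1n _ 2) iu.
exact: integrable_itvB.
Qed.

Lemma trace_uE : {ae leb, forall z : R, 1 <= z -> phiu z (2 - z) = trace_u z /\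
  forall c, 2 - z <= c -> c <= z -> phiu z c = trace_u z + \int[leb]_(y in `[2 - z, c]) rhs z y}.
Proof.
have := sol_eq_u sol; apply: filterS; first exact: (ae_filter_ringOfSetsType leb).
move=> z h z1; have [_ E] := h z1.
have E1 : phiu z (2 - z) = trace_u z.
  rewrite /trace_u -E//; first by ring.
  by slra.
split => // c c1 c2; rewrite -E1 -E//; first by ring.
Qed.

Lemma trace_ubE : {ae leb, forall y : R, y <= 1 -> 0 <= y -> phiub (2 - y) y = trace_ub y /\
  forall d, 2 - y <= d -> phiub d y = trace_ub y + \int[leb]_(z in `[2 - y, d]) rhs z y}.
Proof.
have := sol_eq_ub sol; apply: filterS; first exact: (ae_filter_ringOfSetsType leb).
move=> y h y1 y0.
have ly : lowu y = 2 - y by rewrite /lowu (max_idPr _)//; slra.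
have E1 : phiub (2 - y) y = trace_ub y.
  have [|_ E] := h 2; first by rewrite ly; slra.
  rewrite /trace_ub ly in E *; rewrite -E//; [by ring|by slra].
split => // d yd; rewrite -E1.
have [|_ E] := h d; first by rewrite ly.
by rewrite ly in E; rewrite -E//; ring.
Qed.

(** Green's formula on the characteristic triangle below two points of the
initial line: phi is compared with its value at the upper corner along both
characteristics, and the double integrals of the equation cancel. *)
Lemma initial_increment (u1 u2 : R) : 1 <= u1 -> u1 <= u2 -> u2 <= 2 ->
  phi u2 (2 - u2) - phi u1 (2 - u1) =
  \int[leb]_(z in `[u1, u2]) trace_u z - \int[leb]_(y in `[2 - u2, 2 - u1]) trace_ub y.
Proof.
move=> hu1 hu12 hu2.
have cancel (A B J : R) : A + J - (B + J) = A - B by ring.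
have y1u1 : 2 - (2 - u1) = u1 by ring.
have hy2 : 0 <= 2 - u2 by slra.
have hy12 : 2 - u2 <= 2 - u1 by slra.
have hy1 : 2 - u1 <= 1 by slra.
have hyu : 2 - u1 <= u2 by slra.
have hyu1 : 2 - u1 <= u1 by slra.
have ly1 : lowu (2 - u1) = u1 by rewrite /lowu (max_idPr _)//; slra.
have lu : lowu (2 - u1) <= u2 by rewrite ly1.
have [iu Eu] := sol_u sol lu; rewrite ly1 in iu Eu.
have [ib Eb] := sol_ub sol (le_trans hu1 hu12).
have -> : phi u2 (2 - u2) - phi u1 (2 - u1) =
    (phi u2 (2 - u1) - phi u1 (2 - u1)) - (phi u2 (2 - u1) - phi u2 (2 - u2)) by ring.
rewrite Eu ?lexx// Eb ?lexx//.
have [j1 j2 EJ] := triangle_fubini (triangle_rhs u2 hy1).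
rewrite y1u1 in j1 j2 EJ.
have it : leb.-integrable `[u1, u2] (EFin \o trace_u).
  exact: integrable_subitv integrable_trace_u.
have itb : leb.-integrable `[2 - u2, 2 - u1] (EFin \o trace_ub).
  exact: integrable_subitv integrable_trace_ub.
have ib' : leb.-integrable `[2 - u2, 2 - u1] (EFin \o phiub u2).
  exact: integrable_subitv ib.
rewrite (ae_eq_RintegralD iu it j1); last first.
  have := trace_uE; apply: filterS; first exact: (ae_filter_ringOfSetsType leb).
  move=> z hz z1 z2.
  have [_ E] := hz (le_trans hu1 z1).
  apply: E; first by rewrite lerD2l lerN2.
  exact: le_trans hyu1 z1.
rewrite (ae_eq_RintegralD ib' itb j2); last first.
  have := trace_ubE; apply: filterS; first exact: (ae_filter_ringOfSetsType leb).
  move=> y hz z1 z2.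
  have [_ E] := hz (le_trans z2 hy1) (le_trans hy2 z1).
  by apply: E; move: z1; rewrite lerBlDl -lerBlDr.
rewrite EJ; exact: cancel.
Qed.

Hypothesis eps0 : 0 < eps.

(** The profile r psi0 of the first datum, and its derivative, recovered from
the solution. *)
Definition profile r := clamp phi (1 + 2^-1 * r) (1 - 2^-1 * r) / eps.
Definition dprofile r := (2 * eps)^-1 * (trace_u (1 + 2^-1 * r) - trace_ub (1 - 2^-1 * r)).

(** This identifies the a.e. derivative of r psi0 with the difference of the
traces of [phiu] and [phiub]; it is where the H^1 datum meets the solution. *)
Lemma profile_primitive : primitive_on 0 2 profile dprofile.
Proof.
have h0 : 0 < 2^-1 :> R by rewrite invr_gt0.
have lin (A B : R) : (A - B) / eps = (2 * eps)^-1 * (2^-1^-1 * A - 2^-1^-1 * B).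
  by field; rewrite gt_eqF.
have r3 (y : R) : y <= 2 -> 1 + 2^-1 * y <= 2 by move=> y2; slra.
have Ex (z : R) : 2 - (1 + 2^-1 * z) = 1 - 2^-1 * z by ring.
have cl (z : R) : 0 <= z -> profile z = phi (1 + 2^-1 * z) (1 - 2^-1 * z) / eps.
  move=> z0; rewrite /profile clampE// lowu_le; apply/andP; split; slra.
have it (x y : R) : 0 <= x -> y <= 2 -> leb.-integrable `[1 + 2^-1 * x, 1 + 2^-1 * y] (EFin \o trace_u).
  by move=> x0 y2; apply: integrable_subitv integrable_trace_u; slra.
have itb (x y : R) : 0 <= x -> y <= 2 -> leb.-integrable `[1 - 2^-1 * y, 1 - 2^-1 * x] (EFin \o trace_ub).
  by move=> x0 y2; apply: integrable_subitv integrable_trace_ub; slra.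
split.
  have [i1 _] := Rintegral_affine_itv h0 (it 0 2 (lexx _) (lexx _)).
  have [i2 _] := Rintegral_affine_itv_rev h0 (itb 0 2 (lexx _) (lexx _)).
  have i3 := integrable_itvB i1 i2.
  exact: integrable_itvZl.
move=> x y x0 xy y2.
have r1 : 1 <= 1 + 2^-1 * x by rewrite lerDl mulr_ge0// ltW.
have r2 : 1 + 2^-1 * x <= 1 + 2^-1 * y by rewrite lerD2l ler_pM2l.
have [i1 E1] := Rintegral_affine_itv h0 (it x y x0 y2).
have [i2 E2] := Rintegral_affine_itv_rev h0 (itb x y x0 y2).
have i3 := integrable_itvB i1 i2.
rewrite /dprofile (Rintegral_itvZB _ i1 i2) E1 E2.
have := initial_increment r1 r2 (r3 y y2).
rewrite !Ex => E.
rewrite !cl ?(le_trans x0)// -mulrBl E.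
exact: lin.
Qed.

Lemma continuous_profile : continuous profile.
Proof.
move=> r; apply: cvgM; last exact: cvg_cst.
have cphi := continuous_clamp (sol_cont sol).
apply: (@continuous_comp _ _ _ (fun x : R => (1 + 2^-1 * x, 1 - 2^-1 * x)) (fun p : R * R => clamp phi p.1 p.2)); last exact: cphi.
apply: (@cvg_pair _ _ _ (nbhs r) (nbhs (1 + 2^-1 * r)) (nbhs (1 - 2^-1 * r))).
  by apply: cvgD; [exact: cvg_cst|apply: cvgM; [exact: cvg_cst|exact: cvg_id]].
by apply: cvgB; [exact: cvg_cst|apply: cvgM; [exact: cvg_cst|exact: cvg_id]].
Qed.

Lemma profileE (r : R) : 0 <= r -> profile r = phi (ucoord 0 r) (ubcoord 0 r) / eps.
Proof.
move=> r0; rewrite /profile clampE ?lowu_le; last by apply/andP; split; slra.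
by congr (phi _ _ / _); rewrite /ucoord /ubcoord; field.
Qed.

Lemma ae_profile : {ae leb, forall r : R, 0 <= r -> profile r = r * psi0 r}.
Proof.
have := sol_init sol; apply: filterS; first exact: (ae_filter_ringOfSetsType leb).
move=> r h r0; rewrite profileE// h//.
by field; rewrite gt_eqF.
Qed.

Hypothesis phi_vanish : forall u ub, lowu ub <= u -> ub <= 1 / 2 -> phi u ub = 0.

Lemma profile_vanish (r : R) : 1 <= r -> profile r = 0.
Proof.
move=> r1; rewrite /profile clampE ?lowu_le; last by apply/andP; split; slra.
rewrite phi_vanish ?mul0r// ?lowu_le; last by slra.
by apply/andP; split; slra.
Qed.

Variable dpsi0 : 'I_3 -> R * R * R -> R.
Hypothesis H1psi0 : in_H1 (radial psi0) dpsi0.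
Hypothesis L2psi1 : in_L2 (radial psi1).

Definition gradient_energy := \sum_(i < 3) fine (sqL2 (dpsi0 i)).

Lemma gradient_energy_ge0 : 0 <= gradient_energy.
Proof.
by apply: sumr_ge0 => i _; apply: fine_ge0; apply: integral_ge0 => x _; rewrite lee_fin sqr_ge0.
Qed.

Lemma measurable_dprofile (b : R) : b <= 2 -> measurable_fun `[0, b] dprofile.
Proof.
move=> b2; have [i _] := profile_primitive.
by apply/measurable_EFinP; apply: measurable_int (integrable_subitv (lexx 0) b2 i).
Qed.

Lemma dprofile_L2 (b : R) : b <= 2 ->
  (\int[leb]_(r in `[0%R, b]) (dprofile r ^+ 2)%:E <=
  (2 / sphere_area R * gradient_energy)%:E)%E.
Proof.
move=> b2.
have := radial_derivative_L2 H1psi0 continuous_profile ae_profile profile_vanish profile_primitive.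
have m2 : measurable_fun (`[0%R, 2%R] : set R) (fun r => (dprofile r ^+ 2)%:E).
  by apply/measurable_EFinP; apply: measurable_funX; exact: measurable_dprofile.
apply: le_trans.
rewrite -(@integral_itv_bndoo _ _ _ _ true false); last first.
  by apply: measurable_funS m2 => //; apply: subset_itv; rewrite bnd_simp.
apply: ge0_subset_integral => //.
  by move=> x _; rewrite lee_fin sqr_ge0.
by apply: subset_itv; rewrite bnd_simp.
Qed.

(** The profile vanishes at r = 1, so its values are integrals of its derivative
over an interval of length at most 1. *)
Lemma initial_bound (ub : R) : 1 / 2 <= ub -> ub <= 1 ->
  `|phi (lowu ub) ub| <= eps * Num.sqrt (2 / sphere_area R * gradient_energy).
Proof.
move=> ub1 ub2.
pose r := 2 - 2 * ub.
have r0 : 0 <= r by rewrite /r; slra.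
have r1 : r <= 1 by rewrite /r; slra.
have lu : lowu ub = 2 - ub by rewrite /lowu (max_idPr _)//; slra.
have E : phi (lowu ub) ub = eps * profile r.
  rewrite profileE// lu mulrC mulfVK ?gt_eqF//.
  by congr phi; rewrite /ucoord /ubcoord /r; field.
rewrite E normrM (gtr0_norm eps0) ler_pM2l//.
have [ip Ep] := profile_primitive.
have ip' := integrable_subitv r0 (ler1n _ 2) ip.
have := Ep r 1 r0 r1 (ler1n _ 2); rewrite profile_vanish// sub0r => {}Ep.
have {}Ep : - profile r = \int[leb]_(z in `[r, 1]) dprofile z by exact: Ep.
rewrite -normrN Ep.
have mi : measurable `[r, 1] by exact: measurable_itv.
rewrite -lee_fin; apply: (le_trans (le_normr_Rintegral_itv ip')).
have A0 := sphere_area_gt0 R.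
have q0 : 0 <= 2 / sphere_area R * gradient_energy.
  by rewrite mulr_ge0 ?gradient_energy_ge0// divr_ge0// ltW.
have mdp : measurable_fun `[r, 1] dprofile.
  apply: measurable_funS (measurable_dprofile (ler1n _ 2)) => //.
  by apply: subset_itv; rewrite bnd_simp// ler1n.
have := @cauchy_schwarz _ _ R leb `[r, 1] dprofile (cst 1) (Num.sqrt (2 / sphere_area R * gradient_energy)) 1 mi mdp (measurable_cst _) (sqrtr_ge0 _) ler01.
rewrite mulr1 => CS.
under eq_integral do rewrite -[dprofile _]mulr1; apply: CS.
- rewrite sqr_sqrtr//; apply: le_trans (dprofile_L2 (ler1n _ 2)).
  apply: ge0_subset_integral => //.
  + by apply/measurable_EFinP; apply: measurable_funX; exact: measurable_dprofile (ler1n _ 2).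
  + by move=> x _; rewrite lee_fin sqr_ge0.
  + by apply: subset_itv; rewrite bnd_simp.
- under eq_integral do rewrite expr1n.
  have -> : (\int[leb]_(_ in `[r, 1%R]) (1%:E : \bar R) = (1 * (1 - r))%:E)%E by exact: integral_cst_itv.
  by rewrite lee_fin mul1r expr1n gerBl.
Qed.

(** Half sum and half difference of the two traces are known: one is the velocity
datum, the other the derivative of the first datum. *)
Lemma ae_trace_u : {ae leb, forall r : R, 0 <= r -> r <= 2 ->
  trace_u (1 + 2^-1 * r) = eps * (r * psi1 r + dprofile r)}.
Proof.
have hh : 2^-1 != 0 :> R by rewrite gt_eqF// invr_gt0.
have hh' : - 2^-1 != 0 :> R by rewrite oppr_eq0.
have a1 := ae_affine 1 hh trace_uE.
have a2 := ae_affine 1 hh' trace_ubE.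
have a3 := sol_init_t sol.
apply: (ae_imp2 _ a1 (ae_imp2 (fun x p q => conj p q) a2 a3)).
move=> r /= h1 [h2 h3] r0 r2; move: h1 h2; rewrite mulNr.
have -> : 2 - (1 + 2^-1 * r) = 1 - 2^-1 * r by ring.
have -> : 2 - (1 - 2^-1 * r) = 1 + 2^-1 * r by ring.
have {}h3 := h3 r0.
have e1 : ucoord 0 r = 1 + 2^-1 * r by rewrite /ucoord; field.
have e2 : ubcoord 0 r = 1 - 2^-1 * r by rewrite /ubcoord; field.
have x1 : 1 <= 1 + 2^-1 * r by slra.
have x2 : 1 - 2^-1 * r <= 1 by slra.
have x3 : 0 <= 1 - 2^-1 * r by slra.
rewrite e1 e2 in h3.
move=> /(_ x1)[h1 _] /(_ x2 x3)[h2 _].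
rewrite h1 h2 in h3.
have -> : trace_u (1 + 2^-1 * r) = (trace_u (1 + 2^-1 * r) + trace_ub (1 - 2^-1 * r)) / 2 +
   (trace_u (1 + 2^-1 * r) - trace_ub (1 - 2^-1 * r)) / 2 by field.
by rewrite h3 /dprofile; field; rewrite gt_eqF.
Qed.

Definition data_energy := gradient_energy + fine (sqL2 (radial psi1)).

Lemma measurable_datum : measurable_fun (`[0, 1] : set R) (fun r => r * psi1 r).
Proof.
have [mpsi _] := L2psi1; have mp := measurable_radial_profile mpsi.
apply: measurable_funM; first exact: measurable_id.
have h : measurable_fun (`[0, 1] : set R) (fun r => psi1 `|r|) by exact: measurable_funTS.
apply: eq_measurable_fun h.
by move=> r; rewrite inE/= in_itv/= => /andP[r0 _]; rewrite ger0_norm.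
Qed.

Lemma datum_L2 : (\int[leb]_(r in `[0%R, 1%R]) ((r * psi1 r) ^+ 2)%:E <=
  (fine (sqL2 (radial psi1)) / sphere_area R)%:E)%E.
Proof.
have A0 := sphere_area_gt0 R.
have [mpsi fin] := L2psi1.
have mp := measurable_radial_profile mpsi.
have E : sqL2 (radial psi1) =
    (\int[leb]_(r in `[0%R, +oo[) ((psi1 `|r| ^+ 2)%:E * (sphere_area R * r ^+ 2)%:E))%E.
  rewrite -(@ge0_integral_radial R (fun r => (psi1 `|r| ^+ 2)%:E)).
  - by apply: eq_integral => x _; rewrite /radial ger0_norm// sqrtr_ge0.
  - by apply/measurable_EFinP; exact: measurable_funX.
  - by move=> x; rewrite lee_fin sqr_ge0.
have fn : sqL2 (radial psi1) \is a fin_num.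
  by rewrite ge0_fin_numE//; apply: integral_ge0 => x _; rewrite lee_fin sqr_ge0.
rewrite mulrC EFinM fineK// lee_pdivlMl//.
have m1 : measurable_fun (`[0%R, 1%R] : set R) (fun r => ((r * psi1 r) ^+ 2)%:E).
  by apply/measurable_EFinP; apply: measurable_funX; exact: measurable_datum.
rewrite -ge0_integralZl//; last 2 first.
- by move=> x _; rewrite lee_fin sqr_ge0.
- by rewrite lee_fin ltW.
rewrite E.
apply: (@le_trans _ _ (\int[leb]_(r in `[0%R, 1%R]) ((psi1 `|r| ^+ 2)%:E * (sphere_area R * r ^+ 2)%:E))%E).
  rewrite le_eqVlt; apply/orP; left; apply/eqP; apply: eq_integral => r.
  rewrite inE/= in_itv/= => /andP[r0 _]; rewrite ger0_norm// -!EFinM; congr EFin; ring.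
apply: ge0_subset_integral => //.
- apply: emeasurable_funM; apply/measurable_EFinP.
    by apply: measurable_funTS; exact: measurable_funX.
  by apply: measurable_funM => //; exact: measurable_funX.
- by move=> x _; rewrite -EFinM lee_fin mulr_ge0// ?sqr_ge0// mulr_ge0 ?sqr_ge0// ltW.
- by apply: subset_itv; rewrite bnd_simp.
Qed.

Lemma trace_u_L2 : (\int[leb]_(z in `[1%R, (3 / 2)%R]) (trace_u z ^+ 2)%:E <=
  (2 / sphere_area R * eps ^+ 2 * data_energy)%:E)%E.
Proof.
have A0 := sphere_area_gt0 R.
pose F : R -> \bar R := (fun z => (trace_u z ^+ 2)%:E) \_ `[1%R, (3 / 2)%R].
have h32 := three_halves_le2 R.
have mF : measurable_fun setT F.
  have it := integrable_subitv (lexx 1) h32 integrable_trace_u.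
  have m : measurable_fun (`[1%R, (3 / 2)%R] : set R) (fun z => (trace_u z ^+ 2)%:E).
    by apply/measurable_EFinP; apply: measurable_funX; apply/measurable_EFinP; exact: measurable_int it.
  exact: ((measurable_restrictT _ (measurable_itv _)).1 m).
have F0 x : (0 <= F x)%E by rewrite /F patchE; case: ifPn => // _; rewrite lee_fin sqr_ge0.
have hh : 2^-1 != 0 :> R by rewrite gt_eqF// invr_gt0.
have E := ge0_integral_affine 1 hh mF F0.
have FE : (fun x => F (1 + 2^-1 * x)) =
    (fun x => (trace_u (1 + 2^-1 * x) ^+ 2)%:E) \_ `[0%R, 1%R].
  apply/funext => x; rewrite /F !patchE !mem_setE !in_itv/=.
  by congr (if _ then _ else _); congr (_ && _); apply/idP/idP => h; slra.
rewrite FE -integral_mkcond -integral_mkcond in E.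
have i2 : `|2^-1|^-1 = 2 :> R by rewrite gtr0_norm ?invrK// invr_gt0.
rewrite i2 in E.
rewrite -(@lee_pmul2l _ 2%:E)//.
rewrite -E.
have k0 : (0 : R) <= 2 * eps ^+ 2 by rewrite mulr_ge0// sqr_ge0.
have m1 : measurable_fun (`[0%R, 1%R] : set R) (fun r => (dprofile r ^+ 2)%:E).
  by apply/measurable_EFinP; apply: measurable_funX; exact: measurable_dprofile (ler1n _ 2).
have m2 : measurable_fun (`[0%R, 1%R] : set R) (fun r => ((r * psi1 r) ^+ 2)%:E).
  apply/measurable_EFinP; apply: measurable_funX; exact: measurable_datum.
have m3 : measurable_fun (`[0%R, 1%R] : set R) (fun r => (trace_u (1 + 2^-1 * r) ^+ 2)%:E).
  have := measurableT_comp mF (measurable_funD (measurable_cst (1 : R)) (measurable_funM (measurable_cst (2^-1 : R)) (@measurable_id _ R setT))).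
  rewrite /comp/= FE => m; exact: ((measurable_restrictT _ (measurable_itv _)).2 m).
apply: (@le_trans _ _ (\int[leb]_(r in `[0%R, 1%R])
   ((2 * eps ^+ 2)%:E * ((r * psi1 r) ^+ 2)%:E + (2 * eps ^+ 2)%:E * (dprofile r ^+ 2)%:E))%E).
  apply: ae_ge0_le_integral => //.
  - by move=> x _; rewrite lee_fin sqr_ge0.
  - by move=> x _; rewrite adde_ge0// mule_ge0// lee_fin ?sqr_ge0.
  - by apply: emeasurable_funD; exact: measurable_funeM.
  have := ae_trace_u; apply: filterS; first exact: (ae_filter_ringOfSetsType leb).
  move=> r h /=; rewrite in_itv/= => /andP[r0 r1]; rewrite h// ?(le_trans r1) ?ler1n//.
  rewrite -!EFinM -EFinD lee_fin.
  have := sqr_ge0 (r * psi1 r - dprofile r).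
  move: (r * psi1 r) (dprofile r) => p q pq.
  have -> : (eps * (p + q)) ^+ 2 = 2 * eps ^+ 2 * p ^+ 2 + 2 * eps ^+ 2 * q ^+ 2 - eps ^+ 2 * (p - q) ^+ 2 by ring.
  by rewrite gerBl mulr_ge0// sqr_ge0.
rewrite ge0_integralD//; first last.
- exact: measurable_funeM.
- by move=> x _; rewrite mule_ge0// lee_fin// sqr_ge0.
- exact: measurable_funeM.
- by move=> x _; rewrite mule_ge0// lee_fin// sqr_ge0.
rewrite ge0_integralZl//; last by move=> x _; rewrite lee_fin sqr_ge0.
rewrite ge0_integralZl//; last by move=> x _; rewrite lee_fin sqr_ge0.
apply: (le_trans (leeD (lee_wpmul2l _ datum_L2) (lee_wpmul2l _ (dprofile_L2 (ler1n _ 2))))); rewrite ?lee_fin//.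
rewrite /data_energy.
have P0 : 0 <= fine (sqL2 (radial psi1)) / sphere_area R.
  by rewrite divr_ge0 ?(ltW A0)//; apply: fine_ge0; apply: integral_ge0 => x _; rewrite lee_fin sqr_ge0.
have -> : 2 * (2 / sphere_area R * eps ^+ 2 * (gradient_energy + fine (sqL2 (radial psi1)))) =
  2 * eps ^+ 2 * (fine (sqL2 (radial psi1)) / sphere_area R) + 2 * eps ^+ 2 * (2 / sphere_area R * gradient_energy)
  + 2 * eps ^+ 2 * (fine (sqL2 (radial psi1)) / sphere_area R) by field; rewrite gt_eqF.
by rewrite lerDl mulr_ge0.
Qed.

End trace.

(** * Minkowski's integral inequality *)

Section minkowski.
Context (R : realType).
Local Notation leb := (@lebesgue_measure R).

Lemma measurable_slice (F : R * R -> R) (u : R) : measurable_fun setT F ->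
  measurable_fun setT (fun x => F (u, x)).
Proof. by move=> mF; apply: measurableT_comp => //; exact: measurable_pair1. Qed.

Lemma measurable_fun_powR d (T : measurableType d) (D : set T) (f : T -> R) (p : R) :
  measurable_fun D f -> measurable_fun D (fun x => f x `^ p).
Proof.
move=> mf; apply: (@measurableT_comp _ _ _ _ _ _ (fun z : R => z `^ p) D f); [exact: measurable_powR|exact: mf].
Qed.

(** Minkowski's integral inequality.  The inner integral is estimated by the
Cauchy-Schwarz inequality with weight h = g^(1/2) + eta, where g x is the square
integral of [F (u, x)] in u; as g / h <= h, Tonelli's theorem leaves the square of
the integral of h, and eta tends to 0. *)
Lemma minkowski_integral (F : R * R -> R) (c d I : R) : c <= d -> 0 <= I ->
  measurable_fun setT F -> (forall p, 0 <= F p) ->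
  (\int[leb]_(x in `[c, d]) ((\int[leb]_u (F (u, x) ^+ 2)%:E) `^ (1 / 2)) <= I%:E)%E ->
  (\int[leb]_u ((\int[leb]_(x in `[c, d]) (F (u, x))%:E) *
                (\int[leb]_(x in `[c, d]) (F (u, x))%:E)) <= (I ^+ 2)%:E)%E.
Proof.
move=> cd I0 mF F0 gI.
pose g (x : R) : \bar R := (\int[leb]_u (F (u, x) ^+ 2)%:E)%E.
have g0 x : (0 <= g x)%E by apply: integral_ge0 => u _; rewrite lee_fin sqr_ge0.
have mF2 : measurable_fun setT (fun p => (F p ^+ 2)%:E).
  by apply/measurable_EFinP; exact: measurable_funX.
have mg : measurable_fun setT g.
  apply: (@measurable_fun_fubini_tonelli_G _ _ _ _ _ leb (fun p => (F p ^+ 2)%:E)) => //.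
  by move=> p; rewrite lee_fin sqr_ge0.
have mgh : measurable_fun setT (fun x => g x `^ (1 / 2))%E.
  apply: (@measurableT_comp _ _ _ _ _ _ (fun z : \bar R => z `^ (1 / 2))%E _ g) => //.
  exact: measurable_poweR.
pose r (x : R) : R := fine (g x `^ (1 / 2))%E.
have r0 x : 0 <= r x by apply: fine_ge0; exact: poweR_ge0.
have mr : measurable_fun setT r by exact: measurableT_comp mgh.
have gfin : {ae leb, forall x, `[c, d]%classic x -> (g x `^ (1 / 2))%E \is a fin_num}.
  apply: integrable_ae; first exact: measurable_itv.
  apply/integrableP; split; first exact: measurable_funTS.
  under eq_integral do rewrite gee0_abs ?poweR_ge0//.
  by apply: (le_lt_trans gI); rewrite ltry.
have key (eta : R) : 0 < eta ->
    (\int[leb]_u ((\int[leb]_(x in `[c, d]) (F (u, x))%:E) *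
                (\int[leb]_(x in `[c, d]) (F (u, x))%:E)) <= ((I + eta * (d - c + 1)) ^+ 2)%:E)%E.
  move=> eta0; set H := I + _.
  have dc0 : 0 <= d - c by rewrite subr_ge0.
  have H0 : 0 < H by rewrite ltr_wpDl// mulr_gt0// ltr_wpDl.
  pose h x := r x + eta.
  have h0 x : 0 < h x by rewrite ltr_wpDl.
  have mh : measurable_fun setT h by apply: measurable_funD.
  have hH : (\int[leb]_(x in `[c, d]) (h x)%:E <= H%:E)%E.
    rewrite (_ : (fun x => (h x)%:E) = (fun x => (r x)%:E + eta%:E)%E)//.
    rewrite ge0_integralD//; last 3 first.
    - by move=> x _; rewrite lee_fin.
    - by apply/measurable_EFinP; exact: measurable_funTS.
    - by move=> x _; rewrite lee_fin ltW.
    rewrite integral_cst_itv// /H EFinD; apply: leeD; last first.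
      by rewrite lee_fin ler_pM2l// lerDl.
    apply: le_trans gI; apply: ge0_le_integral => //.
    - by move=> x _; rewrite lee_fin.
    - by apply/measurable_EFinP; exact: measurable_funTS.
    - exact: measurable_funTS.
    - by move=> x _; rewrite /r -/(g x); case: (_ `^ _)%E (poweR_ge0 (g x) (1 / 2)) => [z| |]//=; rewrite ?leey.
  have mind : measurable_fun setT (fun p : R * R => \1_`[c, d] p.2 : R).
    by apply: measurableT_comp => //; exact: measurable_snd.
  have mh2 : measurable_fun setT (fun p : R * R => h p.2).
    by apply: measurableT_comp => //; exact: measurable_snd.
  have i0 (x : R) : (0 : R) <= \1_`[c, d] x by rewrite indicE.
  pose Fc (p : R * R) := F p * \1_`[c, d] p.2.
  have mFc : measurable_fun setT Fc by exact: measurable_funM.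
  pose K (p : R * R) := F p ^+ 2 / h p.2 * \1_`[c, d] p.2.
  have mK : measurable_fun setT K.
    apply: measurable_funM => //; apply: measurable_funM; first exact: measurable_funX.
    rewrite (_ : (fun p => _) = (fun p : R * R => h p.2 `^ (-1))); last first.
      by apply/funext => p; rewrite powR_inv1// ltW.
    exact: measurable_fun_powR.
  have K0 p : 0 <= K p by rewrite mulr_ge0// divr_ge0 ?sqr_ge0// ltW.
  have restrictE (f : R -> R) : (\int[leb]_(x in `[c, d]) (f x)%:E = \int[leb]_x (f x * \1_`[c, d] x)%:E)%E.
    rewrite [LHS]integral_mkcond; apply: eq_integral => x _.
    by rewrite patchE indicE; case: ifPn => _; rewrite ?mulr1 ?mulr0.
  pose Y u := (\int[leb]_(x in `[c, d]) (F (u, x))%:E)%E.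
  pose Z u := (\int[leb]_(x in `[c, d]) (F (u, x) ^+ 2 / h x)%:E)%E.
  have YE u : Y u = (\int[leb]_x (Fc (u, x))%:E)%E by exact: restrictE.
  have ZE u : Z u = (\int[leb]_x (K (u, x))%:E)%E by exact: (restrictE (fun x => F (u, x) ^+ 2 / h x)).
  have Y0 u : (0 <= Y u)%E by apply: integral_ge0 => x _; rewrite lee_fin.
  have Z0 u : (0 <= Z u)%E by apply: integral_ge0 => x _; rewrite lee_fin divr_ge0 ?sqr_ge0// ltW.
  have mY : measurable_fun setT Y.
    rewrite (funext YE); apply: (@measurable_fun_fubini_tonelli_F _ _ _ _ _ leb (fun p => (Fc p)%:E)) => //.
      exact/measurable_EFinP.
    by move=> p; rewrite lee_fin mulr_ge0.
  have mZ : measurable_fun setT Z.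
    rewrite (funext ZE); apply: (@measurable_fun_fubini_tonelli_F _ _ _ _ _ leb (fun p => (K p)%:E)) => //.
    exact/measurable_EFinP.
  have YZ u : (Y u * Y u <= H%:E * Z u)%E.
    have [/eqP Zy|Zf] := boolP (Z u == +oo%E).
      by rewrite Zy gt0_muley ?lte_fin// leey.
    have {}Zf : Z u \is a fin_num by rewrite ge0_fin_numE// lt_neqAle Zf leey.
    have fZ0 : 0 <= fine (Z u) by exact: fine_ge0.
    have msl := measurable_slice u mF.
    have msq : measurable_fun (`[c, d] : set R) (fun x => Num.sqrt (h x)).
      by apply: measurable_funTS; apply: measurableT_comp => //; apply: continuous_measurable_fun; exact: sqrt_continuous.
    have q0 (x : R) : Num.sqrt (h x) != 0 by rewrite gt_eqF// sqrtr_gt0.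
    have mf : measurable_fun (`[c, d] : set R) (fun x => F (u, x) / Num.sqrt (h x)).
      apply: measurable_funM; first exact: measurable_funTS.
      rewrite (_ : (fun x => _) = (fun x : R => Num.sqrt (h x) `^ (-1))); last first.
        by apply/funext => x; rewrite powR_inv1// sqrtr_ge0.
      exact: measurable_fun_powR.
    have CS := @cauchy_schwarz _ _ R leb `[c, d]%classic (fun x => F (u, x) / Num.sqrt (h x))
      (fun x => Num.sqrt (h x)) (Num.sqrt (fine (Z u))) (Num.sqrt H) (measurable_itv _) mf msq (sqrtr_ge0 _) (sqrtr_ge0 _).
    have {}CS : (Y u <= (Num.sqrt (fine (Z u)) * Num.sqrt H)%:E)%E.
      have -> : Y u = (\int[leb]_(x in `[c, d]) `|F (u, x) / Num.sqrt (h x) * Num.sqrt (h x)|%:E)%E.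
        by apply: eq_integral => x _; rewrite mulfVK// ger0_norm.
      apply: CS.
      - rewrite sqr_sqrtr// fineK// le_eqVlt; apply/orP; left; apply/eqP.
        by apply: eq_integral => x _; rewrite exprMn exprVn sqr_sqrtr// ltW.
      - rewrite sqr_sqrtr ?(ltW H0)//; apply: le_trans hH.
        rewrite le_eqVlt; apply/orP; left; apply/eqP.
        by apply: eq_integral => x _; rewrite sqr_sqrtr// ltW.
    apply: (@le_trans _ _ ((Num.sqrt (fine (Z u)) * Num.sqrt H)%:E * (Num.sqrt (fine (Z u)) * Num.sqrt H)%:E)%E).
      exact: lee_pmul.
    rewrite -(fineK Zf) -!EFinM lee_fin -expr2 exprMn !sqr_sqrtr ?(ltW H0)//.
    by rewrite mulrC.
  apply: (@le_trans _ _ (\int[leb]_u (H%:E * Z u))%E).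
    apply: ge0_le_integral => //.
    - by move=> u _; exact: (mule_ge0 (Y0 u) (Y0 u)).
    - exact: emeasurable_funM.
    - exact: measurable_funeM.
    - by move=> u _; exact: YZ.
  rewrite ge0_integralZl//; last by rewrite lee_fin ltW.
  rewrite expr2 EFinM; apply: lee_wpmul2l; first by rewrite lee_fin ltW.
  apply: le_trans hH; rewrite restrictE (funext ZE).
  have -> : (\int[leb]_u \int[leb]_x (K (u, x))%:E = \int[leb]_x \int[leb]_u (K (u, x))%:E)%E.
    apply: (@fubini_tonelli _ _ _ _ _ leb leb (fun p => (K p)%:E)); first exact/measurable_EFinP.
    by move=> p; rewrite lee_fin.
  apply: ae_ge0_le_integral => //.
  - by move=> x _; apply: integral_ge0 => u _; rewrite lee_fin.
  - apply: (@measurable_fun_fubini_tonelli_G _ _ _ _ _ leb (fun p => (K p)%:E)) => //.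
    exact/measurable_EFinP.
  - by move=> x _; rewrite lee_fin mulr_ge0// ltW.
  - by apply/measurable_EFinP; apply: measurable_funM.
  move: gfin; apply: filterS; first exact: (ae_filter_ringOfSetsType leb).
  move=> x + _; rewrite /K /= indicE; have [xA|xA] := boolP (x \in `[c, d]%classic); last first.
    by move=> _; under eq_integral do rewrite mulr0; rewrite integral0 mulr0.
  move=> /(_ (set_mem xA)) gf; rewrite mulr1.
  have gy : (g x < +oo)%E by apply: (@lty_poweRy _ _ (1 / 2)) => //; rewrite ?gt_eqF// -ge0_fin_numE// poweR_ge0.
  have gfn : g x \is a fin_num by rewrite ge0_fin_numE.
  have rE : r x ^+ 2 = fine (g x) by rewrite /r fine_poweR powR_half_sq// fine_ge0.
  under eq_integral do rewrite mulr1 mulrC EFinM.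
  rewrite ge0_integralZl//; last 3 first.
  - by apply/measurable_EFinP; apply: measurable_funX; apply: measurableT_comp => //; exact: measurable_pair2.
  - by move=> u _; rewrite lee_fin sqr_ge0.
  - by rewrite lee_fin invr_ge0 ltW.
  rewrite -/(g x) -(fineK gfn) -EFinM lee_fin -rE mulrC ler_pdivrMr// -expr2.
  by rewrite lerXn2r ?nnegrE ?r0 ?(ltW (h0 x))// lerDl ltW.
apply/lee_addgt0Pr => e e0.
pose k := d - c + 1.
have k0 : 0 < k by rewrite ltr_wpDl// subr_ge0.
have D0 : 0 < 2 * I * k + k ^+ 2 by rewrite ltr_wpDl ?exprn_gt0// mulr_ge0 ?(ltW k0)// mulr_ge0.
(* (I + eta k)^2 exceeds I^2 by at most eta (2 I k + k^2) if eta <= 1 *)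
pose eta := Num.min 1 (e / (2 * I * k + k ^+ 2)).
have eta0 : 0 < eta by rewrite lt_min ltr01 divr_gt0.
apply: (le_trans (key eta eta0)); rewrite -EFinD lee_fin -/k.
have e1 : eta <= 1 by rewrite ge_min lexx.
have e2 : eta * (2 * I * k + k ^+ 2) <= e by rewrite -ler_pdivlMr// ge_min lexx orbT.
have -> : (I + eta * k) ^+ 2 = I ^+ 2 + (eta * (2 * I * k) + eta * k ^+ 2 * eta) by ring.
rewrite lerD2l; apply: le_trans e2; rewrite [leRHS]mulrDr; apply: lerD => //; apply: ler_piMr => //.
by rewrite mulr_ge0 ?sqr_ge0// ltW.
Qed.
End minkowski.

(** * The source along characteristics *)

Section source.
Context (R : realType).
Local Notation leb := (@lebesgue_measure R).
Variables (mu eps s : R) (phi phiu phiub G : R -> R -> R) (psi0 psi1 : R -> R).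
Hypothesis sol : solution mu phi phiu phiub G eps psi0 psi1.
Hypothesis s0 : 0 <= s.

Definition region_source (p : R * R) : R := `|G p.1 p.2| * \1_(@region R) p.

Lemma region_source_ge0 p : 0 <= region_source p.
Proof. by rewrite mulr_ge0// indicE. Qed.

Lemma measurable_region_source : measurable_fun setT region_source.
Proof.
have Er : @region R = \bigcup_n (@region R `&` [set p | p.1 <= n%:R]).
  apply/seteqP; split => [p rp|p [n _ []//]].
  exists (Num.bound `|p.1|) => //; split => //=.
  by apply: (le_trans (ler_norm _)); apply/ltW/archi_boundP.
have mr : measurable (@region R).
  by rewrite Er; apply: bigcupT_measurable => n; exact: measurable_region_le.
have mG : measurable_fun (@region R) (fun p => G p.1 p.2).
  rewrite Er; apply/measurable_fun_bigcup => n; first exact: measurable_region_le.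
  by apply/measurable_EFinP; apply: measurable_int (sol_source sol n%:R).
have -> : region_source = (fun p => `|G p.1 p.2|) \_ (@region R).
  by apply/funext => p; rewrite /region_source patchE indicE; case: ifPn => _; rewrite ?mulr1 ?mulr0.
apply: ((measurable_restrictT (fun p => `|G p.1 p.2|) mr).1 _).
exact: measurableT_comp.
Qed.

Lemma measurable_plane_weight : measurable_fun setT (fun p : R * R => weight s p.1 p.2).
Proof.
apply: measurable_funM; apply: measurable_fun_powR.
  exact: measurable_fst.
by apply: measurable_funB; [exact: measurable_fst|exact: measurable_snd].
Qed.

Lemma weighted_sqE x : (weighted_sq s G x = \int[leb]_u (weight s u x * region_source (u, x) ^+ 2)%:E)%E.
Proof.
rewrite /weighted_sq [LHS]integral_mkcond; apply: eq_integral => u _.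
rewrite patchE /region_source indicE mem_setE in_itv/= andbT /weight.
have -> : ((u, x) \in @region R) = (lowu x <= u) by apply/idP/idP; rewrite inE.
by case: ifPn => _; rewrite ?mulr1 ?mulr0 ?expr0n/= ?mulr0// real_normK// num_real.
Qed.

Lemma measurable_weighted_sq : measurable_fun setT (fun x => weighted_sq s G x `^ (1 / 2))%E.
Proof.
apply: (@measurableT_comp _ _ _ _ _ _ (fun z : \bar R => z `^ (1 / 2))%E _ (weighted_sq s G)).
  exact: measurable_poweR.
rewrite (funext weighted_sqE).
apply: (@measurable_fun_fubini_tonelli_G _ _ _ _ _ leb (fun p => (weight s p.1 p.2 * region_source p ^+ 2)%:E)) => //.
  apply/measurable_EFinP; apply: measurable_funM; first exact: measurable_plane_weight.
  by apply: measurable_funX; exact: measurable_region_source.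
by move=> p; rewrite lee_fin mulr_ge0 ?weight_ge0 ?sqr_ge0.
Qed.

Definition source_mass ub u : \bar R :=
  (\int[leb]_(x in `[(1 / 2)%R, ub]) (region_source (u, x))%:E)%E.

(** Minkowski's inequality; the weight at ub is at most the weight at x <= ub, so
the inner norms are at most those of the source on the line ub = x. *)
Lemma source_norm (Ub ub I : R) : 1 / 2 <= ub -> ub <= Ub -> 0 <= I ->
  (\int[leb]_(x in `[(1 / 2)%R, Ub]) weighted_sq s G x `^ (1 / 2) <= I%:E)%E ->
  (\int[leb]_(u in `[lowu ub, +oo[) ((weight s u ub)%:E * (source_mass ub u * source_mass ub u))
    <= (I ^+ 2)%:E)%E.
Proof.
move=> ub1 ub2 I0 GI.
pose w (u : R) : R := weight s u ub `^ (1 / 2) * \1_`[lowu ub, +oo[ u.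
have w0 u : 0 <= w u by rewrite mulr_ge0 ?powR_ge0// indicE.
have mw : measurable_fun setT w.
  apply: measurable_funM; last exact: measurable_indic.
  by apply: measurable_fun_powR; exact: measurable_weight.
pose F (p : R * R) := w p.1 * region_source p.
have mF : measurable_fun setT F.
  apply: measurable_funM; last exact: measurable_region_source.
  by apply: measurableT_comp => //; exact: measurable_fst.
have F0 p : 0 <= F p by rewrite mulr_ge0 ?region_source_ge0.
have FI : (\int[leb]_(x in `[(1 / 2)%R, ub]) ((\int[leb]_u (F (u, x) ^+ 2)%:E) `^ (1 / 2)) <= I%:E)%E.
  apply: le_trans GI.
  apply: (@le_trans _ _ (\int[leb]_(x in `[(1 / 2)%R, ub]) weighted_sq s G x `^ (1 / 2))%E); last first.
    apply: ge0_subset_integral => //.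
    - by apply: measurable_funTS; exact: measurable_weighted_sq.
    - by move=> x _; exact: poweR_ge0.
    - by apply: subset_itv; rewrite bnd_simp.
  have F20 x : (0 <= \int[leb]_u (F (u, x) ^+ 2)%:E)%E.
    by apply: integral_ge0 => u _; rewrite lee_fin sqr_ge0.
  apply: ge0_le_integral => //.
  - by move=> x _; exact: poweR_ge0.
  - apply: measurable_funTS.
    apply: (@measurableT_comp _ _ _ _ _ _ (fun z : \bar R => z `^ (1 / 2))%E _ (fun x => \int[leb]_u (F (u, x) ^+ 2)%:E)%E).
      exact: measurable_poweR.
    apply: (@measurable_fun_fubini_tonelli_G _ _ _ _ _ leb (fun p => (F p ^+ 2)%:E)) => //.
      by apply/measurable_EFinP; exact: measurable_funX.
    by move=> p; rewrite lee_fin sqr_ge0.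
  - by apply: measurable_funTS; exact: measurable_weighted_sq.
  move=> x /=; rewrite in_itv/= => /andP[x1 xub].
  have h12 : (0 : R) <= 1 / 2 by rewrite divr_ge0.
  apply: (gt0_ler_poweR h12); rewrite ?in_itv/= ?leey ?andbT//.
    by rewrite weighted_sqE; apply: integral_ge0 => u _; rewrite lee_fin mulr_ge0 ?weight_ge0 ?sqr_ge0.
  rewrite weighted_sqE; apply: ge0_le_integral => //.
  - by move=> u _; rewrite lee_fin sqr_ge0.
  - apply/measurable_EFinP; apply: measurable_funX; apply: (measurableT_comp mF).
    exact: measurable_pair2.
  - apply/measurable_EFinP; apply: measurable_funM; first exact: measurable_weight.
    apply: measurable_funX; apply: (measurableT_comp measurable_region_source).
    exact: measurable_pair2.
  move=> u _; rewrite lee_fin /F /w /= !exprMn powR_half_sq ?weight_ge0//.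
  apply: ler_wpM2r; first by rewrite mulr_ge0 ?sqr_ge0.
  rewrite indicE mem_setE in_itv/= andbT; have [lu|lu] := boolP (lowu ub <= u); last by rewrite expr0n/= mulr0 weight_ge0.
  rewrite expr1n mulr1.
  apply: ler_wpM2l; first exact: powR_ge0.
  have [_ l2 _] := lowuP ub.
  by apply: le_powR_pos => //; slra.
have := minkowski_integral ub1 I0 mF F0 FI.
apply: le_trans; rewrite [leLHS]integral_mkcond.
rewrite le_eqVlt; apply/orP; left; apply/eqP; apply: eq_integral => u _.
have -> : (\int[leb]_(x in `[(1 / 2)%R, ub]) (F (u, x))%:E = (w u)%:E * source_mass ub u)%E.
  rewrite /source_mass -ge0_integralZl//.
  - apply/measurable_EFinP; apply: measurable_funTS; exact: (measurable_slice u measurable_region_source).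
  - by move=> x _; rewrite lee_fin region_source_ge0.
  - by rewrite lee_fin.
rewrite muleACA -EFinM patchE /w indicE; have [lu|lu] := boolP (u \in _); last by rewrite mulr0 mul0r mul0e.
by rewrite !mulr1 -expr2 powR_half_sq// weight_ge0.
Qed.

Hypothesis phi_vanish : forall u ub, lowu ub <= u -> ub <= 1 / 2 -> phi u ub = 0.

Local Notation a := (mu * (2 - mu) / 4).
Local Notation rhs := (phi_uub_rhs mu phi G).

(** The a.e. derivative of a vanishing absolutely continuous function is 0, and
countably many bounded intervals exhaust the half line. *)
Lemma ae_phiu_vanish : {ae leb, forall u : R, 3 / 2 < u -> phiu u (1 / 2) = 0}.
Proof.
have l12 := lowu_half R.
suff : {ae leb, forall u : R, forall n : nat, 3 / 2 < u -> u < n.+2%:R -> phiu u (1 / 2) = 0}.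
  apply: filterS; first exact: (ae_filter_ringOfSetsType leb).
  move=> u h u1; apply: (h (Num.bound `|u|)) => //.
  apply: (le_lt_trans (ler_norm _)); apply: (lt_le_trans (archi_boundP (normr_ge0 _))).
  by rewrite ler_nat; do 2 apply: leqW.
apply: (@ae_foralln _ _ _ leb (fun n (u : R) => 3 / 2 < u -> u < n.+2%:R -> phiu u (1 / 2) = 0)) => n.
have h1 : 3 / 2 < n.+2%:R :> R.
  by apply: (@lt_le_trans _ _ 2%:R); [slra|rewrite ler_nat].
have h2 : lowu (1 / 2) <= n.+2%:R :> R by rewrite l12 ltW.
have := sol_u sol h2; rewrite l12 => /(primitive_is_derive h1).
apply: filterS; first exact: (ae_filter_ringOfSetsType leb).
move=> u h u1 u2; have {}h := h u1 u2.
have h0 : is_derive u (1 : R) (cst 0 : R -> R) (phiu u (1 / 2)).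
  apply: near_eq_is_derive h; near=> y.
  rewrite phi_vanish// l12; apply: ltW; near: y; exact: lt_nbhsr.
by have := @derive_val _ _ _ _ _ _ _ h0; rewrite derive_cst.
Unshelve. all: by end_near. Qed.

(** What the ray of abscissa u carries when it enters ub >= 1/2: the trace on the
initial line for u <= 3/2, and 0 beyond, by the vanishing on ub = 1/2. *)
Definition trace_start u : R := if u <= 3 / 2 then trace_u mu phi phiu G u else 0.

Definition source_term u ub : R := phiu u ub + potential_term a (clamp phi) u ub.

(** Integrating the equation along the ray of abscissa [u], from the initial
line if [u <= 3 / 2] and from the line ub = 1 / 2 otherwise. *)
Lemma source_term_start : {ae leb, forall u : R, forall ub, 1 / 2 <= ub -> lowu ub <= u ->
  (`|source_term u ub - trace_start u|%:E <= source_mass ub u)%E}.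
Proof.
have cphi := continuous_clamp (sol_cont sol).
apply: (ae_imp2 _ (sol_eq_u sol) (ae_imp2 (fun x p q => conj p q) (trace_uE sol) ae_phiu_vanish)).
move=> u h1 [h2 h3] ub ub12 lu.
have [l1 l2 l3] := lowuP ub.
have u1 : 1 <= u by exact: le_trans lu.
have ubu : ub <= u by exact: le_trans lu.
have ub2 : 2 - u <= ub by move: l3 lu => /le_trans h /h; rewrite lerBlDr lerBlDl addrC.
have [irhs Erhs] := h1 u1.
set b := Num.max (1 / 2) (2 - u).
have bub : b <= ub by rewrite /b ge_max ub12.
have b12 : 1 / 2 <= b by rewrite /b le_max lexx.
have b2 : 2 - u <= b by rewrite /b le_max lexx orbT.
have b0 : 0 <= b by apply: le_trans b12; rewrite divr_ge0.
have u0 : 0 < u by apply: lt_le_trans u1.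
pose q x := clamp phi u x / (u + x) ^+ 2.
have iq : leb.-integrable `[b, ub] (EFin \o q).
  apply: continuous_compact_integrable; first exact: segment_compact.
  exact: continuous_potential.
have irhs' : leb.-integrable `[b, ub] (EFin \o rhs u) by exact: integrable_subitv irhs.
have iaq := integrable_itvZl (- a) iq.
have Gq x : b <= x -> x <= ub -> G u x = rhs u x - - a * q x.
  move=> bx xub; rewrite /q clampE; last first.
    rewrite lowu_le (le_trans xub)//=; move: (le_trans b2 bx); rewrite lerBlDr lerBlDl addrC.
    by rewrite -lerBlDl.
  rewrite /phi_uub_rhs; field.
  by rewrite gt_eqF// ltr_wpDr// (le_trans b0).
have iG : leb.-integrable `[b, ub] (EFin \o G u).
  apply: eq_integrable (integrable_itvB irhs' iaq) => //.
  by move=> x; rewrite inE/= in_itv/= => /andP[bx xub]; rewrite Gq.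
have key : source_term u ub - trace_start u = \int[leb]_(x in `[b, ub]) G u x.
  transitivity (\int[leb]_(x in `[b, ub]) (rhs u x - - a * q x)); last first.
    by apply: eq_Rintegral => x; rewrite inE/= in_itv/= => /andP[bx xub]; rewrite Gq.
  rewrite RintegralB// (@RintegralZl _ _ _ leb `[b, ub]%classic q)// mulNr opprK /source_term /potential_term.
  suff -> : phiu u ub = trace_start u + \int[leb]_(x in `[b, ub]) rhs u x.
    by rewrite -(addrA (trace_start u)) [LHS]addrC addKr.
  rewrite /trace_start; case: ifPn => [u32|]; last rewrite -ltNge => u32.
    have -> : b = 2 - u by apply/max_idPr; slra.
    by have [_ E] := h2 u1; rewrite E.
  have -> : b = 1 / 2 by apply/max_idPl; slra.
  by rewrite add0r -Erhs// ?h3 ?subr0//; slra.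
rewrite key; apply: (le_trans (le_normr_Rintegral_itv iG)).
rewrite /source_mass.
have mGr : measurable_fun setT (fun x => region_source (u, x)) by exact: (measurable_slice u measurable_region_source).
apply: (@le_trans _ _ (\int[leb]_(x in `[b, ub]) (region_source (u, x))%:E)%E); last first.
  apply: ge0_subset_integral => //.
  - by apply/measurable_EFinP; exact: measurable_funTS.
  - by move=> x _; rewrite lee_fin region_source_ge0.
  - by apply: subset_itv; rewrite bnd_simp.
rewrite le_eqVlt; apply/orP; left; apply/eqP; apply: eq_integral => x.
rewrite inE/= in_itv/= => /andP[bx xub]; rewrite /region_source indicE mem_set ?mulr1//.
rewrite /region/= lowu_le (le_trans xub)//=; move: (le_trans b2 bx); rewrite lerBlDr lerBlDl addrC.
by rewrite -lerBlDl.
Qed.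

End source.

(** * Flux control of solutions *)

Section flux.
Context (R : realType).
Local Notation leb := (@lebesgue_measure R).

Lemma integrable_itvD (f g : R -> R) (c d : R) :
  leb.-integrable `[c, d] (EFin \o f) -> leb.-integrable `[c, d] (EFin \o g) ->
  leb.-integrable `[c, d] (EFin \o (fun x => f x + g x)).
Proof.
move=> fi gi.
have : leb.-integrable `[c, d] ((EFin \o f) \+ (EFin \o g))%E.
  by apply: integrableD => //; exact: measurable_itv.
by apply: eq_integrable.
Qed.

Lemma Rintegral_itv_add (f g : R -> R) (c d : R) :
  leb.-integrable `[c, d] (EFin \o f) -> leb.-integrable `[c, d] (EFin \o g) ->
  \int[leb]_(x in `[c, d]) (f x + g x) = \int[leb]_(x in `[c, d]) f x + \int[leb]_(x in `[c, d]) g x.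
Proof. by move=> fi gi; rewrite RintegralD. Qed.

Lemma Rintegral_itv_sub (f g : R -> R) (c d : R) :
  leb.-integrable `[c, d] (EFin \o f) -> leb.-integrable `[c, d] (EFin \o g) ->
  \int[leb]_(x in `[c, d]) (f x - g x) = \int[leb]_(x in `[c, d]) f x - \int[leb]_(x in `[c, d]) g x.
Proof. by move=> fi gi; rewrite RintegralB. Qed.

Lemma measurable_cylinder (f : R -> R) (b : R) :
  (forall B, b <= B -> measurable_fun (`[b, B] : set R) f) -> measurable_fun (`[b, +oo[ : set R) f.
Proof.
move=> mf.
have -> : `[b, +oo[%classic = \bigcup_n (`[b, b + n%:R]%classic : set R).
  apply/seteqP; split => [x /=|x [n _]/=]; rewrite !in_itv/= ?andbT; last by case/andP.
  move=> bx; exists (Num.bound `|x - b|) => //=; rewrite in_itv/= bx -lerBlDl/=.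
  by apply: (le_trans (ler_norm _)); apply/ltW/archi_boundP.
by apply/measurable_fun_bigcup => n //; apply: mf; rewrite lerDl.
Qed.

(** [inv_weight] is the reciprocal of [weight] off the axis, which meets the ray
in one point. *)
Lemma weighted_cauchy_schwarz (s ub u1 u2 N J : R) (f : R -> R) :
  lowu ub <= u1 -> 0 <= N -> 0 <= J -> measurable_fun (`[lowu ub, +oo[ : set R) f ->
  (\int[leb]_(u in `[lowu ub, +oo[) (weight s u ub * f u ^+ 2)%:E <= (N ^+ 2)%:E)%E ->
  (\int[leb]_(u in `[u1, u2]) (inv_weight s u ub)%:E <= (J ^+ 2)%:E)%E ->
  (\int[leb]_(u in `[u1, u2]) `|f u|%:E <= (N * J)%:E)%E.
Proof.
move=> lu1 N0 J0 mf fN iJ.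
have [l1 l2 l3] := lowuP ub.
have sub12 : `]u1, u2[%classic `<=` (`[u1, u2]%classic : set R) by apply: subset_itv; rewrite bnd_simp.
have subl : `]u1, u2[%classic `<=` (`[lowu ub, +oo[%classic : set R) by apply: subset_itv; rewrite bnd_simp.
have m12 : measurable_fun (`]u1, u2[ : set R) f by apply: measurable_funS mf.
(* the open interval avoids the axis, where both weights can be 0 *)
rewrite integral_itv_bndoo; last by apply/measurable_EFinP; exact: measurableT_comp.
pose g u := Num.sqrt (weight s u ub) * f u.
pose h u := Num.sqrt (inv_weight s u ub).
have iw0 u : 0 <= inv_weight s u ub by rewrite mulr_ge0 ?powR_ge0.
have mw : measurable_fun setT (fun u : R => weight s u ub) by exact: measurable_weight.
have mi : measurable_fun setT (fun u : R => inv_weight s u ub) by exact: measurable_weight.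
have msq : measurable_fun setT (@Num.sqrt R) by apply: continuous_measurable_fun; exact: sqrt_continuous.
have mg : measurable_fun (`]u1, u2[ : set R) g.
  by apply: measurable_funM => //; apply: measurable_funTS; exact: (measurableT_comp msq mw).
have mh : measurable_fun (`]u1, u2[ : set R) h.
  by apply: measurable_funTS; exact: (measurableT_comp msq mi).
have gE u : g u ^+ 2 = weight s u ub * f u ^+ 2 by rewrite /g exprMn sqr_sqrtr// weight_ge0.
have CS := @cauchy_schwarz _ _ R leb `]u1, u2[%classic g h N J (measurable_itv _) mg mh N0 J0.
have -> : (\int[leb]_(u in `]u1, u2[) `|f u|%:E = \int[leb]_(u in `]u1, u2[) `|g u * h u|%:E)%E.
  apply: eq_integral => u; rewrite inE/= in_itv/= => /andP[u1u _].
  have u0 : 0 < u by apply: lt_trans u1u; apply: lt_le_trans lu1; exact: lt_le_trans l1.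
  have ub0 : 0 < u - ub by rewrite subr_gt0; apply: le_lt_trans u1u; exact: le_trans lu1.
  rewrite /g /h mulrAC -sqrtrM ?weight_ge0// /weight /inv_weight mulrACA.
  by rewrite -!powR_add// !subrr !powRr0 mulr1 sqrtr1 mul1r.
apply: CS.
- apply: le_trans fN; under eq_integral do rewrite gE.
  apply: ge0_subset_integral => //.
  + apply/measurable_EFinP; apply: measurable_funM; first exact: measurable_funTS.
    exact: measurable_funX.
  + by move=> u _; rewrite lee_fin mulr_ge0 ?weight_ge0 ?sqr_ge0.
- apply: le_trans iJ; under eq_integral do rewrite /h sqr_sqrtr//.
  apply: ge0_subset_integral => //.
  + by apply/measurable_EFinP; exact: measurable_funTS.
  + by move=> u _; rewrite lee_fin.
Qed.

Lemma measurable_partial_integral (K : R * R -> R) : measurable_fun setT K ->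
  measurable_fun setT (fun u => \int[leb]_x K (u, x)).
Proof.
move=> mK; apply: measurableT_comp => //.
have mE : measurable_fun setT (EFin \o K) by exact/measurable_EFinP.
rewrite (_ : (fun u => _) = (fun u => \int[leb]_x ((EFin \o K)^\+ (u, x)) - \int[leb]_x ((EFin \o K)^\- (u, x)))%E); last first.
  apply/funext => u; rewrite integralE; congr (_ - _)%E; apply: eq_integral => x _.
    by rewrite !funeposE.
  by rewrite !funenegE.
apply: emeasurable_funB.
  apply: (@measurable_fun_fubini_tonelli_F _ _ _ _ _ leb ((EFin \o K)^\+)%E) => //.
  exact: measurable_funepos.
apply: (@measurable_fun_fubini_tonelli_F _ _ _ _ _ leb ((EFin \o K)^\-)%E) => //.
exact: measurable_funeneg.
Qed.

Lemma measurable_potential a (phi : R -> R -> R) ub :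
  continuous (fun p : R * R => phi p.1 p.2) -> 1 / 2 <= ub ->
  measurable_fun (`[lowu ub, +oo[ : set R) (fun u => potential_term a phi u ub).
Proof.
move=> cphi ub12; apply: measurable_funM; first exact: measurable_cst.
pose D : set (R * R) := [set p | Num.max (1 / 2) (2 - p.1) <= p.2] `&` [set p | p.2 <= ub].
have m1 : measurable_fun [set: R * R] (fun x => x.1) by exact: measurable_fst.
have m2 : measurable_fun [set: R * R] (fun x => x.2) by exact: measurable_snd.
have mD : measurable D.
  rewrite -[X in measurable (X `&` _)]setTI -[X in measurable (_ `&` X)]setTI.
  apply: measurableI; apply: measurable_fun_le => //.
  by apply: measurable_maxr => //; exact: measurable_funB.
pose K (p : R * R) := phi p.1 p.2 * (p.1 + p.2) `^ (- 2) * \1_D p.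
have mK : measurable_fun setT K.
  apply: measurable_funM; last exact: measurable_indic.
  apply: measurable_funM; first exact: continuous_plane_measurable.
  by apply: measurable_fun_powR; exact: measurable_funD.
apply: (eq_measurable_fun (fun u => \int[leb]_x K (u, x))); last first.
  by apply: measurable_funTS; exact: measurable_partial_integral.
move=> u; rewrite inE/= in_itv/= andbT => lu.
rewrite [RHS]Rintegral_mkcond; apply: eq_Rintegral => x _.
rewrite patchE /K indicE mem_setE in_itv/=.
have -> : ((u, x) \in D) = (Num.max (1 / 2) (2 - u) <= x <= ub).
  by apply/idP/idP; rewrite inE/D/=; [move=> [-> ->]|move=> /andP[]].
have [/andP[bx xub]|nb] := boolP (_ <= x <= ub); last by rewrite mulr0.
have x0 : 0 <= x by apply: le_trans bx; rewrite le_max divr_ge0.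
have u0 : 0 < u by have [l1 _ _] := lowuP ub; apply: lt_le_trans lu; exact: lt_le_trans l1.
by rewrite mulr1/= powRN2// addr_ge0// ltW.
Qed.

End flux.

Section solution_flux.
Context (R : realType).
Local Notation leb := (@lebesgue_measure R).
Variables (mu eps s M Ub I : R) (phi phiu phiub G : R -> R -> R) (psi0 psi1 : R -> R).
Variable dpsi0 : 'I_3 -> R * R * R -> R.
Hypothesis sol : solution mu phi phiu phiub G eps psi0 psi1.
Hypotheses (s0 : 0 <= s) (s1 : s <= 1) (eps0 : 0 < eps) (I0 : 0 <= I) (M0 : 0 <= M).
Hypothesis phi_vanish : forall u ub, lowu ub <= u -> ub <= 1 / 2 -> phi u ub = 0.
Hypothesis H1psi0 : in_H1 (radial psi0) dpsi0.
Hypothesis L2psi1 : in_L2 (radial psi1).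
Hypothesis source_I :
  (\int[leb]_(x in `[(1 / 2)%R, Ub]) weighted_sq s G x `^ (1 / 2) <= I%:E)%E.
Hypothesis M_large : 81 / (4 * sphere_area R) * (eps ^+ 2 * data_energy psi1 dpsi0) + 2 * I ^+ 2 <= M ^+ 2.
Hypothesis M_init : eps * Num.sqrt (2 / sphere_area R * gradient_energy dpsi0) <= M.

Local Notation a := (mu * (2 - mu) / 4).
Local Notation src := (source_term mu phi phiu).
Local Notation pot := (potential_term a (clamp phi)).
Local Notation start := (trace_start mu phi phiu G).

Let cphi : continuous (fun p : R * R => clamp phi p.1 p.2) := continuous_clamp (sol_cont sol).

Lemma measurable_phiu ub : measurable_fun (`[lowu ub, +oo[ : set R) (phiu ^~ ub).
Proof.
apply: measurable_cylinder => B lB; apply/measurable_EFinP.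
by have [i _] := sol_u sol lB; exact: measurable_int i.
Qed.

Lemma measurable_source_term ub : 1 / 2 <= ub ->
  measurable_fun (`[lowu ub, +oo[ : set R) (src ^~ ub).
Proof.
by move=> ub12; apply: measurable_funD; [exact: measurable_phiu|exact: measurable_potential].
Qed.

Lemma measurable_start ub : measurable_fun (`[lowu ub, +oo[ : set R) start.
Proof.
have h32 := three_halves_le2 R.
have mtr : measurable_fun (`[1%R, (3 / 2)%R] : set R) (trace_u mu phi phiu G).
  apply/measurable_EFinP; exact: measurable_int (integrable_subitv (lexx 1) h32 (integrable_trace_u sol)).
apply: (eq_measurable_fun (trace_u mu phi phiu G \_ `[1%R, (3 / 2)%R])); last first.
  by apply: measurable_funTS; exact: ((measurable_restrictT _ (measurable_itv _)).1 mtr).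
move=> u; rewrite inE/= in_itv/= andbT => lu; have [l1 _ _] := lowuP ub.
by rewrite /trace_start patchE mem_setE in_itv/= (le_trans l1 lu).
Qed.

(** The trace is only present for u <= 3/2, where the weight is at most
(3/2)^4 = 81/16. *)
Lemma start_L2 ub : 1 / 2 <= ub ->
  (\int[leb]_(u in `[lowu ub, +oo[) (weight s u ub * start u ^+ 2)%:E <=
   (81 / 16 * (2 / sphere_area R * eps ^+ 2 * data_energy psi1 dpsi0))%:E)%E.
Proof.
move=> ub12; have [l1 l2 l3] := lowuP ub.
have T := trace_u_L2 sol eps0 phi_vanish H1psi0 L2psi1.
have k0 : (0 : R) <= 81 / 16 by rewrite divr_ge0.
rewrite EFinM; apply: le_trans (lee_wpmul2l _ T); last by rewrite lee_fin.
have h32 := three_halves_le2 R.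
have mtr : measurable_fun (`[1%R, (3 / 2)%R] : set R) (trace_u mu phi phiu G).
  apply/measurable_EFinP; exact: measurable_int (integrable_subitv (lexx 1) h32 (integrable_trace_u sol)).
rewrite -ge0_integralZl//; first last.
- by move=> u _; rewrite lee_fin sqr_ge0.
- by apply/measurable_EFinP; exact: measurable_funX.
rewrite [leRHS]integral_mkcond.
pose P : R -> \bar R := (fun u => (81 / 16)%:E * (trace_u mu phi phiu G u ^+ 2)%:E)%E \_ `[1%R, (3 / 2)%R].
have P0 u : (0 <= P u)%E by rewrite /P patchE; case: ifPn => // _; rewrite mule_ge0// lee_fin// sqr_ge0.
have mP : measurable_fun setT P.
  apply: (measurable_restrictT _ (measurable_itv _)).1.
  by apply: measurable_funeM; apply/measurable_EFinP; exact: measurable_funX.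
apply: (@le_trans _ _ (\int[leb]_(u in `[lowu ub, +oo[) P u)%E); last first.
  by apply: ge0_subset_integral.
apply: ge0_le_integral => //.
- by move=> u _; rewrite lee_fin mulr_ge0 ?weight_ge0 ?sqr_ge0.
- apply/measurable_EFinP; apply: measurable_funM; first exact: measurable_weight.
  by apply: measurable_funX; exact: measurable_start.
- exact: measurable_funTS.
move=> u; rewrite /= in_itv/= andbT => lu.
have u1 : 1 <= u by exact: le_trans lu.
rewrite /P patchE mem_setE in_itv/= u1 /trace_start.
case: ifPn => u32; last by rewrite expr0n mulr0.
rewrite -EFinM lee_fin; apply: ler_wpM2r; first exact: sqr_ge0.
apply: (@le_trans _ _ (u `^ (4 * s))).
  by apply: weight_le => //; [slra|exact: le_trans lu|slra].
apply: (@le_trans _ _ (u `^ 4%:R)).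
  by apply: ler_powR => //; rewrite -[leRHS]mulr1 ler_wpM2l.
rewrite powR_mulrn; last by slra.
have -> : 81 / 16 = (3 / 2) ^+ 4 :> R by field.
by rewrite lerXn2r ?nnegrE//; slra.
Qed.

Lemma measurable_source_mass ub : measurable_fun setT (source_mass G ub).
Proof.
have -> : source_mass G ub = (fun u => \int[leb]_x (region_source G (u, x) * \1_`[(1 / 2)%R, ub] x)%:E)%E.
  apply/funext => u; rewrite /source_mass [LHS]integral_mkcond; apply: eq_integral => x _.
  by rewrite patchE indicE; case: ifPn => _; rewrite ?mulr1 ?mulr0.
apply: (@measurable_fun_fubini_tonelli_F _ _ _ _ _ leb (fun p => (region_source G p * \1_`[(1 / 2)%R, ub] p.2)%:E)).
  apply/measurable_EFinP; apply: measurable_funM; first exact: (measurable_region_source sol).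
  by apply: measurableT_comp => //; exact: measurable_snd.
by move=> p; rewrite lee_fin mulr_ge0 ?region_source_ge0// indicE.
Qed.

Lemma source_term_L2 ub : 1 / 2 <= ub -> ub <= Ub ->
  (\int[leb]_(u in `[lowu ub, +oo[) (weight s u ub * src u ub ^+ 2)%:E <= (M ^+ 2)%:E)%E.
Proof.
move=> ub12 ubU.
have S := start_L2 ub12.
have N := source_norm sol s0 ub12 ubU I0 source_I.
pose V u := ((weight s u ub)%:E * (source_mass G ub u * source_mass G ub u))%E.
pose T u : \bar R := (weight s u ub * start u ^+ 2)%:E.
have sm0 u : (0 <= source_mass G ub u)%E by apply: integral_ge0 => x _; rewrite lee_fin region_source_ge0.
have V0 u : (0 <= V u)%E by rewrite mule_ge0 ?lee_fin ?weight_ge0// mule_ge0.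
have T0 u : (0 <= T u)%E by rewrite lee_fin mulr_ge0 ?weight_ge0 ?sqr_ge0.
have mT : measurable_fun (`[lowu ub, +oo[ : set R) T.
  apply/measurable_EFinP; apply: measurable_funM; first exact: measurable_weight.
  by apply: measurable_funX; exact: measurable_start.
have mV : measurable_fun (`[lowu ub, +oo[ : set R) V.
  apply: emeasurable_funM; first by apply/measurable_EFinP; exact: measurable_weight.
  by apply: measurable_funTS; apply: emeasurable_funM; exact: measurable_source_mass.
apply: (@le_trans _ _ (\int[leb]_(u in `[lowu ub, +oo[) (2%:E * T u + 2%:E * V u))%E).
  apply: ae_ge0_le_integral => //.
  - by move=> u _; rewrite lee_fin mulr_ge0 ?weight_ge0 ?sqr_ge0.
  - apply/measurable_EFinP; apply: measurable_funM; first exact: measurable_weight.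
    by apply: measurable_funX; exact: measurable_source_term.
  - by move=> u _; rewrite adde_ge0// mule_ge0.
  - by apply: emeasurable_funD; exact: measurable_funeM.
  have := source_term_start sol phi_vanish.
  apply: filterS; first exact: (ae_filter_ringOfSetsType leb).
  move=> u h; rewrite /= in_itv/= andbT => lu; have {h} := h ub ub12 lu.
  rewrite /V /T; case: (source_mass G ub u) (sm0 u) => [n|_ _|]//.
    move=> n0 h; rewrite -!EFinM -EFinD lee_fin; rewrite !lee_fin in n0 h.
    have -> : 2 * (weight s u ub * start u ^+ 2) + 2 * (weight s u ub * (n * n)) =
       weight s u ub * (2 * start u ^+ 2 + 2 * (n * n)) by ring.
    apply: ler_wpM2l; first exact: weight_ge0.
    have : (src u ub - start u) ^+ 2 <= n ^+ 2.
      by rewrite -(real_normK (num_real (src u ub - start u))) lerXn2r ?nnegrE.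
    have := sqr_ge0 (src u ub - 2 * start u).
    move: (src u ub) (start u) => p q h1 h2.
    have -> : p ^+ 2 = 2 * q ^+ 2 + 2 * (p - q) ^+ 2 - (p - 2 * q) ^+ 2 by ring.
    rewrite lerBlDr; apply: (@le_trans _ _ (2 * q ^+ 2 + 2 * (n * n))); last by rewrite lerDl.
    by rewrite lerD2l ler_pM2l// -expr2.
  have [w0|w0] := eqVneq (weight s u ub) 0; first by rewrite w0 !mul0r !mul0e mule0 adde0.
  have wp : 0 < weight s u ub by rewrite lt_neqAle eq_sym w0 weight_ge0.
  by rewrite mulyy gt0_muley ?lte_fin// gt0_muley ?lte_fin// addey ?leey// -EFinM.
rewrite ge0_integralD//; first last.
- exact: measurable_funeM.
- by move=> u _; rewrite mule_ge0.
- exact: measurable_funeM.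
- by move=> u _; rewrite mule_ge0.
rewrite ge0_integralZl// ge0_integralZl//.
apply: (le_trans (leeD (lee_wpmul2l _ S) (lee_wpmul2l _ N))) => //.
rewrite -!EFinM -EFinD lee_fin.
apply: le_trans M_large.
rewrite lerD2r le_eqVlt; apply/orP; left; apply/eqP.
by field; rewrite gt_eqF// sphere_area_gt0.
Qed.

Lemma solution_cs ub u1 u2 N J : lowu ub <= u1 -> u1 <= u2 -> 0 <= N -> 0 <= J ->
    (weighted_sq s phiu ub <= (N ^+ 2)%:E)%E ->
    (\int[leb]_(u in `[u1, u2]) (inv_weight s u ub)%:E <= (J ^+ 2)%:E)%E ->
    `|clamp phi u2 ub - clamp phi u1 ub| <= N * J.
Proof.
move=> lu1 u12 N0 J0 wN iJ.
have lu2 : lowu ub <= u2 by exact: le_trans u12.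
have [ip Ep] := sol_u sol lu2.
rewrite !clampE// Ep// -lee_fin.
apply: (le_trans (le_normr_Rintegral_itv (integrable_subitv lu1 (lexx u2) ip))).
have wN' : (\int[leb]_(u in `[lowu ub, +oo[) (weight s u ub * (phiu ^~ ub) u ^+ 2)%:E <= (N ^+ 2)%:E)%E by exact: wN.
have CS := weighted_cauchy_schwarz lu1 N0 J0 (@measurable_phiu ub) wN' iJ.
exact: CS.
Qed.

Lemma solution_step ub u1 u2 J c1 c2 c3 : 1 / 2 <= ub -> ub <= Ub ->
    lowu ub <= u1 -> u1 <= u2 -> 0 <= J ->
    (\int[leb]_(u in `[u1, u2]) (inv_weight s u ub)%:E <= (J ^+ 2)%:E)%E ->
    (forall u, u1 <= u -> u <= u2 ->
      `|pot u ub - c1 / u ^+ 2| <= c2 / u ^+ 2 + 2 * c3 / u ^+ 3) ->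
    `|clamp phi u2 ub - clamp phi u1 ub + c1 * (u1^-1 - u2^-1)| <=
      M * J + (c2 * (u1^-1 - u2^-1) + c3 * (u1 ^- 2 - u2 ^- 2)).
Proof.
move=> ub12 ubU lu1 u12 J0 iJ hP.
have [l1 l2 l3] := lowuP ub.
have cancel (x y z : R) : x + y = (x + z) - (z - y) by ring.
have u10 : 0 < u1 by apply: lt_le_trans lu1; exact: lt_le_trans l1.
have lu2 : lowu ub <= u2 by exact: le_trans u12.
have [ip Ep] := sol_u sol lu2.
have ip' := integrable_subitv lu1 (lexx u2) ip.
have [iq Eq] := integral_inv23 c2 c3 u10 u12.
have [iq1 Eq1] := integral_inv23 c1 0 u10 u12.
have iq1' : leb.-integrable `[u1, u2] (EFin \o (fun u => c1 / u ^+ 2)).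
  by apply: eq_integrable iq1 => // u _; rewrite mulr0 mul0r addr0.
have Eq1' : \int[leb]_(u in `[u1, u2]) (c1 / u ^+ 2) = c1 * (u1^-1 - u2^-1).
  rewrite -[RHS]addr0 -[X in _ = _ + X](mul0r (u1 ^- 2 - u2 ^- 2)) -Eq1.
  by apply: eq_Rintegral => u _; rewrite mulr0 mul0r addr0.
have mpot : measurable_fun (`[u1, u2] : set R) (fun u => pot u ub).
  apply: measurable_funS (measurable_potential a cphi ub12) => //.
  by apply: subset_itv; rewrite bnd_simp.
have idiff : leb.-integrable `[u1, u2] (EFin \o (fun u => pot u ub - c1 / u ^+ 2)).
  apply: le_integrable iq => //.
    apply/measurable_EFinP; apply: measurable_funB => //.
    by apply/measurable_EFinP; exact: measurable_int iq1'.
  move=> u; rewrite /= in_itv/= => /andP[h1 h2]; rewrite lee_fin.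
  by apply: (le_trans (hP u h1 h2)); exact: ler_norm.
have ipot : leb.-integrable `[u1, u2] (EFin \o (fun u => pot u ub)).
  apply: eq_integrable (integrable_itvD idiff iq1') => // u _.
  by rewrite /= subrK.
have isrc : leb.-integrable `[u1, u2] (EFin \o (src ^~ ub)).
  exact: (integrable_itvD ip' ipot).
have -> : clamp phi u2 ub - clamp phi u1 ub + c1 * (u1^-1 - u2^-1) =
    \int[leb]_(u in `[u1, u2]) src u ub - \int[leb]_(u in `[u1, u2]) (pot u ub - c1 / u ^+ 2).
  rewrite (clampE _ lu2) (clampE _ lu1) (Ep _ _ lu1 u12 (lexx _)).
  rewrite (Rintegral_itv_sub ipot iq1') (Rintegral_itv_add ip' ipot) Eq1'.
  exact: cancel.
apply: (le_trans (ler_normB _ _)); apply: lerD.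
  rewrite -lee_fin; apply: (le_trans (le_normr_Rintegral_itv isrc)).
  exact: (weighted_cauchy_schwarz lu1 M0 J0 (measurable_source_term ub12) (source_term_L2 ub12 ubU) iJ).
rewrite -Eq -lee_fin; apply: (le_trans (le_normr_Rintegral_itv idiff)).
rewrite /Rintegral fineK; last exact: integrable_fin_num iq.
apply: ge0_le_integral => //.
- apply/measurable_EFinP; apply: measurableT_comp => //; apply/measurable_EFinP.
  exact: measurable_int idiff.
- exact: measurable_int iq.
- by move=> u; rewrite /= in_itv/= => /andP[h1 h2]; rewrite lee_fin hP.
Qed.

Lemma weighted_sq_split ub (k : \bar R) : 1 / 2 <= ub -> ub <= Ub ->
  (\int[leb]_(u in `[lowu ub, +oo[) (weight s u ub * pot u ub ^+ 2)%:E <= k)%E ->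
  (weighted_sq s phiu ub <= 2%:E * (M ^+ 2)%:E + 2%:E * k)%E.
Proof.
move=> ub12 ubU hk.
have S := source_term_L2 ub12 ubU.
have msrc := measurable_source_term ub12.
have mpot := measurable_potential a cphi ub12.
have mw : measurable_fun (`[lowu ub, +oo[ : set R) (fun u => weight s u ub) by exact: measurable_weight.
have m1 : measurable_fun (`[lowu ub, +oo[ : set R) (fun u => (weight s u ub * src u ub ^+ 2)%:E).
  by apply/measurable_EFinP; apply: measurable_funM => //; exact: measurable_funX.
have m2 : measurable_fun (`[lowu ub, +oo[ : set R) (fun u => (weight s u ub * pot u ub ^+ 2)%:E).
  by apply/measurable_EFinP; apply: measurable_funM => //; exact: measurable_funX.
have p1 u : (0 <= (weight s u ub * src u ub ^+ 2)%:E)%E by rewrite lee_fin mulr_ge0 ?weight_ge0 ?sqr_ge0.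
have p2 u : (0 <= (weight s u ub * pot u ub ^+ 2)%:E)%E by rewrite lee_fin mulr_ge0 ?weight_ge0 ?sqr_ge0.
apply: (@le_trans _ _ (\int[leb]_(u in `[lowu ub, +oo[)
    (2%:E * (weight s u ub * src u ub ^+ 2)%:E + 2%:E * (weight s u ub * pot u ub ^+ 2)%:E))%E).
  apply: ge0_le_integral => //.
  - by move=> u _; rewrite lee_fin mulr_ge0 ?weight_ge0 ?sqr_ge0.
  - apply/measurable_EFinP; apply: measurable_funM => //.
    by apply: measurable_funX; exact: measurable_phiu.
  - by apply: emeasurable_funD; exact: measurable_funeM.
  - move=> u _; rewrite -!EFinM -EFinD lee_fin -/(weight s u ub).
    have -> : 2 * (weight s u ub * src u ub ^+ 2) + 2 * (weight s u ub * pot u ub ^+ 2) =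
      weight s u ub * (2 * src u ub ^+ 2 + 2 * pot u ub ^+ 2) by ring.
    apply: ler_wpM2l; first exact: weight_ge0.
    have -> : phiu u ub = src u ub - pot u ub by rewrite addrK.
    move: (src u ub) (pot u ub) => p q.
    have -> : 2 * p ^+ 2 + 2 * q ^+ 2 = (p - q) ^+ 2 + (p + q) ^+ 2 by ring.
    by rewrite lerDl sqr_ge0.
rewrite ge0_integralD//; first last.
- exact: measurable_funeM.
- by move=> u _; rewrite mule_ge0.
- exact: measurable_funeM.
- by move=> u _; rewrite mule_ge0.
rewrite ge0_integralZl// ge0_integralZl//.
by apply: leeD; apply: lee_wpmul2l.
Qed.

Lemma solution_norm ub k r : 1 / 2 <= ub -> ub <= Ub -> 0 <= k -> r < -1 ->
    (forall u, lowu ub <= u -> weight s u ub * pot u ub ^+ 2 <= k * u `^ r) ->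
    (weighted_sq s phiu ub <=
     (2 * M ^+ 2 + 2 * (k * (lowu ub `^ (r + 1) / - (r + 1))))%:E)%E.
Proof.
move=> ub12 ubU k0 r1 hk; have [l1 l2 l3] := lowuP ub.
have l0 : 0 < lowu ub by exact: lt_le_trans l1.
rewrite EFinD !EFinM; apply: weighted_sq_split => //.
have mp : measurable_fun (`[lowu ub, +oo[ : set R) (fun u : R => u `^ r) by apply: measurable_funTS.
apply: (@le_trans _ _ (\int[leb]_(u in `[lowu ub, +oo[) (k%:E * (u `^ r)%:E))%E).
  apply: ge0_le_integral => //.
  - by move=> u _; rewrite lee_fin mulr_ge0 ?weight_ge0 ?sqr_ge0.
  - apply/measurable_EFinP; apply: measurable_funM; first exact: measurable_weight.
    by apply: measurable_funX; exact: measurable_potential.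
  - by apply: measurable_funeM; exact/measurable_EFinP.
  - by move=> u; rewrite /= in_itv/= andbT => lu; rewrite -EFinM lee_fin hk.
rewrite ge0_integralZl//; first last.
- by move=> u _; rewrite lee_fin powR_ge0.
- exact/measurable_EFinP.
apply: lee_wpmul2l; first by rewrite lee_fin.
apply: integral_itvcy_le => //; first by move=> u _; exact: powR_ge0.
by move=> b lb; exact: integral_powR_tail_le.
Qed.

(** A lower bound c / u for the weighted square of the potential would make the
integral of 1 / u converge. *)
Lemma solution_diverge ub c U : 1 / 2 <= ub -> ub <= Ub ->
    (weighted_sq s phiu ub < +oo)%E -> 0 < c -> lowu ub <= U ->
    ~ (forall u, U <= u -> c / u <= weight s u ub * pot u ub ^+ 2).
Proof.
move=> ub12 ubU wfin c0 lU hc; have [l1 l2 l3] := lowuP ub.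
have S := source_term_L2 ub12 ubU.
have msrc := measurable_source_term ub12.
have mpot := measurable_potential a cphi ub12.
have w0 : (0 <= weighted_sq s phiu ub)%E.
  by apply: integral_ge0 => u _; rewrite lee_fin mulr_ge0 ?sqr_ge0// weight_ge0.
have wf : weighted_sq s phiu ub \is a fin_num by rewrite ge0_fin_numE.
pose K := 2 * fine (weighted_sq s phiu ub) + 2 * M ^+ 2.
have K0 : 0 <= K by rewrite addr_ge0// mulr_ge0 ?sqr_ge0// fine_ge0.
have U0 : 0 < U by apply: lt_le_trans lU; exact: lt_le_trans l1.
have mw : measurable_fun (`[lowu ub, +oo[ : set R) (fun u => weight s u ub) by exact: measurable_weight.
have m1 : measurable_fun (`[lowu ub, +oo[ : set R) (fun u => (weight s u ub * src u ub ^+ 2)%:E).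
  by apply/measurable_EFinP; apply: measurable_funM => //; exact: measurable_funX.
have m2 : measurable_fun (`[lowu ub, +oo[ : set R) (fun u => (weight s u ub * phiu u ub ^+ 2)%:E).
  by apply/measurable_EFinP; apply: measurable_funM => //; apply: measurable_funX; exact: measurable_phiu.
have m3 : measurable_fun (`[lowu ub, +oo[ : set R) (fun u => (weight s u ub * pot u ub ^+ 2)%:E).
  by apply/measurable_EFinP; apply: measurable_funM => //; exact: measurable_funX.
have p1 u : (0 <= (weight s u ub * src u ub ^+ 2)%:E)%E by rewrite lee_fin mulr_ge0 ?weight_ge0 ?sqr_ge0.
have p2 u : (0 <= (weight s u ub * phiu u ub ^+ 2)%:E)%E by rewrite lee_fin mulr_ge0 ?weight_ge0 ?sqr_ge0.
have p3 u : (0 <= (weight s u ub * pot u ub ^+ 2)%:E)%E by rewrite lee_fin mulr_ge0 ?weight_ge0 ?sqr_ge0.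
have potK : (\int[leb]_(u in `[lowu ub, +oo[) (weight s u ub * pot u ub ^+ 2)%:E <= K%:E)%E.
  apply: (@le_trans _ _ (\int[leb]_(u in `[lowu ub, +oo[)
    (2%:E * (weight s u ub * phiu u ub ^+ 2)%:E + 2%:E * (weight s u ub * src u ub ^+ 2)%:E))%E).
    apply: ge0_le_integral => //.
    - by apply: emeasurable_funD; exact: measurable_funeM.
    - move=> u _; rewrite -!EFinM -EFinD lee_fin.
      have -> : 2 * (weight s u ub * phiu u ub ^+ 2) + 2 * (weight s u ub * src u ub ^+ 2) =
        weight s u ub * (2 * phiu u ub ^+ 2 + 2 * src u ub ^+ 2) by ring.
      apply: ler_wpM2l; first exact: weight_ge0.
      rewrite /source_term; move: (phiu u ub) (pot u ub) => p q.
      have -> : 2 * p ^+ 2 + 2 * (p + q) ^+ 2 = q ^+ 2 + (2 * p + q) ^+ 2 by ring.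
      by rewrite lerDl sqr_ge0.
  rewrite ge0_integralD//; first last.
  - exact: measurable_funeM.
  - by move=> u _; rewrite mule_ge0.
  - exact: measurable_funeM.
  - by move=> u _; rewrite mule_ge0.
  have -> : K%:E = (2%:E * weighted_sq s phiu ub + 2%:E * (M ^+ 2)%:E)%E.
    by rewrite /K EFinD !EFinM fineK.
  rewrite ge0_integralZl// ge0_integralZl//.
  by apply: leeD; apply: lee_wpmul2l.
have lnK (b : R) : U <= b -> c * (ln b - ln U) <= K.
  move=> Ub'.
  have cont : {within `[U, b], continuous (fun u : R => c / u)}.
    apply: continuous_in_subspaceT => u; rewrite inE/= in_itv/= => /andP[Uu _].
    apply: cvgM; first exact: cvg_cst.
    by apply: continuous_invr; rewrite gt_eqF// (lt_le_trans U0).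
  have iE : (\int[leb]_(u in `[U, b]) (c / u)%:E = (c * (ln b - ln U))%:E)%E.
    have dln u : U <= u -> u <= b -> is_derive u (1 : R) (fun u => c * ln u) (c / u).
      move=> Uu _; have u0 : 0 < u by exact: lt_le_trans Uu.
      have h := is_derive1_ln u0.
      exact: (is_deriveZ c h).
    have := Rintegral_FTC Ub' dln cont.
    rewrite -mulrBr /Rintegral => <-; rewrite fineK//; apply: integrable_fin_num => //.
    by apply: continuous_compact_integrable => //; exact: segment_compact.
  rewrite -lee_fin -iE; apply: le_trans potK.
  apply: (@le_trans _ _ (\int[leb]_(u in `[U, b]) (weight s u ub * pot u ub ^+ 2)%:E)%E).
    have sub : `[U, b]%classic `<=` (`[lowu ub, +oo[%classic : set R) by apply: subset_itv; rewrite bnd_simp.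
    apply: ge0_le_integral => //.
    - by move=> u; rewrite /= in_itv/= => /andP[Uu _]; rewrite lee_fin divr_ge0 ?(ltW c0)// (le_trans _ Uu)// ltW.
    - apply/measurable_EFinP; apply: subspace_continuous_measurable_fun => //.
    - exact: measurable_funS m3.
    - by move=> u; rewrite /= in_itv/= => /andP[Uu _]; rewrite lee_fin hc.
  apply: ge0_subset_integral => //.
  by apply: subset_itv; rewrite bnd_simp.
(* at this abscissa c times the logarithm of the ratio is K + 1 *)
have e1 : U <= U * expR ((K + 1) / c).
  rewrite ler_peMr ?(ltW U0)// -expR0 ler_expR divr_ge0 ?(ltW c0)//.
  exact: addr_ge0.
have := lnK _ e1; rewrite lnM ?posrE ?expR_gt0// expRK addrAC subrr add0r mulrC divfK ?gt_eqF//.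
by rewrite gerDl ler10.
Qed.

Lemma solution_flux_control : flux_control a s M Ub (clamp phi) phiu.
Proof.
split.
- exact: cphi.
- by move=> *; exact: solution_step.
- by move=> *; exact: solution_norm.
- by move=> *; exact: solution_diverge.
- by move=> *; exact: solution_cs.
- move=> ub ub12 ub1; rewrite clampE//.
  apply: le_trans M_init; exact: (initial_bound sol eps0 phi_vanish H1psi0 ub12 ub1).
- move=> ub ub1 _; rewrite clampE ?lowu_id//.
  by have [psi ->] := sol_radial sol; rewrite ?lowu_id// subrr mul0r.
Qed.

End solution_flux.

(** * The weighted estimate *)

Section main.
Context (R : realType).
Local Notation leb := (@lebesgue_measure R).

(** It blows up as s increases to 3/4: the potential is of order u^-2, and its
weighted square, of order u^(4 s - 4), ceases to be integrable there. *)
Definition regime_constant (s : R) : R :=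
  if s <= 1 / 2 then 15
  else if s < 3 / 4 then 2 + 2 * 80 ^+ 2 / (3 - 4 * s) ^+ 3 else 3.

Lemma regime_constant_gt0 s : 0 < regime_constant s.
Proof.
rewrite /regime_constant; case: ifP => // _; case: ifP => // s34.
by rewrite ltr_pwDl// divr_ge0// ?exprn_ge0//; lra.
Qed.

Lemma flux_control_bound a s M Ub phi phiu : 0 < a -> a <= 1 / 4 -> 0 <= s -> s <= 1 ->
  0 <= M -> flux_control a s M Ub phi phiu -> admissible s phiu Ub ->
  forall ub : R, 1 / 2 <= ub -> ub <= Ub ->
  (weighted_sq s phiu ub <= (regime_constant s * M ^+ 2)%:E)%E.
Proof.
move=> a0 a4 s0 s1 M0 fc adm ub ub12 ubU; rewrite /regime_constant.
case: ifPn => [s12|]; first exact: low_regime (ltW a0) a4 s0 s12 M0 fc ub12 ubU.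
rewrite -ltNge => /ltW s12; case: ifPn => [s34|].
  exact: mid_regime (ltW a0) a4 s12 s34 M0 fc ub12 ubU.
rewrite -leNgt => s34; apply: (high_regime a0 a4 s34 s1 M0 fc) => //.
exact: adm.
Qed.

Lemma powR_sqr_half (x : R) : 0 <= x -> (x ^+ 2) `^ (1 / 2) = x.
Proof.
move=> x0; rewrite -powR_mulrn// -powRrM.
by rewrite (_ : _ * _ = 1) ?powRr1//; field.
Qed.

Lemma sqL2_ge0 (f : R * R * R -> R) : (0 <= sqL2 f)%E.
Proof. by apply: integral_ge0 => x _; rewrite lee_fin sqr_ge0. Qed.

Lemma in_L2_fin_num (f : R * R * R -> R) : in_L2 f -> sqL2 f \is a fin_num.
Proof. by move=> [_ h]; rewrite ge0_fin_numE// sqL2_ge0. Qed.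

(** Chosen so that its square dominates both 84 / |S^2| and 4, see
[data_constant_sq]. *)
Definition data_constant : R := 2 + 21 / sphere_area R.

Lemma data_constant_sq : 4 + 84 / sphere_area R <= data_constant ^+ 2.
Proof.
rewrite /data_constant; have -> : (2 + 21 / sphere_area R) ^+ 2 =
  4 + 84 / sphere_area R + (21 / sphere_area R) ^+ 2 by ring.
by rewrite lerDl sqr_ge0.
Qed.

End main.

Theorem lemma2p3 (R : realType) (mu s : R)
    (mu_gt0 : 0 < mu) (mu_lt2 : mu < 2) (s_ge0 : 0 <= s) (s_le1 : s <= 1) :
  exists C : R, 0 < C /\
  forall (phi phiu phiub G : R -> R -> R) (psi0 psi1 : R -> R)
         (dpsi0 : 'I_3 -> R * R * R -> R) (eps Ub : R),
    0 < eps ->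
    1 / 2 <= Ub ->
    in_H1 (radial psi0) dpsi0 ->
    in_L2 (radial psi1) ->
    (forall r, 1 < r -> psi0 r = 0) ->
    (forall r, 1 < r -> psi1 r = 0) ->
    solution mu phi phiu phiub G eps psi0 psi1 ->
    (forall u ub, lowu ub <= u -> ub <= 1 / 2 -> phi u ub = 0) ->
    admissible s phiu Ub ->
    (ereal_sup [set weighted_sq s phiu ub `^ (1 / 2) | ub in `[(1 / 2)%R, Ub]]
     <= C%:E *
        (eps%:E * (sqH1 (radial psi0) dpsi0 + sqL2 (radial psi1)) `^ (1 / 2)
         + \int[@leb1 R]_(ub in `[(1 / 2)%R, Ub])
             weighted_sq s G ub `^ (1 / 2)))%E.
Proof.
have A0 := sphere_area_gt0 R.
have L0 := regime_constant_gt0 s.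
have C0 : 0 < data_constant R by rewrite ltr_pwDl// divr_ge0// ltW.
have h12 : (0 : R) <= 1 / 2 by rewrite divr_ge0.
exists (regime_constant s `^ (1 / 2) * data_constant R); split.
  by rewrite mulr_gt0// powR_gt0.
move=> phi phiu phiub G psi0 psi1 dpsi0 eps Ub eps0 Ub12 H1psi0 L2psi1 _ _ sol phi_vanish adm.
set C := _ * data_constant R.
have Cpos : 0 < C by rewrite mulr_gt0// powR_gt0.
set S := (\int[_]_(ub in _) _)%E.
have S0 : (0 <= S)%E by apply: integral_ge0 => x _; exact: poweR_ge0.
set E := (sqH1 _ _ + _)%E.
have [/eqP Sy|Sy] := boolP (S == +oo%E).
  rewrite Sy addey; last by rewrite gt_eqF// (lt_le_trans ltNy0)// mule_ge0 ?lee_fin ?(ltW eps0)// poweR_ge0.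
  by rewrite gt0_muley ?lte_fin// leey.
have Sfin : S \is a fin_num by rewrite ge0_fin_numE// lt_neqAle Sy leey.
pose I := fine S.
have I0 : 0 <= I by exact: fine_ge0.
have [L2psi0 L2d _] := H1psi0.
pose e := fine (sqL2 (radial psi0)) + data_energy psi1 dpsi0.
have g0 := gradient_energy_ge0 dpsi0.
have p0 : 0 <= fine (sqL2 (radial psi1)) by rewrite fine_ge0// sqL2_ge0.
have q0 : 0 <= fine (sqL2 (radial psi0)) by rewrite fine_ge0// sqL2_ge0.
have d0 : 0 <= data_energy psi1 dpsi0 by rewrite addr_ge0.
have e0 : 0 <= e by rewrite addr_ge0.
have EE : E = e%:E.
  have sE : (\sum_(i < 3) sqL2 (dpsi0 i) = (gradient_energy dpsi0)%:E)%E.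
    by rewrite /gradient_energy -sumEFin; apply: eq_bigr => i _; rewrite fineK// in_L2_fin_num.
  rewrite /E /sqH1 sE -(fineK (in_L2_fin_num L2psi0)) -(fineK (in_L2_fin_num L2psi1)) -!EFinD.
  by rewrite /e /data_energy addrA.
pose r := e `^ (1 / 2).
have r0 : 0 <= r by exact: powR_ge0.
have rr : r ^+ 2 = e by rewrite powR_half_sq.
pose M := data_constant R * (eps * r + I).
have M0 : 0 <= M by rewrite mulr_ge0 ?(ltW C0)// addr_ge0// mulr_ge0// ltW.
have source_I : (\int[@lebesgue_measure R]_(x in `[(1 / 2)%R, Ub]) weighted_sq s G x `^ (1 / 2) <= I%:E)%E.
  by rewrite fineK.
have D2 := data_constant_sq R.
have iA0 : 0 <= (sphere_area R)^-1 by rewrite invr_ge0 ltW.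
have M_large : 81 / (4 * sphere_area R) * (eps ^+ 2 * data_energy psi1 dpsi0) + 2 * I ^+ 2 <= M ^+ 2.
  have de : eps ^+ 2 * data_energy psi1 dpsi0 <= eps ^+ 2 * e by rewrite ler_wpM2l ?sqr_ge0// lerDr.
  have ee0 : 0 <= eps ^+ 2 * e by rewrite mulr_ge0// sqr_ge0.
  apply: (@le_trans _ _ ((4 + 84 / sphere_area R) * (eps ^+ 2 * e + I ^+ 2))).
    rewrite [leRHS]mulrDr; apply: lerD.
      have n0 : 0 <= 4 * sphere_area R by rewrite mulr_ge0// ltW.
      apply: ler_pM => //; first by rewrite mulr_ge0 ?invr_ge0//.
        by rewrite mulr_ge0 ?sqr_ge0.
      rewrite invfM mulrA; apply: (@le_trans _ _ (84 / sphere_area R)); last by rewrite lerDr.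
      by rewrite ler_wpM2r// ler_pdivrMr// -natrM ler_nat.
    rewrite ler_wpM2r ?sqr_ge0// (@le_trans _ _ 4)// ?ler_nat//.
    by rewrite lerDl mulr_ge0.
  apply: (@le_trans _ _ (data_constant R ^+ 2 * (eps ^+ 2 * e + I ^+ 2))).
    by rewrite ler_wpM2r// addr_ge0// sqr_ge0.
  rewrite /M exprMn ler_wpM2l ?sqr_ge0// -rr.
  have -> : (eps * r + I) ^+ 2 = eps ^+ 2 * r ^+ 2 + I ^+ 2 + 2 * (eps * r * I) by ring.
  by rewrite lerDl !mulr_ge0// ltW.
have M_init : eps * Num.sqrt (2 / sphere_area R * gradient_energy dpsi0) <= M.
  apply: (@le_trans _ _ (eps * (data_constant R * r))); last first.
    by rewrite /M mulrCA ler_wpM2l ?(ltW C0)// lerDl.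
  rewrite ler_pM2l//.
  have Dr0 : 0 <= data_constant R * r by rewrite mulr_ge0// ltW.
  rewrite -(ger0_norm Dr0) -sqrtr_sqr ler_wsqrtr// exprMn rr.
  apply: ler_pM => //; first by rewrite mulr_ge0.
    apply: le_trans D2; apply: (@le_trans _ _ (84 / sphere_area R)); last by rewrite lerDr.
    by rewrite ler_wpM2r// ler_nat.
  by rewrite /e /data_energy addrCA lerDl addr_ge0.
have fc := solution_flux_control sol s_ge0 s_le1 eps0 I0 M0 phi_vanish H1psi0 L2psi1 source_I M_large M_init.
have a0 : 0 < mu * (2 - mu) / 4 by rewrite divr_gt0// mulr_gt0// subr_gt0.
have a4 : mu * (2 - mu) / 4 <= 1 / 4.
  by have := sqr_ge0 (mu - 1); rewrite ler_pM2r ?invr_gt0//; nra.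
apply: ge_ereal_sup => _ /= [ub + <-]; rewrite in_itv/= => /andP[ub1 ub2].
have bound := flux_control_bound a0 a4 s_ge0 s_le1 M0 fc adm ub1 ub2.
apply: (@le_trans _ _ ((regime_constant s * M ^+ 2)%:E `^ (1 / 2))%E).
  apply: (gt0_ler_poweR h12); rewrite ?in_itv/= ?leey ?andbT//.
    by apply: integral_ge0 => u _; rewrite lee_fin mulr_ge0 ?sqr_ge0// mulr_ge0 ?powR_ge0.
  by rewrite lee_fin mulr_ge0 ?sqr_ge0// ltW.
have -> : (C%:E * (eps%:E * E `^ (1 / 2) + S) = (C * (eps * r + I))%:E)%E.
  by rewrite [in RHS]EFinM EFinD EFinM /I fineK// EE poweR_EFin.
rewrite poweR_EFin lee_fin.
rewrite powRM ?sqr_ge0 ?(ltW L0)// powR_sqr_half// /C /M mulrA.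
exact: lexx.
Qed.
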